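(* (i) For every initial datum $U_0\in\mathcal{H}$ there exists a unique solution $U\in C([0,+\infty),\mathcal{H})$ of the problem $U'=\mathcal{A}U$, $U(0)=U_0$. Moreover, if $U_0\in\mathcal{D}(\mathcal{A})$, then $U\in C([0,+\infty),\mathcal{D}(\mathcal{A}))\cap C^1([0,+\infty),\mathcal{H})$. (ii) The solution $\underline{u}$ of $(P)$ with initial datum in $\mathcal{D}(\mathcal{A})$ satisfies $$E'(t)=-|\partial_tu_0(t,0)|^2\le 0 ;$$ therefore the energy is decreasing (that is, nonincreasing in $t$).
   Context: Let $N\ge 1$ be an integer and $\rho_0,\dots,\rho_{N-1}>0$ constants. System $(P)$ is, for unknowns $u_j(t,x)$, $x\in(j,j+1)$, $t\in(0,\infty)$, $j=0,\dots,N-1$: $$\begin{cases}\partial_t^2u_j-\rho_j\partial_x^2u_j=0 \text{ on } (0,\infty)\times(j,j+1), & j=0,\dots,N-1,\\ \rho_0\partial_xu_0(t,0)=\partial_tu_0(t,0),\quad u_{N-1}(t,N)=0,\\ u_{j-1}(t,j)=u_j(t,j), & j=1,\dots,N-1,\\ -\rho_{j-1}\partial_xu_{j-1}(t,j)+\rho_j\partial_xu_j(t,j)=0, & j=1,\dots,N-1,\\ u_j(0,x)=u_j^0(x),\ \partial_tu_j(0,x)=u_j^1(x), & j=0,\dots,N-1.\end{cases}$$ All functions are complex valued. Let $$V=\Big\{\underline{u}=(u_0,\dots,u_{N-1})\in\prod_{j=0}^{N-1}H^1(j,j+1):\ u_{N-1}(N)=0,\ u_{j-1}(j)=u_j(j),\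 j=1,\dots,N-1\Big\}$$ and $\mathcal{H}=V\times\prod_{j=0}^{N-1}L^2(j,j+1)$, a Hilbert space with inner product $$\langle(\underline{u},\underline{v}),(\underline{\tilde u},\underline{\tilde v})\rangle_{\mathcal{H}}=\sum_{j=0}^{N-1}\int_j^{j+1}\left(v_j\overline{\tilde v_j}+\rho_j\partial_xu_j\,\partial_x\overline{\tilde u_j}\right)dx.$$ Let $\mathcal{A}(\underline{u},\underline{v})=(\underline{v},(\rho_j\partial_x^2u_j)_{0\le j\le N-1})$ with domain $$\mathcal{D}(\mathcal{A})=\Big\{(\underline{u},\underline{v})\in\Big(V\cap\prod_{j=0}^{N-1}H^2(j,j+1)\Big)\times V:\ \rho_0\partial_xu_0(0)=v_0(0),\ \rho_{j-1}\partial_xu_{j-1}(j)=\rho_j\partial_xu_j(j),\ 1\le j\le N-1\Big\},$$ equipped with the graph norm. System $(P)$ is the first order problem $U'=\mathcal{A}U$, $U(0)=U_0=(\underline{u}^0,\underline{u}^1)$ with $U=(\underline{u},\partial_t\underline{u})$; for $U_0\in\mathcal{H}$, ''solution'' means mild solution. The energy is $$E(t)=\frac12\sum_{j=0}^{N-1}\int_j^{j+1}\left(|\partial_tu_j(t,x)|^2+\rho_j|\partial_xu_j(t,x)|^2\right)dx.$$ *)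

(* Defs.v *)
(* Elements of L^2, H^1, V and H are represented by functions.  Every notion
   below depends only on the a.e. class of these functions on the intervals
   ]j, j+1[ (values elsewhere are irrelevant), and equality in H is [Heq]. *)
From mathcomp Require Import all_boot all_order all_algebra.
From mathcomp Require Import all_classical all_reals all_analysis.
From mathcomp Require Export complex.
Set Implicit Arguments.
Unset Strict Implicit.
Unset Printing Implicit Defensive.
Import Order.TTheory GRing.Theory Num.Theory.
Import numFieldNormedType.Exports.
Local Open Scope classical_set_scope.
Local Open Scope ring_scope.
Local Open Scope complex_scope.

Definition cell {R : realType} (j : nat) : set R := `]j%:R, j.+1%:R[.

Definition cint {R : realType} (D : set R) (f : R -> R[i]) : R[i] :=
  Rintegral lebesgue_measure D (fun x => complex.Re (f x)) +i*
  Rintegral lebesgue_measure D (fun x => complex.Im (f x)).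

Definition L2 {R : realType} (D : set R) (f : R -> R[i]) : Prop :=
  [/\ measurable_fun D (fun x => complex.Re (f x)),
      measurable_fun D (fun x => complex.Im (f x)) &
      lebesgue_measure.-integrable D (fun x => (Normc.normc (f x) ^+ 2)%:E)].

(* C^1 functions with compact support in ]j, j+1[; as in Brezis, chapter 8,
   these are the test functions for weak derivatives on an interval (real-valued
   ones suffice, the relation below being complex linear in the test function) *)
Definition test_fun {R : realType} (j : nat) (phi : R -> R) : Prop :=
  [/\ forall x, derivable phi x 1, continuous (derive1 phi) &
      exists a b, `[a, b] `<=` cell (R := R) j /\
        (forall x, ~ `[a, b]%classic x -> phi x = 0)].

Definition weak_deriv {R : realType} (j : nat) (u g : R -> R[i]) : Prop :=
  forall phi, test_fun j phi ->
    cint (cell j) (fun x => u x * (derive1 phi x)%:C) =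
    - cint (cell j) (fun x => g x * (phi x)%:C).

Definition H1 {R : realType} (j : nat) (u : R -> R[i]) : Prop :=
  L2 (cell j) u /\ exists2 g, L2 (cell j) g & weak_deriv j u g.

(* the L^2 weak derivative of u on ]j, j+1[ (unique a.e.), for u in H^1 *)
Definition wd {R : realType} (j : nat) (u : R -> R[i]) : R -> R[i] :=
  xget (fun=> 0) [set g | L2 (cell j) g /\ weak_deriv j u g].

Definition H2 {R : realType} (j : nat) (u : R -> R[i]) : Prop :=
  H1 j u /\ H1 j (wd j u).

Definition cont_rep {R : realType} (j : nat) (u w : R -> R[i]) : Prop :=
  [/\ {within `[j%:R, j.+1%:R], continuous (fun x => complex.Re (w x))},
      {within `[j%:R, j.+1%:R], continuous (fun x => complex.Im (w x))} &
      ae_eq lebesgue_measure (cell j) w u].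

(* the value at x in [j, j+1] of the continuous representative of u in H^1 *)
Definition trace {R : realType} (j : nat) (u : R -> R[i]) (x : R) : R[i] :=
  xget (fun=> 0) [set w | cont_rep j u w] x.

Definition components (R : realType) (N : nat) := 'I_N -> R -> R[i].

(* pairs (u, v); addition and scaling by R[i] are the pointwise ones *)
Definition state (R : realType) (N : nat) := (components R N * components R N)%type.

Definition inV {R : realType} {N : nat} (u : components R N) : Prop :=
  [/\ forall j : 'I_N, H1 j (u j),
      forall j : 'I_N, j.+1 = N -> trace j (u j) N%:R = 0 &
      forall i j : 'I_N, i.+1 = j ->
        trace i (u i) j%:R = trace j (u j) j%:R].

Definition inH {R : realType} {N : nat} (U : state R N) : Prop :=
  inV U.1 /\ (forall j : 'I_N, L2 (cell j) (U.2 j)).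

Definition Heq {R : realType} {N : nat} (U W : state R N) : Prop :=
  forall j : 'I_N, ae_eq lebesgue_measure (cell j) (U.1 j) (W.1 j) /\
                   ae_eq lebesgue_measure (cell j) (U.2 j) (W.2 j).

Definition Hdot {R : realType} {N : nat} (rho : 'I_N -> R)
    (U W : state R N) : R[i] :=
  \sum_(j < N) cint (cell j) (fun x => U.2 j x * (W.2 j x)^* +
    (rho j)%:C * wd j (U.1 j) x * (wd j (W.1 j) x)^*).

Definition Hnorm {R : realType} {N : nat} (rho : 'I_N -> R)
    (U : state R N) : R :=
  Num.sqrt (complex.Re (Hdot rho U U)).

Definition opA {R : realType} {N : nat} (rho : 'I_N -> R)
    (U : state R N) : state R N :=
  (U.2, fun j x => (rho j)%:C * wd j (wd j (U.1 j)) x).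

Definition inDA {R : realType} {N : nat} (rho : 'I_N -> R)
    (U : state R N) : Prop :=
  [/\ inV U.1 /\ (forall j : 'I_N, H2 j (U.1 j)),
      inV U.2,
      forall j : 'I_N, j = 0%N :> nat ->
        (rho j)%:C * trace j (wd j (U.1 j)) 0 = trace j (U.2 j) 0 &
      forall i j : 'I_N, i.+1 = j ->
        (rho i)%:C * trace i (wd i (U.1 i)) j%:R =
        (rho j)%:C * trace j (wd j (U.1 j)) j%:R].

Definition graph_norm {R : realType} {N : nat} (rho : 'I_N -> R)
    (U : state R N) : R :=
  Hnorm rho U + Hnorm rho (opA rho U).

(* Functions of time are only considered on [0, +oo[: limits are one-sided
   at 0. *)
Definition halfline {R : realType} : set R := [set t | 0 <= t].

Definition contH {R : realType} {N : nat} (rho : 'I_N -> R)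
    (U : R -> state R N) : Prop :=
  forall t : R, 0 <= t -> inH (U t) /\
    Hnorm rho (U s - U t) @[s --> within halfline (nbhs t)] --> 0.

Definition contDA {R : realType} {N : nat} (rho : 'I_N -> R)
    (U : R -> state R N) : Prop :=
  forall t : R, 0 <= t -> inDA rho (U t) /\
    graph_norm rho (U s - U t) @[s --> within halfline (nbhs t)] --> 0.

Definition derivH {R : realType} {N : nat} (rho : 'I_N -> R)
    (U : R -> state R N) (t : R) (W : state R N) : Prop :=
  inH W /\
  Hnorm rho (((s - t)^-1)%:C *: (U s - U t) - W)
    @[s --> within halfline t^'] --> 0.

Definition C1H {R : realType} {N : nat} (rho : 'I_N -> R)
    (U : R -> state R N) : Prop :=
  contH rho U /\
  exists2 dU, contH rho dU & forall t : R, 0 <= t -> derivH rho U t (dU t).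

(* for s = [:: t_1; ...; t_n] and t_0 = 0, the Riemann sum
   \sum_(i < n) (t_(i+1) - t_i) U(tag i) *)
Definition riemann_sum {R : realType} {N : nat} (U : R -> state R N)
    (s : seq R) (tag : nat -> R) : state R N :=
  \sum_(i < size s) (s`_i - (0 :: s)`_i)%:C *: U (tag i).

(* W is the H-valued Riemann integral of U over [0, t] *)
Definition is_intH {R : realType} {N : nat} (rho : 'I_N -> R)
    (U : R -> state R N) (t : R) (W : state R N) : Prop :=
  inH W /\
  forall e : R, 0 < e -> exists2 d : R, 0 < d &
    forall (s : seq R) (tag : nat -> R), itv_partition 0 t s ->
      (forall i, (i < size s)%N ->
        (0 :: s)`_i <= tag i <= s`_i /\ s`_i - (0 :: s)`_i < d) ->
      Hnorm rho (riemann_sum U s tag - W) < e.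

(* the integrated equation U(t) = U0 + A \int_0^t U(s) ds; the initial condition
   is its case t = 0, stated for readability *)
Definition mild_solution {R : realType} {N : nat} (rho : 'I_N -> R)
    (U0 : state R N) (U : R -> state R N) : Prop :=
  [/\ contH rho U, Heq (U 0) U0 &
      forall t : R, 0 <= t -> exists W,
        [/\ is_intH rho U t W, inDA rho W & Heq (U t) (U0 + opA rho W)]].

(* energy of U = (u, d_t u) *)
Definition energy {R : realType} {N : nat} (rho : 'I_N -> R)
    (U : R -> state R N) (t : R) : R :=
  2^-1 * \sum_(j < N) Rintegral lebesgue_measure (cell j) (fun x =>
    Normc.normc ((U t).2 j x) ^+ 2 + rho j * Normc.normc (wd j ((U t).1 j) x) ^+ 2).

Definition derivR {R : realType} (f : R -> R) (t l : R) : Prop :=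
  (s - t)^-1 * (f s - f t) @[s --> within halfline t^'] --> l.

(* Main.v *)
(* Existence comes from d'Alembert's formula. With c_j = sqrt(rho_j), the Riemann
   invariants v - c_j u' and v + c_j u' are carried along the characteristics of
   the j-th cell by signals leaving its left and its right end. The boundary and
   transmission conditions express each signal at time t > 0 by signals at times
   at most t - min_j 1/c_j, so they determine all signals step by step from the
   Riemann invariants of the initial datum. Then v and u' are combinations of the
   signals, u of their primitives, and the time integral of u of their second
   primitives, which lies in D(A). Continuity in the energy norm is the continuity
   of translations in L^2; with Tonelli's theorem it also yields the convergence of
   the Riemann sums.

   Uniqueness and regularity come from Re <AU, U> = - |v_0(0)|^2, which makes the
   norm of a classical solution nonincreasing. The difference of the time integrals
   of two mild solutions is a classical solution vanishing at time 0. If U_0 lies in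
   D(A) and V is the mild solution with datum A U_0, then Z = U_0 + int V is a
   classical solution; the difference quotients of int U are classical solutions
   too, and comparing them with Z gives U = Z.

   Functions of H^1 are handled by du Bois-Reymond's lemma: they are a.e. equal to a
   primitive of their weak derivative. *)
Require Import Defs.
From mathcomp Require Import all_boot all_order all_algebra.
From mathcomp Require Import all_classical all_reals all_analysis.
From mathcomp Require Import measurable_realfun.
From mathcomp Require Import ring lra.
Set Implicit Arguments.
Unset Strict Implicit.
Unset Printing Implicit Defensive.
Import Order.TTheory GRing.Theory Num.Theory.
Local Open Scope ring_scope.

(** * Weak derivatives and primitives *)


Section SquareIntegrable.
Import numFieldNormedType.Exports.
Local Open Scope classical_set_scope.
Context {R : realType}.
Notation mu := (@lebesgue_measure R).
Implicit Types (D : set R) (f g : R -> R).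

(** A state is a pair of functions, and [wd] and [trace] are choices: [opA] is linear only up to
    [Heq], and identities between states must be carried along [Heq]. The predicates [primitive_on]
    and [isH1] avoid the choices by exhibiting a continuous representative and a derivative. All
    coefficients are real, so real and imaginary parts never interact and the analysis is done for
    real functions.

    The integrated equation shapes the existence proof. For a datum merely in H the signals are only
    locally square integrable, but by construction they satisfy the node relations at every positive
    time. Integration in time preserves a linear relation up to its value at time 0. For the
    displacement this constant vanishes because the datum lies in V; for the time integral it is
    removed by subtracting the value at time 0. That is why the time integral meets all the
    conditions of D(A).

    The node relations can be solved for the emitted signals because the determinants c_i + c_(i+1)
    and c_0 + 1 are positive. *)

Definition sqint D f :=
  measurable_fun D f /\ mu.-integrable D (fun x => (f x ^+ 2)%:E).

Lemma sqintM D f g : measurable D -> sqint D f -> sqint D g ->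
  mu.-integrable D (fun x => (f x * g x)%:E).
Proof.
move=> mD [mf f2] [mg g2].
apply: (@le_integrable _ _ _ mu D mD _ (fun x => (f x ^+ 2)%:E + (g x ^+ 2)%:E)%E).
- by apply/measurable_EFinP; exact: measurable_funM.
- move=> x _; rewrite -EFinD !abse_EFin lee_fin.
  rewrite [leRHS]ger0_norm ?addr_ge0 ?sqr_ge0//.
  rewrite normrM -(real_normK (num_real (f x))) -(real_normK (num_real (g x))).
  by nra.
- exact: integrableD.
Qed.

Lemma sqintD D f g : measurable D -> sqint D f -> sqint D g ->
  sqint D (fun x => f x + g x).
Proof.
move=> mD sf sg; split; first by apply: measurable_funD; [case: sf|case: sg].
have -> : (fun x => ((f x + g x) ^+ 2)%:E) =
  (fun x => ((f x ^+ 2)%:E + ((f x * g x)%:E + (f x * g x)%:E) + (g x ^+ 2)%:E)%E).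
  by apply/funext => x; rewrite -!EFinD; congr EFin; ring.
apply: integrableD => //; last by case: sg.
apply: integrableD => //; first by case: sf.
by apply: integrableD => //; exact: sqintM.
Qed.

Lemma sqintZ D f (k : R) : measurable D -> sqint D f -> sqint D (fun x => k * f x).
Proof.
move=> mD [mf f2]; split; first exact: measurable_funM.
have -> : (fun x => ((k * f x) ^+ 2)%:E) = (fun x => (k ^+ 2)%:E * (f x ^+ 2)%:E)%E.
  by apply/funext => x; rewrite -EFinM exprMn.
exact: integrableZl.
Qed.

Lemma sqintN D f : measurable D -> sqint D f -> sqint D (fun x => - f x).
Proof.
move=> mD sf; have := sqintZ (-1) mD sf.
by under eq_fun do rewrite mulN1r.
Qed.

Lemma sqintB D f g : measurable D -> sqint D f -> sqint D g ->
  sqint D (fun x => f x - g x).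
Proof. by move=> mD sf sg; apply: sqintD => //; exact: sqintN. Qed.

Lemma sqint_cst D (k : R) : measurable D -> (mu D < +oo)%E -> sqint D (fun=> k).
Proof.
move=> mD muD; split; first exact: measurable_cst.
apply/integrableP; split; first exact: measurable_cst.
rewrite integral_cst//= lte_mul_pinfty// ltry//.
Qed.

Lemma sqint_integrable D f : measurable D -> (mu D < +oo)%E -> sqint D f ->
  mu.-integrable D (EFin \o f).
Proof.
move=> mD muD sf; have := sqintM mD sf (sqint_cst 1 mD muD).
by under eq_fun do rewrite mulr1.
Qed.

Lemma sqintS D E f : measurable D -> measurable E -> D `<=` E -> sqint E f -> sqint D f.
Proof.
move=> mD mE DE [mf f2]; split; first exact: measurable_funS mf.
exact: integrableS f2.
Qed.

Lemma eq_sqint D f g : measurable D -> (forall x, D x -> f x = g x) -> sqint D f -> sqint D g.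
Proof.
move=> mD fg [mf f2]; split; first by apply: eq_measurable_fun mf => x /set_mem /fg.
by apply: eq_integrable f2 => // x /set_mem /fg ->.
Qed.

Lemma sqint_restrict D f : measurable D -> sqint D f -> sqint setT (f \_ D).
Proof.
move=> mD [mf f2]; split; first by apply/(measurable_restrictT f mD).
have -> : (fun x => ((f \_ D) x ^+ 2)%:E) = (fun x => (f x ^+ 2)%:E) \_ D.
  by apply/funext => x; rewrite !patchE; case: ifP => // _; rewrite expr0n.
by rewrite -(@integrable_mkcond _ _ _ mu).
Qed.

Lemma L2P D (u : R -> R[i]) : measurable D ->
  L2 D u <-> sqint D (fun x => complex.Re (u x)) /\ sqint D (fun x => complex.Im (u x)).
Proof.
move=> mD.
have E : (fun x => (Normc.normc (u x) ^+ 2)%:E) =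
   (fun x => (complex.Re (u x) ^+ 2)%:E + (complex.Im (u x) ^+ 2)%:E)%E.
  apply/funext => x; rewrite -EFinD; congr EFin; case: (u x) => a b /=.
  by rewrite sqr_sqrtr// addr_ge0 ?sqr_ge0.
rewrite /L2 E; split => [[mr mi i2]|[[mr r2] [mi i2]]]; last first.
  by split => //; exact: integrableD.
split; split => //; apply: (@le_integrable _ _ _ mu D mD _ _ _ _ i2).
- exact/measurable_EFinP/measurable_funX.
- by move=> x _; rewrite -EFinD !abse_EFin lee_fin !ger0_norm ?addr_ge0 ?sqr_ge0// lerDl sqr_ge0.
- exact/measurable_EFinP/measurable_funX.
- by move=> x _; rewrite -EFinD !abse_EFin lee_fin !ger0_norm ?addr_ge0 ?sqr_ge0// lerDr sqr_ge0.
Qed.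

Lemma sqint_norm0 D f : measurable D -> sqint D f ->
  \int[mu]_(x in D) (f x * f x) = 0 -> ae_eq mu D f (cst 0).
Proof.
move=> mD sf f0.
have If := sqintM mD sf sf.
have mff : measurable_fun D (fun x => (f x * f x)%:E) by exact: (measurable_int mu).
have : ae_eq mu D (fun x => (f x * f x)%:E) (cst 0%E).
  apply/(ae_eq_integral_abs mu mD mff).
  under eq_integral do rewrite gee0_abs ?lee_fin -?expr2 ?sqr_ge0// expr2.
  by rewrite -[LHS]fineK; [congr EFin|exact: integrable_fin_num].
by apply: filterS => x /= h Dx; move: (h Dx) => [] /eqP; rewrite mulf_eq0 orbb => /eqP.
Qed.

End SquareIntegrable.


(** * Fubini's theorem and integration by parts for primitives *)

Section Primitives.
Import numFieldNormedType.Exports.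
Local Open Scope classical_set_scope.
Context {R : realType}.
Notation mu := (@lebesgue_measure R).
Implicit Types (D : set R) (f g : R -> R) (a b : R).

Lemma Rintegral_Fubini (h : R * R -> R) :
  (mu \x mu)%E.-integrable setT (EFin \o h) ->
  (forall x, mu.-integrable setT (fun y => (h (x, y))%:E)) ->
  (forall y, mu.-integrable setT (fun x => (h (x, y))%:E)) ->
  \int[mu]_x \int[mu]_y h (x, y) = \int[mu]_y \int[mu]_x h (x, y).
Proof.
move=> ih h1 h2; rewrite /Rintegral; congr fine.
under eq_integral do rewrite fineK ?integrable_fin_num//.
under [RHS]eq_integral do rewrite fineK ?integrable_fin_num//.
exact: (Fubini ih).
Qed.

Lemma integrable_prodmul f g (k : R * R -> R) :
  mu.-integrable setT (EFin \o f) -> mu.-integrable setT (EFin \o g) ->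
  measurable_fun setT k -> (forall z, `|k z| <= 1) ->
  (mu \x mu)%E.-integrable setT (fun z => (f z.1 * g z.2 * k z)%:E).
Proof.
move=> If Ig mk k1.
have mf : measurable_fun setT f by apply/measurable_EFinP; exact: (measurable_int mu).
have mg : measurable_fun setT g by apply/measurable_EFinP; exact: (measurable_int mu).
have mfg : measurable_fun setT (fun z : R * R => f z.1 * g z.2).
  by apply: measurable_funM; [exact: measurableT_comp|exact: measurableT_comp].
suff Ifg : (mu \x mu)%E.-integrable setT (fun z => (f z.1 * g z.2)%:E).
  apply: (le_integrable measurableT _ _ Ifg).
  - by apply/measurable_EFinP; exact: measurable_funM.
  - by move=> z _; rewrite !abse_EFin lee_fin normrM ler_piMr.
apply/integrable12ltyP; first exact/measurable_EFinP.
rewrite /=.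
under eq_integral => x _.
  under eq_integral => y _.
    rewrite normrM EFinM.
    over.
  rewrite ge0_integralZl//; last first.
    by apply/measurable_EFinP; exact: measurableT_comp.
  over.
rewrite ge0_integralZr//; last first.
- exact: integral_ge0.
- by apply/measurable_EFinP; exact: measurableT_comp.
apply: lte_mul_pinfty.
- exact: integral_ge0.
- by rewrite ge0_fin_numE ?integral_ge0//; case/integrableP: If.
- by case/integrableP: Ig.
Qed.

Lemma integrable_mull1 g (k : R -> R) : mu.-integrable setT (EFin \o g) ->
  measurable_fun setT k -> (forall z, `|k z| <= 1) ->
  mu.-integrable setT (fun y => (g y * k y)%:E).
Proof.
move=> Ig mk k1.
have mg : measurable_fun setT g by apply/measurable_EFinP; exact: (measurable_int mu).
apply: (le_integrable measurableT _ _ Ig).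
- by apply/measurable_EFinP; exact: measurable_funM.
- by move=> z _; rewrite !abse_EFin lee_fin normrM ler_piMr.
Qed.

(** A kernel bounded by 1 keeps the product of two integrable functions integrable on the plane. It
    is applied to the indicator of a half plane. *)
Lemma Fubini_prodmul f g (k : R -> R -> R) :
  mu.-integrable setT (EFin \o f) -> mu.-integrable setT (EFin \o g) ->
  measurable_fun setT (fun z : R * R => k z.1 z.2) -> (forall x y, `|k x y| <= 1) ->
  mu.-integrable setT (fun x => (f x * \int[mu]_y (g y * k x y))%:E) /\
  \int[mu]_x (f x * \int[mu]_y (g y * k x y)) =
  \int[mu]_y (g y * \int[mu]_x (f x * k x y)).
Proof.
move=> If Ig mk k1.
pose h (z : R * R) := f z.1 * g z.2 * k z.1 z.2.
have ih : (mu \x mu)%E.-integrable setT (EFin \o h).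
  exact: (@integrable_prodmul f g (fun z => k z.1 z.2)).
have mk1 x : measurable_fun setT (k x).
  exact: (measurableT_comp mk (pair1_measurable x)).
have mk2 y : measurable_fun setT (k ^~ y).
  exact: (measurableT_comp mk (pair2_measurable y)).
have i1 x : mu.-integrable setT (fun y => (g y * k x y)%:E) by exact: integrable_mull1.
have i2 y : mu.-integrable setT (fun x => (f x * k x y)%:E) by exact: integrable_mull1.
have h1 x : (fun y => (h (x, y))%:E) = (fun y => (f x)%:E * (g y * k x y)%:E)%E.
  by apply/funext => y; rewrite -EFinM /h mulrA.
have h2 y : (fun x => (h (x, y))%:E) = (fun x => (g y)%:E * (f x * k x y)%:E)%E.
  by apply/funext => x; rewrite -EFinM /h /=; congr EFin; ring.
have i1h x : mu.-integrable setT (fun y => (h (x, y))%:E).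
  by rewrite h1; exact: integrableZl.
have i2h y : mu.-integrable setT (fun x => (h (x, y))%:E).
  by rewrite h2; exact: integrableZl.
have e1 x : \int[mu]_y h (x, y) = f x * \int[mu]_y (g y * k x y).
  by rewrite -(RintegralZl _ measurableT (i1 x)); apply: eq_Rintegral => y _; rewrite /h mulrA.
have e2 y : \int[mu]_x h (x, y) = g y * \int[mu]_x (f x * k x y).
  by rewrite -(RintegralZl _ measurableT (i2 y)); apply: eq_Rintegral => x _; rewrite /h /=; ring.
split.
  apply: (eq_integrable measurableT _ _ _ (integrable_fubini_F ih)) => x _.
  by rewrite /fubini_F -e1 /Rintegral fineK// integrable_fin_num.
under eq_Rintegral do rewrite -e1.
by rewrite (Rintegral_Fubini ih i1h i2h); apply: eq_Rintegral => y _; rewrite e2.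
Qed.

Lemma integrable_patch D f : measurable D -> mu.-integrable D (EFin \o f) ->
  mu.-integrable setT (EFin \o (f \_ D)).
Proof. by move=> mD; rewrite -restrict_EFin -(@integrable_mkcond _ _ _ mu). Qed.

(** The square over [[a, b]] is cut along its diagonal, with [k] the indicator of [x < y], and
    Fubini's theorem exchanges the order of integration on one of the two triangles. *)
Lemma prim_parts a b f g :
  mu.-integrable `[a, b] (EFin \o f) -> mu.-integrable `[a, b] (EFin \o g) ->
  \int[mu]_(x in `[a, b]) (f x * \int[mu]_(y in `[a, x]) g y) +
  \int[mu]_(x in `[a, b]) (g x * \int[mu]_(y in `[a, x]) f y) =
  \int[mu]_(x in `[a, b]) f x * \int[mu]_(x in `[a, b]) g x.
Proof.
move=> If Ig.
pose F := f \_ `[a, b]; pose G := g \_ `[a, b].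
pose k (x y : R) : R := (x < y)%R%:R.
have mk : measurable_fun setT (fun z : R * R => k z.1 z.2).
  rewrite /k; apply: (measurableT_comp (f := fun b : bool => b%:R : R)) => //.
  exact: measurable_fun_ltr.
have k1 x y : `|k x y| <= 1 by rewrite /k; case: (x < y)%R; rewrite ?normr1 ?normr0.
have mk1 x : measurable_fun setT (k x) by exact: (measurableT_comp mk (pair1_measurable x)).
have sub x : a <= x <= b -> `[a, x] `<=` `[a, b].
  by move=> /andP[_ xb]; apply: subset_itvl; rewrite bnd_simp.
have kf y : a <= y <= b -> \int[mu]_x (F x * k x y) = \int[mu]_(x in `[a, y]) f x.
  move=> yab; rewrite -Rintegral_itv_bndo_bndc; last first.
    apply: integrableS If => //; apply: subset_trans (sub _ yab).
    exact: subset_itv_co_cc.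
  rewrite [RHS]Rintegral_mkcond; apply: eq_Rintegral => x _.
  rewrite /F /k !patchE; move: yab; rewrite !mem_setE !in_itv /=.
  case: (leP a x) => ax /=; last by rewrite mul0r.
  case: (ltP x y) => xy /andP[_ yb]; rewrite ?mulr1 ?mulr0//.
  by rewrite (le_trans (ltW xy) yb).
have kg x : a <= x <= b ->
    \int[mu]_y (G y * k x y) = \int[mu]_(x in `[a, b]) g x - \int[mu]_(y in `[a, x]) g y.
  move=> xab; have [ax0 xb] := andP xab.
  rewrite (@Rintegral_itvB _ g (BLeft a) (BRight b) x Ig) ?bnd_simp//.
  rewrite [RHS]Rintegral_mkcond; apply: eq_Rintegral => y _.
  rewrite /G /k !patchE; move: xab; rewrite !mem_setE !in_itv /=.
  case: (ltP x y) => xy /andP[ax _]; rewrite ?mulr1 ?mulr0//.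
  by rewrite (le_trans ax (ltW xy)).
have toT (w h : R -> R) : \int[mu]_(x in `[a, b]) (h x * w x) = \int[mu]_x ((h \_ `[a, b]) x * w x).
  rewrite Rintegral_mkcond; apply: eq_Rintegral => x _.
  by rewrite !patchE; case: ifP; rewrite ?mul0r.
have IF : mu.-integrable setT (EFin \o F) by exact: integrable_patch.
have IG : mu.-integrable setT (EFin \o G) by exact: integrable_patch.
have [Ik Ek] := Fubini_prodmul IF IG mk k1.
have -> : \int[mu]_(x in `[a, b]) (g x * \int[mu]_(y in `[a, x]) f y) =
    \int[mu]_x (F x * \int[mu]_y (G y * k x y)).
  rewrite Ek -toT; apply: eq_Rintegral => x; rewrite inE /= in_itv /= => xab.
  by rewrite kf.
have -> : \int[mu]_(x in `[a, b]) (f x * \int[mu]_(y in `[a, x]) g y) =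
    \int[mu]_x (F x * \int[mu]_(x in `[a, b]) g x - F x * \int[mu]_y (G y * k x y)).
  under [RHS]eq_Rintegral do rewrite -mulrBr.
  rewrite -toT; apply: eq_Rintegral => x; rewrite inE /= in_itv /= => xab.
  rewrite (kg x xab); move: (Rintegral _ _ _) (Rintegral _ _ _) => p q.
  by congr (_ * _); ring.
have IFr (r : R) : mu.-integrable setT (EFin \o (fun x => F x * r)).
  have -> : (fun x => F x * r) = (fun x => r * F x) by apply/funext => x; rewrite mulrC.
  exact: (integrableZl measurableT r IF).
rewrite (RintegralB measurableT (IFr _) Ik) subrK (RintegralZr _ measurableT IF).
by rewrite -Rintegral_mkcond.
Qed.

End Primitives.


(** * Cut-off functions of class C^1 *)

Section Cutoff.
Import numFieldNormedType.Exports.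
Local Open Scope classical_set_scope.
Context {R : realType}.
Implicit Types (f g : R -> R) (a b c d : R).

(* Twice the square of the positive part, which is C^1. *)
Definition sqpos (y : R) : R := y * `|y| + y ^+ 2.

Lemma sqpos_ge0 y : 0 <= sqpos y.
Proof.
rewrite /sqpos; case: (ger0P y) => y0; first by rewrite -expr2 addr_ge0 ?sqr_ge0.
by rewrite mulrN -expr2 addNr.
Qed.

Lemma sqpos_le0 y : y <= 0 -> sqpos y = 0.
Proof. by move=> y0; rewrite /sqpos ler0_norm// mulrN -expr2 addNr. Qed.

Lemma sqpos_gt0 y : 0 < y -> 0 < sqpos y.
Proof. by move=> y0; rewrite /sqpos gtr0_norm// -expr2 addr_gt0 ?exprn_gt0. Qed.

(** The remainder is quadratic across the kink at 0 as well, so [y * |y|] is differentiable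
    everywhere with the continuous derivative [2 * |y|]. *)
Lemma sqpos_taylor (y s : R) :
  `|s * `|s| - y * `|y| - (s - y) * (2 * `|y|)| <= (s - y) ^+ 2.
Proof.
have := sqr_ge0 (s - y); have := sqr_ge0 s; have := sqr_ge0 y.
rewrite ler_norml; case: (ger0P y) => y0; case: (ger0P s) => s0 => ? ? ?; apply/andP; split.
- by lra.
- by lra.
- have : 0 <= y * - s by apply: mulr_ge0 => //; rewrite oppr_ge0 ltW.
  by lra.
- have : 0 <= y * - s by apply: mulr_ge0 => //; rewrite oppr_ge0 ltW.
  by lra.
- have : 0 <= s * - y by apply: mulr_ge0 => //; rewrite oppr_ge0 ltW.
  by lra.
- have : 0 <= s * - y by apply: mulr_ge0 => //; rewrite oppr_ge0 ltW.
  by lra.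
- by lra.
- by lra.
Qed.

Lemma is_derive_sqpos (y : R) : is_derive y 1 sqpos (2 * `|y| + 2 * y).
Proof.
have cvH : h^-1 *: (((fun y : R => y * `|y|) \o shift y) (h *: 1) - y * `|y|)
    @[h --> 0^'] --> 2 * `|y|.
  apply/cvgrPdist_le => /= e e0; near=> h.
  have h0 : h != 0 by near: h; exact: nbhs_dnbhs_neq.
  rewrite /GRing.scale /= mulr1.
  have := sqpos_taylor y (h + y); rewrite addrK => H.
  have h1 : 0 < `|h| by rewrite normr_gt0.
  rewrite distrC -(ler_pM2l h1) -normrM.
  have -> : h * (h^-1 * ((h + y) * `|h + y| - y * `|y|) - 2 * `|y|) =
     (h + y) * `|h + y| - y * `|y| - h * (2 * `|y|) by field.
  apply: (le_trans H); rewrite -(real_normK (num_real h)) expr2 ler_wpM2l//.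
  by near: h; apply: dnbhs0_le.
have H : is_derive y 1 (fun y : R => y * `|y|) (2 * `|y|).
  by apply: DeriveDef; [apply/cvg_ex; exists (2 * `|y|)|exact: cvg_lim].
have -> : sqpos = (fun y : R => y * `|y|) + (fun y : R => y ^+ 2) by [].
apply: is_derive_eq.
by rewrite /GRing.scale /=; ring.
Unshelve. all: by end_near. Qed.

Lemma continuous_sqpos : continuous sqpos.
Proof.
move=> y; apply: differentiable_continuous; apply/derivable1_diffP.
exact: (@ex_derive _ _ _ _ _ _ _ (is_derive_sqpos y)).
Qed.

Section Construction.
Variables (c d : R) (n : nat).

Let P (x : R) : R := (x - c) * (d - x).

(** A test function with values in [[0, 1]], supported in [[c, d]], which tends pointwise to the
    indicator of []c, d[] as [n] grows. *)
Definition cutoff (x : R) : R := 1 - (1 + n%:R * sqpos (P x))^-1.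

Let den_gt0 x : 0 < 1 + n%:R * sqpos (P x).
Proof. by rewrite ltr_pwDl// mulr_ge0 ?sqpos_ge0. Qed.

Lemma cutoff_bounds x : 0 <= cutoff x <= 1.
Proof.
rewrite /cutoff subr_ge0 invf_le1// lerDl mulr_ge0 ?sqpos_ge0//=.
by rewrite gerBl invr_ge0 ltW.
Qed.

Lemma cutoff_out x : c <= d -> ~ (c <= x <= d) -> cutoff x = 0.
Proof.
move=> cd xcd; rewrite /cutoff sqpos_le0 ?mulr0 ?addr0 ?invr1 ?subrr//.
rewrite /P; case: (leP c x) xcd => cx /= xcd; last first.
  by apply: mulr_le0_ge0; rewrite ?subr_le0 ?subr_ge0 ltW// (lt_le_trans cx).
have dx : d < x by rewrite ltNge; apply/negP.
by apply: mulr_ge0_le0; [rewrite subr_ge0|rewrite subr_le0 ltW].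
Qed.

Let dcutoff (x : R) : R :=
  n%:R * (2 * `|P x| + 2 * P x) * (d + c - 2 * x) / (1 + n%:R * sqpos (P x)) ^+ 2.

Lemma is_derive_cutoff (x : R) : is_derive x 1 cutoff (dcutoff x).
Proof.
have dP : is_derive x 1 P (d + c - 2 * x).
  have -> : P = (fun x => x - c) * (fun x => d - x) by [].
  apply: is_derive_eq; rewrite /GRing.scale /=; ring.
have dQ : is_derive x 1 (sqpos \o P) ((2 * `|P x| + 2 * P x) * (d + c - 2 * x)).
  apply: is_derive1_comp; exact: is_derive_sqpos.
have -> : cutoff = cst 1 - (fun x => (cst 1 x + (n%:R *: (sqpos \o P)) x)^-1) by [].
have dD : is_derive x 1 (cst 1 + n%:R *: (sqpos \o P)) (0 + n%:R *: ((2 * `|P x| + 2 * P x) * (d + c - 2 * x))).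
  exact: is_deriveD.
have den0 : (cst 1 + n%:R *: (sqpos \o P)) x != 0 by rewrite gt_eqF// den_gt0.
have := is_deriveV den0 dD => dV.
apply: is_derive_eq.
rewrite /dcutoff /GRing.scale /=; rewrite fctE /= /GRing.scale/= in den0 *.
by rewrite /GRing.scale /= in den0 *; field.
Qed.

Lemma test_fun_cutoff j : j%:R < c -> c <= d -> d < j.+1%:R -> test_fun j cutoff.
Proof.
move=> jc cd dj; split.
- by move=> x; exact: (@ex_derive _ _ _ _ _ _ _ (is_derive_cutoff x)).
- have -> : derive1 cutoff = dcutoff.
    by apply/funext => x; rewrite derive1E; exact: (@derive_val _ _ _ _ _ _ _ (is_derive_cutoff x)).
  move=> x.
  have cP : {for x, continuous P}.
    apply: differentiable_continuous; apply/derivable1_diffP.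
    by apply: derivableM; apply: derivableB.
  have cL : d + c - 2 * y @[y --> x] --> d + c - 2 * x.
    apply: cvgB; first exact: cvg_cst.
    by apply: cvgM; [exact: cvg_cst|exact: cvg_id].
  have cA : 2 * `|P y| + 2 * P y @[y --> x] --> 2 * `|P x| + 2 * P x.
    apply: cvgD; apply: cvgM; [exact: cvg_cst|exact: cvg_norm|exact: cvg_cst|exact: cP].
  have cD : 1 + n%:R * sqpos (P y) @[y --> x] --> 1 + n%:R * sqpos (P x).
    apply: cvgD; first exact: cvg_cst.
    apply: cvgM; first exact: cvg_cst.
    by apply: (continuous_comp cP); exact: continuous_sqpos.
  apply: cvgM; first by apply: cvgM => //; apply: cvgM => //; exact: cvg_cst.
  apply: cvgV; first by rewrite expf_eq0 /= gt_eqF.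
  by rewrite expr2; apply: cvgM.
- exists c, d; split.
    move=> x; rewrite /cell /= !in_itv /= => /andP[cx xd].
    by rewrite (lt_le_trans jc cx) (le_lt_trans xd dj).
  by move=> x /=; rewrite in_itv /= => h; apply: cutoff_out => //; apply/negP.
Qed.

End Construction.

Lemma cutoff_cvg c d x : c <= d -> cutoff c d n x @[n --> \oo] --> (\1_`]c, d[%classic x : R).
Proof.
move=> cd; rewrite indicE; have [xcd|xcd] := boolP (c < x < d); last first.
  rewrite memNset/= ?in_itv; last exact/negP.
  have -> : (fun n => cutoff c d n x) = cst 0; last exact: cvg_cst.
  apply/funext => n; rewrite /cutoff sqpos_le0 ?mulr0 ?addr0 ?invr1 ?subrr//.
  move: xcd; rewrite negb_and -!leNgt => /orP[h|h].
    by apply: mulr_le0_ge0; rewrite ?subr_le0 ?subr_ge0// (le_trans h).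
  by apply: mulr_ge0_le0; rewrite ?subr_le0 ?subr_ge0// (le_trans cd).
rewrite mem_set/= ?in_itv//= /cutoff.
set p := sqpos _.
have p0 : 0 < p by case/andP: xcd => cx xd; rewrite sqpos_gt0// mulr_gt0// subr_gt0.
rewrite -[X in _ --> X](subr0 (1 : R)); apply: cvgB; first exact: cvg_cst.
(* Since [1 + n p >= (n + 1) min(1, p)], the distance to 1 is at most a constant times
   [1 / (n + 1)]. *)
have m0 : 0 < Num.min 1 p by rewrite lt_min ltr01.
apply: (@squeeze_cvgr _ _ _ _ (cst 0) (fun n => (Num.min 1 p)^-1 * (n.+1%:R)^-1)).
- apply: nearW => n /=.
  have D0 : 0 < 1 + n%:R * p by rewrite ltr_pwDl// mulr_ge0// ltW.
  rewrite invr_ge0 (ltW D0)/= -invfM lef_pV2 ?posrE ?mulr_gt0//.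
  rewrite -natr1 mulrDr mulr1 addrC lerD ?ge_min ?lexx// mulrC ler_wpM2l//.
  by rewrite ge_min lexx orbT.
- exact: cvg_cst.
- rewrite -[X in _ --> X](mulr0 (Num.min 1 p)^-1).
  by apply: cvgM; [exact: cvg_cst|exact: cvg_harmonic].
Qed.

End Cutoff.


(** * The fundamental lemma of the calculus of variations on a cell *)

Section DuBoisReymond.
Import numFieldNormedType.Exports.
Local Open Scope classical_set_scope.
Context {R : realType}.
Notation mu := (@lebesgue_measure R).
Implicit Types (D : set R) (f g : R -> R) (a b c d : R).

Lemma measurable_cell j : measurable (cell j : set (measurableTypeR R)).
Proof. exact: measurable_itv. Qed.

Lemma cell_lty j : (mu (cell j) < +oo)%E.
Proof. by rewrite /cell lebesgue_measure_itv; case: ifP => _; rewrite ?ltry// -EFinD ltry. Qed.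

Lemma natS_gt j : j%:R < j.+1%:R :> R.
Proof. by rewrite ltr_nat. Qed.

Lemma integrable_bmul D f (k : R -> R) (M : R) : measurable D ->
  mu.-integrable D (EFin \o f) -> measurable_fun D k ->
  (forall x, D x -> `|k x| <= M) -> mu.-integrable D (fun x => (f x * k x)%:E).
Proof.
move=> mD If mk kM.
have mf : measurable_fun D f by apply/measurable_EFinP; exact: (measurable_int mu).
have IM : mu.-integrable D (fun x => M%:E * (abse \o (EFin \o f)) x)%E.
  by apply: integrableZl => //; exact: integrable_abse.
apply: (@le_integrable _ _ _ mu D mD _ _ _ _ IM).
- by apply/measurable_EFinP; exact: measurable_funM.
- move=> x Dx; rewrite /= lee_fin normrM mulrC [leRHS]normrM normr_id.
  by rewrite ler_wpM2r// (le_trans (kM x Dx))// ler_norm.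
Qed.

(** The cut-offs stay below 1 and tend to the indicator of []c, d[], so dominated convergence passes
    from test functions to intervals. *)
Lemma test_fun_indic0 j g c d : mu.-integrable (cell j) (EFin \o g) ->
  (forall phi, test_fun j phi -> \int[mu]_(x in cell j) (g x * phi x) = 0) ->
  j%:R < c -> c <= d -> d < j.+1%:R -> \int[mu]_(x in `]c, d[) g x = 0.
Proof.
move=> Ig g0 jc cd dj.
have mg : measurable_fun (cell j) g by apply/measurable_EFinP; exact: (measurable_int mu).
have mb n : measurable_fun (cell j) (cutoff c d n).
  apply: measurable_funTS; apply: continuous_measurable_fun => x.
  apply: differentiable_continuous; apply/derivable1_diffP.
  by case: (test_fun_cutoff n jc cd dj).
have Ib n : mu.-integrable (cell j) (fun x => (g x * cutoff c d n x)%:E).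
  apply: (integrable_bmul (M := 1) (measurable_cell j) Ig (mb n)) => x _.
  by have /andP[b0 b1] := cutoff_bounds c d n x; rewrite ger0_norm.
have cv : (\int[mu]_(x in cell j) (g x * cutoff c d n x)%:E)%E @[n --> \oo] -->
    (\int[mu]_(x in cell j) (g x * \1_(`]c, d[%classic) x)%:E)%E.
  apply: (dominated_cvg (measurable_cell j) (g := fun x => `|(g x)%:E|%E)).
  - by move=> n; exact: (measurable_int mu).
  - move=> x _; apply: cvg_EFin; first exact: nearW.
    by apply: cvgM; [exact: cvg_cst|exact: cutoff_cvg].
  - by move=> x _; rewrite abse_EFin.
  - exact: integrable_abse.
  - move=> n x _; rewrite !abse_EFin lee_fin normrM ler_piMr//.
    by have /andP[b0 b1] := cutoff_bounds c d n x; rewrite ger0_norm.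
have z n : (\int[mu]_(x in cell j) (g x * cutoff c d n x)%:E)%E = 0%E.
  rewrite -[LHS]fineK; last exact: (integrable_fin_num (measurable_cell j) (Ib n)).
  by congr EFin; apply: g0; exact: test_fun_cutoff.
have e0 : (\int[mu]_(x in cell j) (g x * \1_(`]c, d[%classic) x)%:E)%E = 0%E.
  apply/esym; move: cv; under [X in X @ _ --> _]eq_fun do rewrite z.
  by move=> cv; apply: (cvg_unique _ (cvg_cst _) cv).
rewrite /Rintegral; have -> : `]c, d[ = cell j `&` `]c, d[%classic :> set R.
  rewrite setIidr// => x; rewrite /cell /= !in_itv /= => /andP[cx xd].
  by rewrite (lt_trans jc cx) (lt_trans xd dj).
rewrite integral_mkcondr -[RHS]/(fine 0%E) -e0; congr fine; apply: eq_integral => x _.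
by rewrite patchE indicE; case: ifP => _; rewrite ?mulr1 ?mulr0.
Qed.

(** The integral of [g] over every compact subinterval vanishes, so the indefinite integral is
    locally constant on the cell. By Lebesgue's differentiation theorem its derivative is [g] almost
    everywhere. *)
Lemma test_fun_ae0 j g : mu.-integrable (cell j) (EFin \o g) ->
  (forall phi, test_fun j phi -> \int[mu]_(x in cell j) (g x * phi x) = 0) ->
  ae_eq mu (cell j) g (cst 0).
Proof.
move=> Ig g0; pose G := g \_ (@cell R j).
have IG : mu.-integrable setT (EFin \o G).
  by apply: integrable_patch => //; exact: measurable_cell.
have IGy y : mu.-integrable `]-oo, y] (EFin \o G) by exact: integrableS IG.
have locG : locally_integrable setT G by apply: open_integrable_locally => //; exact: openT.
have := FTC1Ny IGy locG; apply: filterS; first exact: (ae_filter_ringOfSetsType mu).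
move=> x /= [_ FG] xj.
move: FG; rewrite /G patchE mem_set// => <-.
move: xj; rewrite /cell /= in_itv /= => /andP[jx xj].
apply: cvg_lim => //; apply: cvg_near_cst; near=> h.
have [jh hj] : j%:R < h + x /\ h + x < j.+1%:R.
  have : `|h| < Num.min (x - j%:R) (j.+1%:R - x).
    by near: h; apply: dnbhs0_lt; rewrite lt_min !subr_gt0 jx.
  by rewrite lt_min !ltr_norml => /andP[/andP[? ?] /andP[? ?]]; split; lra.
rewrite (_ : _ - _ = 0) ?scaler0//.
have key p q : j%:R < p -> p <= q -> q < j.+1%:R -> 
   \int[mu]_(t in `]-oo, q]) G t - \int[mu]_(t in `]-oo, p]) G t = 0.
  move=> jp pq qj; rewrite Rintegral_itvB//.
  rewrite -Rintegral_itv_bndo_bndc; last by apply: integrableS IG.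
  rewrite -[RHS](test_fun_indic0 Ig g0 jp pq qj); apply: eq_Rintegral => t.
  rewrite inE /= in_itv /= => /andP[pt tq]; rewrite /G patchE mem_set//.
  by rewrite /cell /= in_itv /= (lt_trans jp pt) (lt_trans tq qj).
case: (leP x (h + x)) => hx; first by rewrite key.
by rewrite -[LHS]opprB key ?oppr0// ltW.
Unshelve. all: by end_near. Qed.

End DuBoisReymond.


(** * Primitives on a cell and integration by parts *)

Section WeakDerivatives.
Import numFieldNormedType.Exports.
Local Open Scope classical_set_scope.
Context {R : realType}.
Notation mu := (@lebesgue_measure R).
Implicit Types (D : set R) (f g u w phi : R -> R) (a b c d : R).

Lemma integrable_cellP j g : mu.-integrable (cell j) (EFin \o g) <->
  mu.-integrable `[j%:R, j.+1%:R] (EFin \o g).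
Proof.
split => Ig; last by apply: integrableS Ig => //; [exact: measurable_cell|exact: subset_itv_oo_cc].
have mg : measurable_fun (cell j) g by apply/measurable_EFinP; exact: (measurable_int mu).
have mg' := measurable_fun_itv_cc mg.
apply/integrableP; split; first exact/measurable_EFinP.
rewrite integral_itv_bndoo; first by case/integrableP : Ig.
by apply: measurableT_comp => //; exact/measurable_EFinP.
Qed.

Lemma Rintegral_cell j g : mu.-integrable (cell j) (EFin \o g) ->
  \int[mu]_(x in cell j) g x = \int[mu]_(x in `[j%:R, j.+1%:R]) g x.
Proof.
case/integrableP => mf _; rewrite /Rintegral; congr fine; apply/esym.
exact: (@integral_itv_bndoo _ _ _ (EFin \o g) true false mf).
Qed.

Lemma sqint_integrable_itv j g : sqint (cell j) g -> mu.-integrable `[j%:R, j.+1%:R] (EFin \o g).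
Proof.
by move=> sg; apply/integrable_cellP; apply: sqint_integrable => //; [exact: measurable_cell|exact: cell_lty].
Qed.

Lemma test_fun_out j phi x : test_fun j phi -> ~ cell j x -> phi x = 0.
Proof. by move=> [_ _ [a [b [ab0 h]]]] nx; apply: h => /ab0. Qed.

Lemma test_fun_integrable j phi : test_fun j phi ->
  mu.-integrable `[j%:R, j.+1%:R] (EFin \o derive1 phi) /\
  mu.-integrable `[j%:R, j.+1%:R] (EFin \o phi).
Proof.
move=> [d1 c1 _]; split; apply: continuous_compact_integrable.
- exact: segment_compact.
- exact: continuous_subspaceT.
- exact: segment_compact.
- apply: continuous_subspaceT => x.
  by apply: differentiable_continuous; apply/derivable1_diffP.
Qed.

Lemma test_fun_prim j phi x : test_fun j phi -> j%:R <= x <= j.+1%:R ->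
  \int[mu]_(y in `[j%:R, x]) derive1 phi y = phi x.
Proof.
move=> tf; rewrite le_eqVlt => /andP[/predU1P[<- _|jx xj]].
  by rewrite set_itv1 Rintegral_set1 (test_fun_out tf)// /cell /= in_itv /= ltxx.
have [d1 c1 _] := tf.
have cphi : continuous phi.
  by move=> y; apply: differentiable_continuous; apply/derivable1_diffP.
have p0 : phi j%:R = 0 by apply: (test_fun_out tf); rewrite /cell /= in_itv /= ltxx.
have LR : derivable_oo_LRcontinuous phi j%:R x.
  split; first by move=> y _; exact: d1.
    by apply: cvg_at_right_filter; exact: cphi.
  by apply: cvg_at_left_filter; exact: cphi.
have := continuous_FTC2 jx (continuous_subspaceT c1) LR (fun _ _ => erefl).
by rewrite /Rintegral => ->; rewrite p0 sube0.
Qed.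

End WeakDerivatives.


Section WeakPrimitive.
Import numFieldNormedType.Exports.
Local Open Scope classical_set_scope.
Context {R : realType}.
Notation mu := (@lebesgue_measure R).
Implicit Types (D : set R) (f g u w phi : R -> R) (a b c d : R).

(** Required at every point of the closed cell: for integrable [g], [w] is continuous up to the
    ends, and its end values serve as traces. *)
Definition primitive_on j w g := forall x, j%:R <= x <= j.+1%:R ->
  w x = w j%:R + \int[mu]_(y in `[j%:R, x]) g y.

Definition wdr j u g := forall phi, test_fun j phi ->
  \int[mu]_(x in cell j) (u x * derive1 phi x) =
  - \int[mu]_(x in cell j) (g x * phi x).

Lemma primitive_on_cont j w g : mu.-integrable `[j%:R, j.+1%:R] (EFin \o g) ->
  primitive_on j w g -> {within `[j%:R, j.+1%:R], continuous w}.
Proof.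
move=> Ig wg.
have jj : j%:R <= j.+1%:R :> R by exact/ltW/natS_gt.
have := parameterized_integral_continuous jj Ig => cI.
have : {within `[j%:R, j.+1%:R], continuous (fun x => w j%:R + parameterized_integral mu j%:R x g)}.
  by move=> x; apply: cvgD; [exact: cvg_cst|exact: cI].
apply: subspace_eq_continuous => x; rewrite inE /= in_itv /= => xj.
by apply/esym; exact: wg.
Qed.

Lemma continuous_sqint a b w : {within `[a, b], continuous w} -> sqint `[a, b] w.
Proof.
move=> cw; split; first exact: subspace_continuous_measurable_fun.
have -> : (fun x => (w x ^+ 2)%:E) = EFin \o (fun x => w x * w x).
  by apply/funext => x; rewrite expr2.
apply: continuous_compact_integrable; first exact: segment_compact.
by move=> x; apply: cvgM; exact: cw.
Qed.

Lemma sqint_cellP j f : sqint (cell j) f <-> sqint `[j%:R, j.+1%:R] f.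
Proof.
split => [[mf f2]|]; last first.
  by apply: sqintS => //; [exact: measurable_cell|exact: subset_itv_oo_cc].
split; first exact: measurable_fun_itv_cc mf.
exact/(@integrable_cellP _ _ (fun x => f x ^+ 2)).
Qed.

Lemma primitive_on_sqint j w g : sqint (cell j) g -> primitive_on j w g -> sqint (cell j) w.
Proof.
move=> sg wg; apply/sqint_cellP/continuous_sqint.
by apply: (primitive_on_cont _ wg); exact: sqint_integrable_itv.
Qed.

(** [prim_parts] applied to the primitives that vanish at the left end, namely [w - w(j)] and
    [v - v(j)]; the two end values are then put back. *)
Lemma primitive_parts j w g v h : sqint (cell j) g -> sqint (cell j) h ->
  primitive_on j w g -> primitive_on j v h ->
  \int[mu]_(x in cell j) (w x * h x + g x * v x) =
  w j.+1%:R * v j.+1%:R - w j%:R * v j%:R.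
Proof.
move=> sg sh wg vh.
have jj : j%:R <= j.+1%:R :> R by exact/ltW/natS_gt.
have mc := @measurable_cell R j.
have Ig := sqint_integrable_itv sg; have Ih := sqint_integrable_itv sh.
have sw := primitive_on_sqint sg wg; have sv := primitive_on_sqint sh vh.
have sG : sqint (cell j) (fun x => w x - w j%:R).
  exact: (sqintB mc sw (sqint_cst (w j%:R) mc (cell_lty j))).
have sH : sqint (cell j) (fun x => v x - v j%:R).
  exact: (sqintB mc sv (sqint_cst (v j%:R) mc (cell_lty j))).
have P := prim_parts Ig Ih.
have IgH := sqintM mc sg sH; have IhG := sqintM mc sh sG.
have e1 : \int[mu]_(x in `[j%:R, j.+1%:R]) (g x * \int[mu]_(y in `[j%:R, x]) h y) =
    \int[mu]_(x in cell j) (g x * (v x - v j%:R)).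
  rewrite (Rintegral_cell IgH); apply: eq_Rintegral => x; rewrite inE /= in_itv /= => xj.
  by rewrite (vh _ xj) addrC addKr.
have e2 : \int[mu]_(x in `[j%:R, j.+1%:R]) (h x * \int[mu]_(y in `[j%:R, x]) g y) =
    \int[mu]_(x in cell j) (h x * (w x - w j%:R)).
  rewrite (Rintegral_cell IhG); apply: eq_Rintegral => x; rewrite inE /= in_itv /= => xj.
  by rewrite (wg _ xj) addrC addKr.
have Ig' := (integrable_cellP j g).2 Ig; have Ih' := (integrable_cellP j h).2 Ih.
rewrite {}e1 {}e2 -(Rintegral_cell Ig') -(Rintegral_cell Ih') in P.
have -> : \int[mu]_(x in cell j) (w x * h x + g x * v x) =
   \int[mu]_(x in cell j) ((g x * (v x - v j%:R) + h x * (w x - w j%:R)) +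
     (v j%:R * g x + w j%:R * h x)).
  by apply: eq_Rintegral => x _; ring.
have Ivg := integrableZl mc (v j%:R) Ig'.
have Iwh := integrableZl mc (w j%:R) Ih'.
rewrite (RintegralD mc (integrableD mc IgH IhG) (integrableD mc Ivg Iwh)).
rewrite (RintegralD mc IgH IhG) (RintegralD mc Ivg Iwh) P.
rewrite (RintegralZl _ mc Ig') (RintegralZl _ mc Ih').
rewrite (wg j.+1%:R) ?jj ?lexx// (vh j.+1%:R) ?jj ?lexx//.
by rewrite -(Rintegral_cell Ig') -(Rintegral_cell Ih'); ring.
Qed.

End WeakPrimitive.


(** * Du Bois-Reymond's lemma *)

Section WeakPrimitive.
Import numFieldNormedType.Exports.
Local Open Scope classical_set_scope.
Context {R : realType}.
Notation mu := (@lebesgue_measure R).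
Implicit Types (D : set R) (f g u w phi : R -> R) (a b c d : R).

Lemma test_fun_sqint j phi : test_fun j phi ->
  sqint (cell j) phi /\ sqint (cell j) (derive1 phi).
Proof.
move=> [d1 c1 _]; split; apply/sqint_cellP/continuous_sqint; apply: continuous_subspaceT => //.
by move=> x; apply: differentiable_continuous; apply/derivable1_diffP.
Qed.

Lemma test_fun_primitive_on j phi : test_fun j phi -> primitive_on j phi (derive1 phi).
Proof.
move=> tf x xj; rewrite test_fun_prim// (test_fun_out (x := j%:R) tf) ?add0r//.
by rewrite /cell /= in_itv /= ltxx.
Qed.

Lemma primitive_on_wdr j w g : sqint (cell j) g -> primitive_on j w g -> wdr j w g.
Proof.
move=> sg wg phi tf; have mc := @measurable_cell R j.
have [sp sd] := test_fun_sqint tf; have sw := primitive_on_sqint sg wg.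
have := primitive_parts sg sd wg (test_fun_primitive_on tf).
rewrite (RintegralD mc (sqintM mc sw sd) (sqintM mc sg sp)).
rewrite !(test_fun_out tf) ?mulr0 ?subrr; last 2 first.
- by rewrite /cell /= in_itv /= ltxx.
- by rewrite /cell /= in_itv /= ltxx andbF.
by move/eqP; rewrite addr_eq0 => /eqP.
Qed.

Lemma test_funB j (k : R) phi psi : test_fun j phi -> test_fun j psi ->
  test_fun j (fun x => phi x - k * psi x).
Proof.
move=> [d1 c1 [a [b [ab h]]]] [d2 c2 [a' [b' [ab' h']]]].
have dd x : derivable (fun x => phi x - k * psi x) x 1.
  by apply: derivableB => //; apply: derivableM.
split; [exact: dd| |].
- have -> : derive1 (fun x => phi x - k * psi x) = derive1 phi \- (k \*: derive1 psi).
    apply/funext => x; rewrite derive1E deriveB//; last by apply: derivableM.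
    by rewrite (deriveMl _ (d2 x)) /= !derive1E.
  by move=> x; apply: cvgB; [exact: c1|apply: cvgM; [exact: cvg_cst|exact: c2]].
(* An empty [[a, b]] satisfies the inclusion in the cell wherever [a] and [b] lie. Then [phi]
   vanishes identically and the other interval must be taken. *)
have [ab0|ab0] := leP a b; last first.
  exists a', b'; split=> // x xab; rewrite h' // h ?mulr0 ?subr0//=.
  by rewrite in_itv /= => /andP[ax xb]; move: ab0; rewrite ltNge (le_trans ax xb).
have [ab1|ab1] := leP a' b'; last first.
  exists a, b; split=> // x xab; rewrite h // h' ?mulr0 ?subr0//=.
  by rewrite in_itv /= => /andP[ax xb]; move: ab1; rewrite ltNge (le_trans ax xb).
have aC : cell j a by apply: ab; rewrite /= in_itv /= lexx.
have bC : cell j b by apply: ab; rewrite /= in_itv /= lexx ab0.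
have aC' : cell j a' by apply: ab'; rewrite /= in_itv /= lexx.
have bC' : cell j b' by apply: ab'; rewrite /= in_itv /= lexx ab1.
exists (Num.min a a'), (Num.max b b'); split.
  move: aC bC aC' bC'; rewrite /cell /= !in_itv /= => /andP[a1 a2] /andP[b1 b2] /andP[a1' a2'] /andP[b1' b2'] x /=.
  rewrite !in_itv /= ge_min le_max => /andP[/orP[]? /orP[]?]; apply/andP; split; lra.
move=> x /= nx; rewrite h ?h' ?mulr0 ?subr0//=; move=> xab; apply: nx; move: xab;
  rewrite !in_itv /= ge_min le_max => /andP[-> ->]; rewrite ?orbT//.
Qed.

(** Otherwise the fundamental lemma would make the constant 1 vanish almost everywhere on a cell of
    positive measure. *)
Lemma exists_test_fun_int j : exists2 phi, test_fun j phi & \int[mu]_(x in cell j) phi x != 0 :> R.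
Proof.
apply: contrapT => H.
have mc := @measurable_cell R j.
have I1 : mu.-integrable (cell j) (EFin \o (cst 1 : R -> R)).
  by apply: sqint_integrable => //; [exact: cell_lty|exact: (sqint_cst 1 mc (cell_lty j))].
have : ae_eq mu (cell j) (cst 1 : R -> R) (cst 0).
  apply: test_fun_ae0 => // phi tf.
  under eq_Rintegral do rewrite mul1r.
  by apply: contrapT => /eqP h; apply: H; exists phi.
case=> A [mA A0 sA].
have : (mu (cell j) <= mu A)%E.
  by apply: le_measure; rewrite ?inE// => x xj; apply: sA => /(_ xj)/eqP; rewrite oner_eq0.
rewrite A0 /cell lebesgue_measure_itv /= lte_fin natS_gt -EFinD lee_fin.
by rewrite leNgt subr_gt0 natS_gt.
Qed.

(** The primitive from minus infinity vanishes to the left of the support trivially, and to its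
    right because the mean of [chi] is zero. *)
Lemma test_fun_primitive j chi : test_fun j chi -> \int[mu]_(x in cell j) chi x = 0 ->
  exists2 phi, test_fun j phi & derive1 phi = chi.
Proof.
move=> tc c0; have mc := @measurable_cell R j.
have [d1 c1 [a [b [ab h]]]] := tc.
have Ec : chi \_ (cell j) = chi.
  apply/funext => x; rewrite patchE; case: ifPn => // /negP nx.
  by rewrite (test_fun_out tc)// => jx; apply: nx; rewrite inE.
have IT : mu.-integrable setT (EFin \o chi).
  rewrite -Ec; apply: integrable_patch => //.
  by apply/integrable_cellP; case: (test_fun_integrable tc).
have ccont : continuous chi.
  by move=> x; apply: differentiable_continuous; apply/derivable1_diffP.
pose phi x := \int[mu]_(t in `]-oo, x]) chi t.
have dphi x : derivable phi x 1 /\ derive1 phi x = chi x.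
  have xu : x < x + 1 by rewrite ltrDl.
  have Ix : mu.-integrable `]-oo, x + 1] (EFin \o chi) by apply: integrableS IT.
  exact: (continuous_FTC1 xu Ix (ltNyr x) (ccont x)).
have E : derive1 phi = chi by apply/funext => x; case: (dphi x).
exists phi; last exact: E.
split; [by move=> y; case: (dphi y)|by rewrite E|].
exists a, b; split; [exact: ab|move=> x nx; rewrite /phi].
have [xa|ax] := ltP x a.
  rewrite -[RHS](Rintegral_set0 mu chi) Rintegral_mkcond [RHS]Rintegral_mkcond.
  apply: eq_Rintegral => t _; rewrite !patchE in_set0; case: ifPn => //.
  rewrite inE /= in_itv /= => tx; apply: h => /=; rewrite in_itv /= => /andP[at0 _].
  by have := le_lt_trans (le_trans at0 tx) xa; rewrite ltxx.
have bx : b < x by rewrite ltNge; apply/negP => xb; apply: nx; rewrite /= in_itv /= ax.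
rewrite -[RHS]c0 Rintegral_mkcond [RHS]Rintegral_mkcond Ec.
apply: eq_Rintegral => t _; rewrite patchE; case: ifPn => // /negP.
rewrite inE /= in_itv /= => tx; rewrite h// /= in_itv /= => /andP[_ tb].
by apply: tx; apply: (le_trans tb); exact: ltW.
Qed.

Lemma wdr_primitive j u g : sqint (cell j) u -> sqint (cell j) g -> wdr j u g ->
  exists2 w, primitive_on j w g & ae_eq mu (cell j) w u.
Proof.
move=> su sg ug; have mc := @measurable_cell R j.
have mcl := @cell_lty R j.
pose v x := \int[mu]_(y in `[j%:R, x]) g y.
have vg : primitive_on j v g.
  by move=> x xj; rewrite /v set_itv1 Rintegral_set1 add0r.
have sv := primitive_on_sqint sg vg.
have svu := sqintB mc su sv.
have [psi tpsi psi0] := exists_test_fun_int j.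
pose m0 := \int[mu]_(x in cell j) psi x.
pose h x := u x - v x.
pose k := \int[mu]_(x in cell j) (h x * psi x) / m0.
have hphi phi : test_fun j phi -> \int[mu]_(x in cell j) (h x * derive1 phi x) = 0.
  move=> tf; have [sp sd] := test_fun_sqint tf.
  under eq_Rintegral do rewrite mulrBl.
  rewrite (RintegralB mc (sqintM mc su sd) (sqintM mc sv sd)).
  by rewrite ug// (primitive_on_wdr sg vg)// subrr.
have hk : ae_eq mu (cell j) (fun x => h x - k) (cst 0).
  have shk := sqintB mc svu (sqint_cst k mc mcl).
  apply: test_fun_ae0; first exact: sqint_integrable.
  move=> phi tf.
  have [sp sd] := test_fun_sqint tf; have [spsi _] := test_fun_sqint tpsi.
  have Ip := sqint_integrable mc mcl sp; have Ipsi := sqint_integrable mc mcl spsi.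
  pose m := \int[mu]_(x in cell j) phi x.
  (* Subtracting [(m / m0) psi] leaves a function of mean zero, hence the derivative of a test
     function, to which [h] is orthogonal. This says exactly that [h - k] is orthogonal to [phi]. *)
  have tB := test_funB (m / m0) tf tpsi.
  have [|Phi tPhi EPhi] := test_fun_primitive tB.
    rewrite (RintegralB mc Ip (integrableZl mc (m / m0) Ipsi)).
    by rewrite (RintegralZl _ mc Ipsi) -/m -/m0 divfK ?subrr.
  have := hphi _ tPhi; rewrite EPhi.
  under eq_Rintegral do rewrite mulrBr mulrCA.
  have I1 := sqintM mc svu sp; have I2 := sqintM mc svu spsi.
  rewrite (RintegralB mc I1 (integrableZl mc (m / m0) I2)) (RintegralZl _ mc I2).
  under [X in _ -> X = _]eq_Rintegral do rewrite mulrBl.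
  rewrite (RintegralB mc I1 (integrableZl mc k Ip)) (RintegralZl _ mc Ip) -/m /k => <-.
  by congr (_ - _); ring.
exists (fun x => k + v x).
  by move=> x xj; rewrite (vg x xj) addrA.
by apply: filterS hk => x /= H jx; move: (H jx); rewrite /h /= => /eqP; rewrite subr_eq0 subr_eq => /eqP ->.
Qed.

End WeakPrimitive.


(** * H^1 in terms of continuous representatives *)

Section SobolevDictionary.
Import numFieldNormedType.Exports.
Local Open Scope classical_set_scope.
Context {R : realType}.
Notation mu := (@lebesgue_measure R).
Notation Re := complex.Re.
Notation Im := complex.Im.

Lemma continuous_ae_eq j (w1 w2 : R -> R) :
  {within `[j%:R, j.+1%:R], continuous w1} -> {within `[j%:R, j.+1%:R], continuous w2} ->
  ae_eq mu (cell j) w1 w2 -> forall x, j%:R <= x <= j.+1%:R -> w1 x = w2 x.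
Proof.
move=> c1 c2 [A [mA A0 sA]] x xj; apply: contrapT => /eqP w12.
have cd : {within `[j%:R, j.+1%:R], continuous (fun x => w1 x - w2 x)}.
  by move=> y; apply: cvgB; [exact: c1|exact: c2].
have xI : `[j%:R, j.+1%:R]%classic x by rewrite /= in_itv.
have d0 : 0 < `|w1 x - w2 x| by rewrite normr_gt0 subr_eq0.
have := (subspace_continuousP _ _).1 cd x xI => /cvgrPdist_lt/(_ _ d0).
rewrite near_withinE => -[e /= e0 he].
have jj := natS_gt (R := R) j.
(* The point may be an end of the cell, so its neighbourhood is cut to the cell. What remains still
   has positive length, against [mu A = 0]. *)
pose a := Num.max j%:R (x - e); pose b := Num.min j.+1%:R (x + e).
have ab : a < b.
  case/andP: xj => jx xj1; rewrite /a /b gt_max !lt_min jj/=; apply/andP; split.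
    by rewrite (le_lt_trans jx)// ltrDl.
  by apply/andP; split; lra.
have : (mu `]a, b[ <= mu A)%E.
  apply: le_measure; rewrite ?inE// => y /=.
  rewrite in_itv /= /a /b gt_max lt_min => /andP[/andP[jy xy] /andP[yj yx]].
  apply: sA => h; have := he y; rewrite /ball /= => H.
  have : `|w1 x - w2 x - (w1 y - w2 y)| < `|w1 x - w2 x|.
    apply: H; first by rewrite ltr_norml; apply/andP; split; lra.
    by rewrite in_itv /= !ltW.
  by rewrite h ?subrr ?subr0 ?ltxx// /cell /= in_itv /= jy.
rewrite A0 lebesgue_measure_itv /= lte_fin ab -EFinD lee_fin.
by rewrite leNgt subr_gt0 ab.
Qed.

(** Working form of membership in H^1: a continuous representative [w] and a derivative [g] are
    exhibited, in place of the choices [trace] and [wd]. *)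
Definition isH1 j (u w g : R -> R[i]) :=
  [/\ L2 (cell j) u, L2 (cell j) g, ae_eq mu (cell j) w u,
      primitive_on j (fun x => Re (w x)) (fun x => Re (g x)) &
      primitive_on j (fun x => Im (w x)) (fun x => Im (g x))].

Lemma L2_cellP j (u : R -> R[i]) : L2 (cell j) u <->
  sqint (cell j) (fun x => Re (u x)) /\ sqint (cell j) (fun x => Im (u x)).
Proof. exact: (L2P _ (@measurable_cell R j)). Qed.

Lemma ReM_real (z : R[i]) (r : R) : Re (z * (r%:C)%C) = Re z * r.
Proof. by case: z => a b /=; rewrite mulr0 subr0. Qed.

Lemma ImM_real (z : R[i]) (r : R) : Im (z * (r%:C)%C) = Im z * r.
Proof. by case: z => a b /=; rewrite mulr0 add0r. Qed.

Lemma complex_eqP (z w : R[i]) : Re z = Re w -> Im z = Im w -> z = w.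
Proof. by case: z w => a b [c d] /= -> ->. Qed.

Lemma weak_derivP j (u g : R -> R[i]) : weak_deriv j u g <->
  wdr j (fun x => Re (u x)) (fun x => Re (g x)) /\
  wdr j (fun x => Im (u x)) (fun x => Im (g x)).
Proof.
have E (v : R -> R[i]) (f : R -> R) : cint (cell j) (fun x => v x * ((f x)%:C)%C) =
    ((\int[mu]_(x in cell j) (Re (v x) * f x)) +i* (\int[mu]_(x in cell j) (Im (v x) * f x)))%C.
  by rewrite /cint; congr Complex; apply: eq_Rintegral => x _; rewrite ?ReM_real ?ImM_real.
split => [H|[H1 H2] phi tf]; last first.
  by rewrite !E; apply: complex_eqP; [exact: H1|exact: H2].
by split => phi tf; have := H phi tf; rewrite !E => -[].
Qed.

Lemma ae_eq_cplx j (u v : R -> R[i]) : ae_eq mu (cell j) (fun x => Re (u x)) (fun x => Re (v x)) ->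
  ae_eq mu (cell j) (fun x => Im (u x)) (fun x => Im (v x)) -> ae_eq mu (cell j) u v.
Proof.
by apply: filterS2 => x h1 h2 jx; apply: complex_eqP; [exact: h1|exact: h2].
Qed.

Lemma ae_eq_Re j (u v : R -> R[i]) : ae_eq mu (cell j) u v ->
  ae_eq mu (cell j) (fun x => Re (u x)) (fun x => Re (v x)).
Proof. by apply: filterS => x h jx; rewrite h. Qed.

Lemma ae_eq_Im j (u v : R -> R[i]) : ae_eq mu (cell j) u v ->
  ae_eq mu (cell j) (fun x => Im (u x)) (fun x => Im (v x)).
Proof. by apply: filterS => x h jx; rewrite h. Qed.

Lemma isH1_cont_rep j u w g : isH1 j u w g -> cont_rep j u w.
Proof.
move=> [_ /L2_cellP[s1 s2] wu w1 w2]; split => //.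
- by apply: (primitive_on_cont _ w1); exact: sqint_integrable_itv.
- by apply: (primitive_on_cont _ w2); exact: sqint_integrable_itv.
Qed.

Lemma wdr_unique j (u g1 g2 : R -> R) : sqint (cell j) g1 -> sqint (cell j) g2 ->
  wdr j u g1 -> wdr j u g2 -> ae_eq mu (cell j) g1 g2.
Proof.
move=> s1 s2 w1 w2; have mc := @measurable_cell R j.
have : ae_eq mu (cell j) (fun x => g1 x - g2 x) (cst 0).
  apply: test_fun_ae0.
    by apply: (sqint_integrable mc (cell_lty j)); exact: (sqintB mc).
  move=> phi tf; have [sp _] := test_fun_sqint tf.
  under eq_Rintegral do rewrite mulrBl.
  rewrite (RintegralB mc (sqintM mc s1 sp) (sqintM mc s2 sp)).
  by apply/eqP; rewrite subr_eq0 -eqr_opp -w1// -w2.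
by apply: filterS => x h jx; apply/eqP; rewrite -subr_eq0; apply/eqP/h.
Qed.

Lemma sqint_ae_wdr j (u v g : R -> R) : sqint (cell j) u -> sqint (cell j) v ->
  ae_eq mu (cell j) u v -> wdr j u g -> wdr j v g.
Proof.
move=> su sv uv ug phi tf; rewrite -ug//; have mc := @measurable_cell R j.
have [_ sd] := test_fun_sqint tf.
rewrite /Rintegral; congr fine; apply: ae_eq_integral => //.
- exact: (measurable_int mu (sqintM mc sv sd)).
- exact: (measurable_int mu (sqintM mc su sd)).
- by apply: filterS uv => x h jx; rewrite h.
Qed.

(** The weak derivative is unique almost everywhere, and the continuous representative is unique at
    every point of the closed cell, ends included. So the choices [wd] and [trace] can only return
    [g] and [w] in these senses. *)
Lemma isH1P j u w g : isH1 j u w g ->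
  [/\ H1 j u, ae_eq mu (cell j) (wd j u) g &
      forall x, j%:R <= x <= j.+1%:R -> trace j u x = w x].
Proof.
move=> H; have cr := isH1_cont_rep H; have [Lu Lg wu w1 w2] := H.
have /L2_cellP[su1 su2] := Lu; have /L2_cellP[sg1 sg2] := Lg.
have wug : weak_deriv j u g.
  apply/weak_derivP; split.
  - apply: (sqint_ae_wdr (primitive_on_sqint sg1 w1) su1 (ae_eq_Re wu)).
    exact: primitive_on_wdr.
  - apply: (sqint_ae_wdr (primitive_on_sqint sg2 w2) su2 (ae_eq_Im wu)).
    exact: primitive_on_wdr.
have Hu : H1 j u by split => //; exists g.
have [Lwd wwd] : L2 (cell j) (wd j u) /\ weak_deriv j u (wd j u).
  by rewrite /wd; case: xgetP => [h _ //|/(_ g)[]].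
split => //.
- have /L2_cellP[sd1 sd2] := Lwd.
  have /weak_derivP[a1 a2] := wwd; have /weak_derivP[b1 b2] := wug.
  by apply: ae_eq_cplx; [exact: wdr_unique a1 b1|exact: wdr_unique a2 b2].
- move=> x xj; rewrite /trace; case: xgetP => [v _|/(_ w)//] [v1 v2 vu].
  have [c1 c2 _] := cr.
  have vw : ae_eq mu (cell j) v w.
    by apply: ae_eq_trans vu _; exact: ae_eq_sym.
  apply: complex_eqP.
  + exact: (continuous_ae_eq v1 c1 (ae_eq_Re vw)).
  + exact: (continuous_ae_eq v2 c2 (ae_eq_Im vw)).
Qed.

(** Du Bois-Reymond's lemma provides a primitive of the chosen derivative; being a continuous
    representative, it agrees with [trace] on the closed cell. *)
Lemma H1_isH1 j u : H1 j u -> isH1 j u (trace j u) (wd j u).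
Proof.
move=> [Lu [g Lg ug]].
have [Lwd wwd] : L2 (cell j) (wd j u) /\ weak_deriv j u (wd j u).
  by rewrite /wd; case: xgetP => [h _ //|/(_ g)[]].
have /L2_cellP[sd1 sd2] := Lwd; have /weak_derivP[a1 a2] := wwd.
have /L2_cellP[su1 su2] := Lu.
have [w1 p1 e1] := wdr_primitive su1 sd1 a1.
have [w2 p2 e2] := wdr_primitive su2 sd2 a2.
have H : isH1 j u (fun x => (w1 x +i* w2 x)%C) (wd j u).
  by split => //; apply: ae_eq_cplx.
have [_ _ tr] := isH1P H.
have jj : j%:R <= j.+1%:R :> R by exact/ltW/natS_gt.
split => //.
- have mc := @measurable_cell R j.
  case: H => _ _ wu _ _; apply: filterS wu => x h jx; rewrite -h// tr//.
  by move: jx; rewrite /cell /= in_itv /= => /andP[? ?]; rewrite !ltW.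
- by move=> x xj; rewrite (tr x xj) tr ?lexx ?jj// /=; exact: p1.
- by move=> x xj; rewrite (tr x xj) tr ?lexx ?jj// /=; exact: p2.
Qed.

End SobolevDictionary.

(** * The energy space *)


Section EnergySpace.
Import numFieldNormedType.Exports.
Local Open Scope classical_set_scope.
Local Open Scope complex_scope.
Context {R : realType}.
Notation mu := (@lebesgue_measure R).

(** A Boolean index lets one real argument serve for both parts. *)
Definition part (b : bool) (z : R[i]) : R := if b then complex.Im z else complex.Re z.

Lemma partD b z w : part b (z + w) = part b z + part b w.
Proof. by case: b; case: z w => ? ? [? ?]. Qed.

Lemma partB b z w : part b (z - w) = part b z - part b w.
Proof. by case: b; case: z w => ? ? [? ?]. Qed.

Lemma partZ b (a : R) z : part b (a%:C * z) = a * part b z.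
Proof. by case: b; case: z => x y /=; rewrite mul0r ?subr0 ?addr0. Qed.

Lemma part0 b : part b 0 = 0.
Proof. by case: b. Qed.

Lemma part_eqP z w : (forall b, part b z = part b w) -> z = w.
Proof. by move=> h; apply: complex_eqP; [exact: (h false)|exact: (h true)]. Qed.

Lemma L2_part j (u : R -> R[i]) : L2 (cell j) u <-> forall b, sqint (cell j) (fun x => part b (u x)).
Proof.
by rewrite L2_cellP; split => [[? ?] []//|h]; split; [exact: (h false)|exact: (h true)].
Qed.

Lemma ae_eq_part j (u v : R -> R[i]) :
  ae_eq mu (cell j) u v <-> forall b, ae_eq mu (cell j) (fun x => part b (u x)) (fun x => part b (v x)).
Proof.
split => [h b|h]; first by apply: filterS h => x h jx; rewrite h.
by apply: ae_eq_cplx; [exact: (h false)|exact: (h true)].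
Qed.

Lemma isH1_part j u w g : isH1 j u w g <->
  [/\ L2 (cell j) u, L2 (cell j) g, ae_eq mu (cell j) w u &
      forall b, primitive_on j (fun x => part b (w x)) (fun x => part b (g x))].
Proof.
split => [[? ? ? ? ?]|[? ? ? h]]; split => //; first by case.
  exact: (h false).
exact: (h true).
Qed.

Lemma ae_eq_lin (T : pzRingType) j (a : T) (u v u' v' : R -> T) :
  ae_eq mu (cell j) u u' -> ae_eq mu (cell j) v v' ->
  ae_eq mu (cell j) (fun x => a * u x + v x) (fun x => a * u' x + v' x).
Proof. by apply: filterS2 => x h1 h2 jx; rewrite h1 ?h2. Qed.

Lemma L2_lin j (a : R) (u v : R -> R[i]) : L2 (cell j) u -> L2 (cell j) v ->
  L2 (cell j) (fun x => a%:C * u x + v x).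
Proof.
have mc := @measurable_cell R j.
move=> /L2_part hu /L2_part hv; apply/L2_part => b.
have -> : (fun x => part b (a%:C * u x + v x)) = (fun x => a * part b (u x) + part b (v x)).
  by apply/funext => x; rewrite partD partZ.
exact: (sqintD mc (sqintZ a mc (hu b)) (hv b)).
Qed.

Lemma primitive_on_lin j (a : R) (w g v h : R -> R) :
  sqint (cell j) g -> sqint (cell j) h -> primitive_on j w g -> primitive_on j v h ->
  primitive_on j (fun x => a * w x + v x) (fun x => a * g x + h x).
Proof.
move=> sg sh wg vh x xj; rewrite (wg x xj) (vh x xj).
have Sx : (`[j%:R, x]%classic : set R) `<=` `[j%:R, j.+1%:R].
  by case/andP: xj => _ xj; apply: subset_itvl; rewrite bnd_simp.
have mx : measurable (`[j%:R, x] : set (measurableTypeR R)) by exact: measurable_itv.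
have Ig : mu.-integrable `[j%:R, x] (EFin \o g).
  by apply: (integrableS _ mx Sx (sqint_integrable_itv sg)); exact: measurable_itv.
have Ih : mu.-integrable `[j%:R, x] (EFin \o h).
  by apply: (integrableS _ mx Sx (sqint_integrable_itv sh)); exact: measurable_itv.
rewrite (RintegralD mx (integrableZl mx a Ig) Ih) (RintegralZl _ mx Ig); ring.
Qed.

Lemma isH1_lin j (a : R) u w g u' w' g' : isH1 j u w g -> isH1 j u' w' g' ->
  isH1 j (fun x => a%:C * u x + u' x) (fun x => a%:C * w x + w' x) (fun x => a%:C * g x + g' x).
Proof.
move=> /isH1_part[u1 g1 wu p1] /isH1_part[u2 g2 wu' p2]; apply/isH1_part; split.
- exact: L2_lin.
- exact: L2_lin.
- exact: ae_eq_lin.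
- move=> b; have /L2_part s1 := g1; have /L2_part s2 := g2.
  have -> : (fun x => part b (a%:C * w x + w' x)) = (fun x => a * part b (w x) + part b (w' x)).
    by apply/funext => x; rewrite partD partZ.
  have -> : (fun x => part b (a%:C * g x + g' x)) = (fun x => a * part b (g x) + part b (g' x)).
    by apply/funext => x; rewrite partD partZ.
  exact: primitive_on_lin.
Qed.

Lemma H1_lin j (a : R) u v : H1 j u -> H1 j v ->
  [/\ H1 j (fun x => a%:C * u x + v x),
      ae_eq mu (cell j) (wd j (fun x => a%:C * u x + v x)) (fun x => a%:C * wd j u x + wd j v x) &
      forall x, j%:R <= x <= j.+1%:R ->
        trace j (fun x => a%:C * u x + v x) x = a%:C * trace j u x + trace j v x].
Proof. by move=> /H1_isH1 hu /H1_isH1 hv; exact: (isH1P (isH1_lin a hu hv)). Qed.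

(** The last two equalities hold between functions, not only almost everywhere: the sets from which
    [wd] and [trace] choose are the same for [u] and [v]. *)
Lemma H1_ae j u v : H1 j u -> L2 (cell j) v -> ae_eq mu (cell j) u v ->
  [/\ H1 j v, wd j v = wd j u & trace j v = trace j u].
Proof.
move=> Hu Lv uv.
have E : forall g, weak_deriv j v g <-> weak_deriv j u g.
  move=> g; have [/L2_cellP[u1 u2] _] := Hu; have /L2_cellP[v1 v2] := Lv.
  rewrite !weak_derivP; split=> -[h1 h2]; split.
  - exact: (sqint_ae_wdr v1 u1 (ae_eq_Re (ae_eq_sym uv)) h1).
  - exact: (sqint_ae_wdr v2 u2 (ae_eq_Im (ae_eq_sym uv)) h2).
  - exact: (sqint_ae_wdr u1 v1 (ae_eq_Re uv) h1).
  - exact: (sqint_ae_wdr u2 v2 (ae_eq_Im uv) h2).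
split.
- by split => //; case: Hu => _ [g Lg ug]; exists g => //; apply/E.
- by rewrite /wd; congr xget; apply/seteqP; split => g [Lg /E].
- apply/funext => x; rewrite /trace; congr (xget _ _ x); apply/seteqP; split => w [c1 c2 wv]; split => //.
  + by apply: ae_eq_trans wv _; exact: ae_eq_sym.
  + exact: ae_eq_trans wv uv.
Qed.

End EnergySpace.


(** * The energy inner product *)

Section EnergyProduct.
Import numFieldNormedType.Exports.
Local Open Scope classical_set_scope.
Local Open Scope complex_scope.
Context {R : realType} {N : nat} (rho : 'I_N -> R) (hrho : forall j, 0 < rho j).
Notation mu := (@lebesgue_measure R).
Implicit Types (U W : state R N) (j : 'I_N) (k : bool * bool).

(* The real functions v, sqrt(rho) u' (real and imaginary parts) whose L^2 norms
   make up the energy norm. *)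
Definition feature U j k (x : R) : R :=
  if k.1 then Num.sqrt (rho j) * part k.2 (wd j (U.1 j) x) else part k.2 (U.2 j x).

(** The real part of [Hdot], written as a sum of real L^2 products: a real bilinear form with the
    same norm. *)
Definition hip_sum U W : R :=
  \sum_(j < N) \sum_k \int[mu]_(x in cell j) (feature U j k x * feature W j k x).

(* [hip] and [hnorm] are sealed: unification must not unfold them. *)
Fact hip_key : {f : state R N -> state R N -> R | f = hip_sum}.
Proof. by exists hip_sum. Qed.

Definition hip : state R N -> state R N -> R := sval hip_key.

Lemma hipE U W : hip U W = hip_sum U W.
Proof. by rewrite /hip (svalP hip_key). Qed.

Fact hnorm_key : {f : state R N -> R | f = Hnorm rho}.
Proof. by exists (Hnorm rho). Qed.

Definition hnorm : state R N -> R := sval hnorm_key.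

Lemma hnormE U : hnorm U = Hnorm rho U.
Proof. by rewrite /hnorm (svalP hnorm_key). Qed.

Lemma lin1 (a : R) U W : (a%:C *: U + W).1 = fun j x => a%:C * U.1 j x + W.1 j x.
Proof. by []. Qed.

Lemma lin2 (a : R) U W : (a%:C *: U + W).2 = fun j x => a%:C * U.2 j x + W.2 j x.
Proof. by []. Qed.

Lemma feature_sqint U j k : inH U -> sqint (cell j) (feature U j k).
Proof.
move=> [[Hu _ _] Lv]; rewrite /feature; case: k => -[] b /=.
  have [_ Lg _ _ _] := H1_isH1 (Hu j).
  by apply: (sqintZ _ (@measurable_cell R j)); have /L2_part := Lg.
by have /L2_part := Lv j.
Qed.

Lemma feature_lin (a : R) U W j k : inH U -> inH W ->
  ae_eq mu (cell j) (feature (a%:C *: U + W) j k)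
    (fun x => a * feature U j k x + feature W j k x).
Proof.
move=> [[Hu _ _] Lv] [[Hu' _ _] Lv']; rewrite /feature; case: k => -[] b; rewrite ?lin1 ?lin2 /=.
  have [_ + _] := H1_lin a (Hu j) (Hu' j).
  by apply: filterS => x h jx; rewrite h// partD partZ mulrDr mulrCA.
by apply: aeW => x jx; rewrite partD partZ.
Qed.

Lemma inH_lin (a : R) U W : inH U -> inH W -> inH (a%:C *: U + W).
Proof.
move=> [[Hu bu cu] Lv] [[Hu' bu' cu'] Lv']; split; last by move=> j; rewrite lin2; exact: L2_lin.
have itv j : j%:R <= j.+1%:R :> R by exact/ltW/natS_gt.
rewrite lin1; split.
- by move=> j; case: (H1_lin a (Hu j) (Hu' j)).
- move=> j jN; have [_ _ ->] := H1_lin a (Hu j) (Hu' j); first by rewrite bu// bu'// mulr0 addr0.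
  by have -> : N%:R = j.+1%:R :> R; [rewrite jN|rewrite itv lexx].
- move=> i j ij; have [_ _ ti] := H1_lin a (Hu i) (Hu' i).
  have [_ _ tj] := H1_lin a (Hu j) (Hu' j).
  have e : j%:R = i.+1%:R :> R by rewrite ij.
  rewrite (ti j%:R); last by rewrite e itv lexx.
  rewrite (tj j%:R); last by rewrite lexx itv.
  by rewrite (cu i j ij) (cu' i j ij).
Qed.

Lemma isH1_0 (j : nat) : isH1 j (fun=> 0 : R[i]) (fun=> 0) (fun=> 0).
Proof.
have mc := @measurable_cell R j.
have L0 : L2 (cell j) (fun=> 0 : R[i]).
  by apply/L2_part => b; rewrite part0; exact: (sqint_cst _ mc (cell_lty j)).
apply/isH1_part; split => //; first exact: aeW.
move=> b x _ /=; rewrite part0 add0r Rintegral_cst ?mul0r//; exact: measurable_itv.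
Qed.

Lemma inH0 : inH (0 : state R N).
Proof.
have itv (j : nat) : j%:R <= j.+1%:R :> R by exact/ltW/natS_gt.
have Z (j : nat) := isH1P (isH1_0 j).
have L0 (j : nat) : L2 (cell j) (fun=> 0 : R[i]) by case: (isH1_0 j).
split; last by move=> j; exact: L0.
split; first by move=> j; case: (Z j).
- move=> j jN; have [_ _ ->] := Z j => //.
  by have -> : N%:R = j.+1%:R :> R; [rewrite jN|rewrite itv lexx].
- move=> i j ij; have [_ _ ti] := Z i; have [_ _ tj] := Z j.
  have e : j%:R = i.+1%:R :> R by rewrite ij.
  rewrite (ti j%:R); last by rewrite e itv lexx.
  by rewrite (tj j%:R)// lexx itv.
Qed.

Lemma dot_ae (j : nat) (f g h : R -> R) : sqint (cell j) f -> sqint (cell j) g -> sqint (cell j) h ->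
  ae_eq mu (cell j) f g ->
  \int[mu]_(x in cell j) (f x * h x) = \int[mu]_(x in cell j) (g x * h x).
Proof.
move=> sf sg sh fg; have mc := @measurable_cell R j.
rewrite /Rintegral; congr fine; apply: ae_eq_integral => //.
- exact: (measurable_int mu (sqintM mc sf sh)).
- exact: (measurable_int mu (sqintM mc sg sh)).
- by apply: filterS fg => x e jx; rewrite e.
Qed.

Lemma hipC U W : hip U W = hip W U.
Proof.
by rewrite !hipE; apply: eq_bigr => j _; apply: eq_bigr => k _; apply: eq_Rintegral => x _; rewrite mulrC.
Qed.

Lemma hip_ge0 U : 0 <= hip U U.
Proof.
rewrite hipE; apply: sumr_ge0 => j _; apply: sumr_ge0 => k _; apply: Rintegral_ge0 => x _.
by rewrite -expr2 sqr_ge0.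
Qed.

Lemma hip_lin (a : R) U V W : inH U -> inH V -> inH W ->
  hip (a%:C *: U + V) W = a * hip U W + hip V W.
Proof.
move=> hU hV hW; rewrite !hipE mulr_sumr -big_split; apply: eq_bigr => j _ /=.
rewrite mulr_sumr -big_split; apply: eq_bigr => k _ /=.
have mc := @measurable_cell R j.
have sU := feature_sqint j k hU; have sV := feature_sqint j k hV; have sW := feature_sqint j k hW.
rewrite (dot_ae _ _ sW (feature_lin a j k hU hV)); last 2 first.
- by apply: feature_sqint; exact: inH_lin.
- exact: (sqintD mc (sqintZ a mc sU) sV).
under eq_Rintegral do rewrite mulrDl -mulrA.
rewrite (RintegralD mc (integrableZl mc a (sqintM mc sU sW)) (sqintM mc sV sW)).
by rewrite (RintegralZl _ mc (sqintM mc sU sW)).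
Qed.

Lemma sum_bool2 (F : bool * bool -> R) :
  \sum_k F k = F (true, true) + F (true, false) + (F (false, true) + F (false, false)).
Proof.
have -> : \sum_k F k = \sum_(a : bool) \sum_(b : bool) F (a, b).
  by rewrite pair_bigA; apply: eq_bigr => -[].
by rewrite big_bool !big_bool.
Qed.

Lemma Rintegral_sum4 (j : nat) (F : bool * bool -> R -> R) :
  (forall k, mu.-integrable (cell j) (EFin \o F k)) ->
  \int[mu]_(x in cell j) (\sum_k F k x) = \sum_k \int[mu]_(x in cell j) F k x.
Proof.
move=> IF; have mc := @measurable_cell R j.
under eq_Rintegral do rewrite sum_bool2.
rewrite sum_bool2.
have I1 := integrableD mc (IF (true, true)) (IF (true, false)).
have I2 := integrableD mc (IF (false, true)) (IF (false, false)).
rewrite (RintegralD mc I1 I2).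
rewrite (RintegralD mc (IF (true, true)) (IF (true, false))).
by rewrite (RintegralD mc (IF (false, true)) (IF (false, false))).
Qed.

Lemma Re_Hdot U W : inH U -> inH W -> complex.Re (Hdot rho U W) = hip U W.
Proof.
move=> hU hW; rewrite hipE /Hdot raddf_sum; apply: eq_bigr => j _ /=.
have mc := @measurable_cell R j.
rewrite -(@Rintegral_sum4 j (fun k x => feature U j k x * feature W j k x)); last first.
  by move=> k; exact: (sqintM mc (feature_sqint j k hU) (feature_sqint j k hW)).
apply: eq_Rintegral => x _; rewrite sum_bool2 /feature /=.
have r2 : Num.sqrt (rho j) * Num.sqrt (rho j) = rho j by rewrite -expr2 sqr_sqrtr// ltW.
case: (U.2 j x) (W.2 j x) (wd j (U.1 j) x) (wd j (W.1 j) x) => a b [a' b'] [c d] [c' d'] /=.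
by move: (Num.sqrt (rho j)) r2 => s <-; ring.
Qed.

Lemma hnorm_ge0 U : 0 <= hnorm U.
Proof. by rewrite hnormE /Hnorm sqrtr_ge0. Qed.

Lemma hnormM U : inH U -> hnorm U * hnorm U = hip U U.
Proof.
by move=> hU; rewrite -expr2 hnormE /Hnorm Re_Hdot// sqr_sqrtr// hip_ge0.
Qed.

Lemma energyE (U : R -> state R N) t : inH (U t) -> energy rho U t = 2^-1 * hip (U t) (U t).
Proof.
move=> hU; rewrite hipE /energy; congr (_ * _); apply: eq_bigr => j _.
have mc := @measurable_cell R j.
rewrite -(@Rintegral_sum4 j (fun k x => feature (U t) j k x * feature (U t) j k x)); last first.
  by move=> k; exact: (sqintM mc (feature_sqint j k hU) (feature_sqint j k hU)).
apply: eq_Rintegral => x _; rewrite sum_bool2 /feature /=.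
have r2 : Num.sqrt (rho j) * Num.sqrt (rho j) = rho j by rewrite -expr2 sqr_sqrtr// ltW.
case: ((U t).2 j x) (wd j ((U t).1 j) x) => a b [c d] /=.
by rewrite !sqr_sqrtr ?addr_ge0 ?sqr_ge0//; move: (Num.sqrt (rho j)) r2 => s <-; ring.
Qed.

Lemma Hdiv_lin U W : U - W = (-1)%:C *: W + U.
Proof.
rewrite addrC; congr (_ + _).
have -> : ((-1)%:C : R[i]) = -1 by rewrite rmorphN rmorph1.
by rewrite scaleN1r.
Qed.

Lemma inHB U W : inH U -> inH W -> inH (U - W).
Proof. by move=> hU hW; rewrite Hdiv_lin; exact: inH_lin. Qed.

Lemma inHD U W : inH U -> inH W -> inH (U + W).
Proof.
move=> hU hW; have -> : U + W = (1%:C : R[i]) *: U + W by rewrite scale1r.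
exact: inH_lin.
Qed.

Lemma inHZ (a : R) U : inH U -> inH (a%:C *: U).
Proof. by move=> hU; rewrite -[_ *: U]addr0; apply: inH_lin => //; exact: inH0. Qed.

Lemma hipBl U V W : inH U -> inH V -> inH W -> hip (U - V) W = hip U W - hip V W.
Proof. by move=> hU hV hW; rewrite Hdiv_lin hip_lin// mulN1r addrC. Qed.

Lemma hip_CauchySchwarz U W : inH U -> inH W -> hip U W ^+ 2 <= hip U U * hip W W.
Proof.
move=> hU hW.
have E t : 0 <= t ^+ 2 * hip U U + 2 * t * hip U W + hip W W.
  have hUW := inH_lin t hU hW.
  have := hip_ge0 (t%:C *: U + W).
  rewrite (hip_lin t hU hW hUW) (hipC U) (hipC W) !(hip_lin t hU hW)// (hipC W U).
  by congr (0 <= _); ring.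
have A0 := hip_ge0 U; have C0 := hip_ge0 W.
(* In the degenerate case the trinomial [E] is affine in [t]. If its slope were nonzero, it would
   take the value -1 at the chosen point. *)
have [A|A] := eqVneq (hip U U) 0.
  have [->|B] := eqVneq (hip U W) 0; first by rewrite expr0n /= mulr_ge0.
  have := E (- (hip W W + 1) / (2 * hip U W)).
  have -> : 2 * (- (hip W W + 1) / (2 * hip U W)) * hip U W = - (hip W W + 1) by field.
  by rewrite A mulr0 add0r; lra.
have := E (- hip U W / hip U U).
have -> : (- hip U W / hip U U) ^+ 2 * hip U U + 2 * (- hip U W / hip U U) * hip U W + hip W W =
   (hip U U * hip W W - hip U W ^+ 2) / hip U U by field.
by rewrite pmulr_lge0 ?invr_gt0 ?lt_def ?A// subr_ge0.
Qed.

Lemma ler_of_sqr (a b : R) : 0 <= b -> a * a <= b * b -> a <= b.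
Proof. by move=> b0 ab; rewrite leNgt; apply/negP => ba; nra. Qed.

Lemma hip_le_hnorm U W : inH U -> inH W -> hip U W <= hnorm U * hnorm W.
Proof.
move=> hU hW; apply: ler_of_sqr; first by apply: mulr_ge0; exact: hnorm_ge0.
have -> : hnorm U * hnorm W * (hnorm U * hnorm W) =
  (hnorm U * hnorm U) * (hnorm W * hnorm W) by ring.
by rewrite !hnormM// -expr2; exact: hip_CauchySchwarz.
Qed.

Lemma hipDl U V W : inH U -> inH V -> inH W -> hip (U + V) W = hip U W + hip V W.
Proof.
move=> hU hV hW; have E : U + V = (1%:C : R[i]) *: U + V by rewrite scale1r.
by rewrite E (hip_lin 1 hU hV hW) mul1r.
Qed.

Lemma hipZl (a : R) U W : inH U -> inH W -> hip (a%:C *: U) W = a * hip U W.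
Proof.
move=> hU hW; have z : hip 0 W = 0.
  have := hip_lin 1 inH0 inH0 hW; rewrite scale1r addr0 mul1r.
  by move/eqP; rewrite -subr_eq0 opprD addNKr oppr_eq0 => /eqP.
by rewrite -[_ *: U]addr0 (hip_lin a hU inH0 hW) z addr0.
Qed.

Lemma hnorm_triangle U W : inH U -> inH W -> hnorm (U + W) <= hnorm U + hnorm W.
Proof.
move=> hU hW; apply: ler_of_sqr; first by apply: addr_ge0; exact: hnorm_ge0.
have hUW := inHD hU hW.
rewrite (hnormM hUW) (hipDl hU hW hUW) (hipC U) (hipC W).
rewrite (hipDl hU hW hU) (hipDl hU hW hW) (hipC W U).
have := hip_le_hnorm hU hW; rewrite -(hnormM hU) -(hnormM hW).
by lra.
Qed.

Lemma hnormZ (a : R) U : inH U -> hnorm (a%:C *: U) = `|a| * hnorm U.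
Proof.
move=> hU; have hZ := inHZ a hU.
have E : hnorm (a%:C *: U) * hnorm (a%:C *: U) =
   (`|a| * hnorm U) * (`|a| * hnorm U).
  rewrite (hnormM hZ) (hipZl a hU hZ) hipC (hipZl a hU hU) -(hnormM hU).
  have : `|a| * `|a| = a * a by rewrite -normrM ger0_norm// -expr2 sqr_ge0.
  move: (`|a|) (hnorm U) => x y xa; rewrite mulrACA xa; ring.
have n1 := hnorm_ge0 (a%:C *: U); have n2 : 0 <= `|a| * hnorm U.
  by apply: mulr_ge0; [|exact: hnorm_ge0].
by apply/eqP; rewrite eq_le; apply/andP; split; apply: ler_of_sqr => //; rewrite E.
Qed.

Lemma hnormN U : inH U -> hnorm (- U) = hnorm U.
Proof.
move=> hU; have -> : - U = (-1)%:C *: U.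
  have -> : ((-1)%:C : R[i]) = -1 by rewrite rmorphN rmorph1.
  by rewrite scaleN1r.
by rewrite hnormZ// normrN1 mul1r.
Qed.

End EnergyProduct.


(** * Equality in H and vanishing of the norm *)

Section GeneratorDomain.
Import numFieldNormedType.Exports.
Local Open Scope classical_set_scope.
Local Open Scope complex_scope.
Context {R : realType} {N : nat} (rho : 'I_N -> R) (hrho : forall j, 0 < rho j).
Notation mu := (@lebesgue_measure R).
Notation hip := (hip rho).
Notation hnorm := (hnorm rho).
Implicit Types (U V W X : state R N) (j : 'I_N) (k : bool * bool).

Lemma Heq_refl U : Heq U U.
Proof. by move=> j; split; exact: aeW. Qed.

Lemma Heq_sym U W : Heq U W -> Heq W U.
Proof. by move=> h j; have [h1 h2] := h j; split; exact: ae_eq_sym. Qed.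

Lemma Heq_trans U V W : Heq U V -> Heq V W -> Heq U W.
Proof.
by move=> h h' j; have [h1 h2] := h j; have [h1' h2'] := h' j; split;
  [exact: ae_eq_trans h1 h1'|exact: ae_eq_trans h2 h2'].
Qed.

Lemma Heq_lin (a : R) U V U' V' : Heq U U' -> Heq V V' ->
  Heq (a%:C *: U + V) (a%:C *: U' + V').
Proof.
move=> h h' j; have [h1 h2] := h j; have [h1' h2'] := h' j; rewrite !lin1 !lin2.
by split; exact: ae_eq_lin.
Qed.

Lemma HeqB U V U' V' : Heq U U' -> Heq V V' -> Heq (U - V) (U' - V').
Proof. by move=> h h'; rewrite !Hdiv_lin; exact: Heq_lin. Qed.

Lemma HeqD U V U' V' : Heq U U' -> Heq V V' -> Heq (U + V) (U' + V').
Proof.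
move=> h h'; have -> : U + V = (1%:C : R[i]) *: U + V by rewrite scale1r.
have -> : U' + V' = (1%:C : R[i]) *: U' + V' by rewrite scale1r.
exact: Heq_lin.
Qed.

Lemma feature_Heq U W j k : inH U -> inH W -> Heq U W ->
  ae_eq mu (cell j) (feature rho U j k) (feature rho W j k).
Proof.
move=> [[Hu _ _] Lv] [[Hw _ _] Lw] UW; rewrite /feature; have [e1 e2] := UW j.
case: k => -[] b /=.
  have [Lw1 _] := Hw j; have [_ -> _] := H1_ae (Hu j) Lw1 e1.
  by apply: aeW.
by have /ae_eq_part := e2.
Qed.

Lemma hip_Heq U W X : inH U -> inH W -> inH X -> Heq U W -> hip U X = hip W X.
Proof.
move=> hU hW hX UW; rewrite !hipE; apply: eq_bigr => j _; apply: eq_bigr => k _.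
by apply: dot_ae; [exact: feature_sqint|exact: feature_sqint|exact: feature_sqint|exact: feature_Heq].
Qed.

Lemma hnorm_Heq U W : inH U -> inH W -> Heq U W -> hnorm (U - W) = 0.
Proof.
move=> hU hW UW; have hUW := inHB hU hW.
have := hnormM hrho hUW; rewrite (hipBl _ hU hW hUW) (hip_Heq hU hW hUW UW) subrr.
by move/eqP; rewrite mulf_eq0 orbb => /eqP.
Qed.

Lemma inH_const_trace U j (x : R) : inH U ->
  (forall b, ae_eq mu (cell j) (fun y => part b (wd j (U.1 j) y)) (cst 0)) ->
  j%:R <= x <= j.+1%:R -> trace j (U.1 j) x = trace j (U.1 j) j%:R.
Proof.
move=> [[Hu _ _] _] w0 xj; have /isH1_part[_ Lg _ P] := H1_isH1 (Hu j).
apply: part_eqP => b; rewrite (P b x xj); set I := Rintegral _ _ _.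
suff -> : I = 0 by rewrite addr0.
have mx : measurable (`[j%:R, x] : set (measurableTypeR R)) by exact: measurable_itv.
have Sx : (`]j%:R, x[%classic : set R) `<=` cell j.
  by case/andP: xj => _ xj; apply: subset_itvl; rewrite bnd_simp.
have mxo : measurable (`]j%:R, x[ : set (measurableTypeR R)) by exact: measurable_itv.
have /L2_part /(_ b)[mg _] := Lg.
have mgx : measurable_fun (`]j%:R, x[%classic : set R) (fun y => part b (wd j (U.1 j) y)).
  by apply: measurable_funS mg => //; exact: measurable_cell.
rewrite /I /Rintegral integral_itv_bndoo; last exact/measurable_EFinP.
rewrite (ae_eq_integral (cst 0%E)) ?integral0//.
- exact/measurable_EFinP.
- by have := w0 b; apply: filterS => y h jy /=; rewrite (h (Sx _ jy)).
Qed.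

(** The norm sees only [u'] and [v]. When it vanishes, [u] is constant on each cell; continuity at
    the nodes and the condition at [N] make these constants zero. *)
Lemma hnorm0_Heq U : inH U -> hnorm U = 0 -> Heq U 0.
Proof.
move=> hU U0; have [[Hu bN ci] Lv] := hU.
have mc := @measurable_cell R.
have F0 j k : ae_eq mu (cell j) (feature rho U j k) (cst 0).
  have sF := feature_sqint rho j k hU.
  apply: (sqint_norm0 (mc j) sF).
  have : hip U U = 0 by rewrite -(hnormM hrho hU) U0 mul0r.
  have ge0 i l : 0 <= \int[mu]_(x in cell (nat_of_ord i)) (feature rho U i l x * feature rho U i l x).
    by apply: Rintegral_ge0 => x _; rewrite -expr2 sqr_ge0.
  rewrite hipE => /eqP; rewrite psumr_eq0; last by move=> i _; exact: sumr_ge0.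
  move=> /allP/(_ j (mem_index_enum j)) /=.
  by rewrite psumr_eq0// => /allP/(_ k (mem_index_enum k)) /= /eqP.
have w0 j b : ae_eq mu (cell j) (fun y => part b (wd j (U.1 j) y)) (cst 0).
  have := F0 j (true, b); apply: filterS => x h jx; move: (h jx); rewrite /feature /=.
  by move/eqP; rewrite mulf_eq0 sqrtr_eq0 leNgt hrho /= => /eqP.
have v0 j : ae_eq mu (cell j) (U.2 j) (fun=> 0).
  by apply/ae_eq_part => b; have := F0 j (false, b); apply: filterS => x h jx; rewrite part0; exact: (h jx).
have itv (i : nat) : i%:R <= i.+1%:R :> R by exact/ltW/natS_gt.
(* Induction on the number of cells to the right of cell [j]: the zero value spreads leftwards from
   the clamped end. *)
have T0 n : forall j : 'I_N, (N - j.+1 <= n)%N ->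
    forall x, j%:R <= x <= j.+1%:R -> trace j (U.1 j) x = 0.
  elim: n => [|n IH] j jn x xj; rewrite (inH_const_trace hU (w0 j) xj).
    have jN : j.+1 = N by apply/eqP; rewrite eqn_leq ltn_ord -subn_eq0 -leqn0.
    rewrite -(inH_const_trace (x := j.+1%:R) hU (w0 j)) ?itv ?lexx//.
    by have -> : j.+1%:R = N%:R :> R; [rewrite jN|exact: bN].
  rewrite -(inH_const_trace (x := j.+1%:R) hU (w0 j)) ?itv ?lexx//.
  have [jN|jN] := eqVneq j.+1 N.
    by have -> : j.+1%:R = N%:R :> R; [rewrite jN|exact: bN].
  have j1 : (j.+1 < N)%N by rewrite ltn_neqAle jN ltn_ord.
  rewrite (ci j (Ordinal j1))//; apply: IH; rewrite /= ?lexx ?itv//.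
  by rewrite -ltnS (leq_trans _ jn)// ltn_sub2l.
move=> j; split; last exact: v0.
have [_ _ tu _ _] := H1_isH1 (Hu j).
apply: filterS tu => x h jx; rewrite -(h jx) (T0 N)//; first by rewrite leq_subr.
by move: jx; rewrite /cell /= in_itv /= => /andP[? ?]; rewrite !ltW.
Qed.

Lemma HeqB0 U W : Heq (U - W) 0 -> Heq U W.
Proof.
move=> h j; have [h1 h2] := h j.
by split; [apply: filterS h1|apply: filterS h2] => x e jx; move: (e jx) => /eqP;
  rewrite subr_eq0 => /eqP.
Qed.

Lemma Heq_hnorm U W : inH U -> inH W -> hnorm (U - W) = 0 -> Heq U W.
Proof. by move=> hU hW h; apply: HeqB0; apply: hnorm0_Heq => //; exact: inHB. Qed.

End GeneratorDomain.

(** * The generator *)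


Section Generator.
Import numFieldNormedType.Exports.
Local Open Scope classical_set_scope.
Local Open Scope complex_scope.
Context {R : realType} {N : nat} (rho : 'I_N -> R) (hrho : forall j, 0 < rho j).
Notation mu := (@lebesgue_measure R).
Notation hip := (hip rho).
Notation opA := (opA rho).
Notation inDA := (inDA rho).
Implicit Types (U V W X Z : state R N) (j : 'I_N) (k : bool * bool).

Lemma inDA_inH U : inDA U -> inH U.
Proof. by move=> [[hV _] [h1 _ _] _ _]; split => // j; case: (h1 j). Qed.

Lemma H1_L2wd j u : @H1 R j u -> L2 (cell j) (wd j u).
Proof. by move=> /H1_isH1[]. Qed.

Lemma L2Z (j : nat) (a : R) (u : R -> R[i]) : L2 (cell j) u -> L2 (cell j) (fun x => a%:C * u x).
Proof.
move=> Lu; have [L0 _ _ _ _] := @isH1_0 R j.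
by have := L2_lin a Lu L0; under eq_fun do rewrite addr0.
Qed.

Lemma opA_inH U : inDA U -> inH (opA U).
Proof.
move=> [[hV h2] hV2 _ _]; split => // j; apply: L2Z.
by case: (h2 j) => _; exact: H1_L2wd.
Qed.

Lemma inV_ae (u v : components R N) : inV u -> (forall j : 'I_N, L2 (cell j) (v j)) ->
  (forall j : 'I_N, ae_eq mu (cell j) (u j) (v j)) -> inV v.
Proof.
move=> [Hu bN ci] Lv uv.
have E j := H1_ae (Hu j) (Lv j) (uv j).
split.
- by move=> j; case: (E j).
- by move=> j jN; have [_ _ ->] := E j; exact: bN.
- by move=> i j ij; have [_ _ ->] := E j; have [_ _ ->] := E i; exact: ci.
Qed.

(** By [H1_ae] the derivatives and traces of [Z] and [U] are the same functions, so the node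
    conditions carry over literally. This moves statements about D(A) between representatives of a
    solution. *)
Lemma inDA_Heq U Z : inDA Z -> inH U -> Heq Z U -> inDA U /\ Heq (opA Z) (opA U).
Proof.
move=> [[hV h2] hV2 b0 bi] [hU LU] ZU.
have E j : wd j (U.1 j) = wd j (Z.1 j).
  have [Hz _ _] := hV; have [Hu _ _] := hU; have [Lu _] := Hu j.
  by case: (H1_ae (Hz j) Lu (ZU j).1).
have E2 j : trace j (U.2 j) = trace j (Z.2 j).
  have [Hz _ _] := hV2.
  by case: (H1_ae (Hz j) (LU j) (ZU j).2).
split.
  split.
  - split; first exact: hU.
    move=> j; have [Hu _ _] := hU; split; first exact: Hu.
    by rewrite E; case: (h2 j).
  - by apply: (inV_ae hV2) => // j; case: (ZU j).
  - by move=> j j0; rewrite E E2 b0.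
  - by move=> i j ij; rewrite !E bi.
move=> j; split; first by case: (ZU j).
by apply: aeW => x _ /=; rewrite E.
Qed.

Lemma inV_lin (a : R) (u v : components R N) : inV u -> inV v -> inV (fun j x => a%:C * u j x + v j x).
Proof.
move=> hu hv; have L0 (j : 'I_N) : L2 (cell j) (fun=> 0 : R[i]) by case: (@isH1_0 R j).
have : inH (a%:C *: ((u, fun _ _ => 0) : state R N) + (v, fun _ _ => 0)).
  by apply: inH_lin; split => // j; exact: L0.
by case.
Qed.

(** Linearity of [opA] holds only up to [Heq], since [wd] of a combination is a new choice. The node
    conditions are linear in the traces, which do combine exactly. *)
Lemma inDA_lin (a : R) U W : inDA U -> inDA W ->
  inDA (a%:C *: U + W) /\ Heq (opA (a%:C *: U + W)) (a%:C *: opA U + opA W).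
Proof.
move=> dU dW; have [[hV h2] hV2 b0 bi] := dU; have [[hV' h2'] hV2' b0' bi'] := dW.
have itv (i : nat) : i%:R <= i.+1%:R :> R by exact/ltW/natS_gt.
have E j : [/\ H1 j (wd j ((a%:C *: U + W).1 j)),
    ae_eq mu (cell j) (wd j (wd j ((a%:C *: U + W).1 j)))
      (fun x => a%:C * wd j (wd j (U.1 j)) x + wd j (wd j (W.1 j)) x) &
    forall x, j%:R <= x <= j.+1%:R ->
      trace j (wd j ((a%:C *: U + W).1 j)) x =
      a%:C * trace j (wd j (U.1 j)) x + trace j (wd j (W.1 j)) x].
  rewrite lin1; have [H1u H1wu] := h2 j; have [H1u' H1wu'] := h2' j.
  have [Hl wl _] := H1_lin a H1u H1u'.
  have [Hwl wwl twl] := H1_lin a H1wu H1wu'.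
  by have [? -> ->] := H1_ae Hwl (H1_L2wd Hl) (ae_eq_sym wl).
have L (r k x y x' y' : R[i]) : r * x = x' -> r * y = y' -> r * (k * x + y) = k * x' + y'.
  by move=> <- <-; rewrite mulrDr mulrCA.
split.
  split.
  - split; first by rewrite lin1; exact: inV_lin.
    move=> j; split; last by case: (E j).
    by rewrite lin1; have [Hu _ _] := hV; have [Hu' _ _] := hV'; case: (H1_lin a (Hu j) (Hu' j)).
  - by rewrite lin2; exact: inV_lin.
  - move=> j j0; have [_ _ ->] := E j; last by rewrite j0 lexx ler01.
    rewrite lin2; have [Hv _ _] := hV2; have [Hv' _ _] := hV2'.
    have [_ _ ->] := H1_lin a (Hv j) (Hv' j); last by rewrite j0 lexx ler01.
    exact: (L _ _ _ _ _ _ (b0 j j0) (b0' j j0)).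
  - move=> i j ij; have e : j%:R = i.+1%:R :> R by rewrite ij.
    have [_ _ ti] := E i; have [_ _ tj] := E j.
    rewrite (ti j%:R); last by rewrite e itv lexx.
    rewrite (tj j%:R); last by rewrite lexx itv.
    have lin (r s b p q p' q' : R[i]) : r * p = s * q -> r * p' = s * q' ->
        r * (b * p + p') = s * (b * q + q').
      by move=> e1 e2; rewrite !mulrDr !(mulrCA _ b) e1 e2.
    by apply: lin; [exact: bi|exact: bi'].
move=> j; split; first exact: aeW.
have [_ + _] := E j; apply: filterS => x h jx /=.
by rewrite (h jx); rewrite mulrDr mulrCA.
Qed.

Lemma inDAB U W : inDA U -> inDA W -> inDA (U - W) /\ Heq (opA (U - W)) (opA U - opA W).
Proof. by move=> dU dW; rewrite !Hdiv_lin; exact: inDA_lin. Qed.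

Lemma inDAD U W : inDA U -> inDA W -> inDA (U + W) /\ Heq (opA (U + W)) (opA U + opA W).
Proof.
move=> dU dW; have -> : U + W = (1%:C : R[i]) *: U + W by rewrite scale1r.
have -> : opA U + opA W = (1%:C : R[i]) *: opA U + opA W by rewrite scale1r.
exact: inDA_lin.
Qed.

(* The boundary terms of the integration by parts telescope over the nodes. *)
Lemma dissipation U (hN : (0 < N)%N) : inDA U ->
  hip (opA U) U = - Normc.normc (trace 0 (U.2 (Ordinal hN)) 0) ^+ 2.
Proof.
move=> dU; have hU := inDA_inH dU; have hA := opA_inH dU.
have [[hV h2] [Hv vN vi] b0 bi] := dU; have [Hu _ _] := hV.
have mc := @measurable_cell R.
pose u' j := trace j (wd j (U.1 j)); pose v j := trace j (U.2 j).
pose B j x := \sum_b rho j * (part b (u' j x) * part b (v j x)).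
have cellE j : \sum_k \int[mu]_(x in cell j) (feature rho (opA U) j k x * feature rho U j k x) =
    B j j.+1%:R - B j j%:R.
  have := H1_isH1 (Hv j) => /isH1_part[_ Lv' ev Pv].
  have [_ H1w] := h2 j; have := H1_isH1 H1w => /isH1_part[_ Lu'' eu Pu].
  have /L2_part sv' := Lv'; have /L2_part su'' := Lu''.
  have Pb b := primitive_parts (su'' b) (sv' b) (Pu b) (Pv b).
  have r2 : Num.sqrt (rho j) * Num.sqrt (rho j) = rho j by rewrite -expr2 sqr_sqrtr// ltW.
  have Ib b : \int[mu]_(x in cell j) (feature rho (opA U) j (true, b) x * feature rho U j (true, b) x) +
     \int[mu]_(x in cell j) (feature rho (opA U) j (false, b) x * feature rho U j (false, b) x) =
     rho j * (part b (u' j j.+1%:R) * part b (v j j.+1%:R)) - rho j * (part b (u' j j%:R) * part b (v j j%:R)).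
    have s1 k := feature_sqint rho j k hA; have s2 k := feature_sqint rho j k hU.
    rewrite -(RintegralD (mc j) (sqintM (mc j) (s1 _) (s2 _)) (sqintM (mc j) (s1 _) (s2 _))).
    rewrite -mulrBr -Pb.
    have spu := primitive_on_sqint (su'' b) (Pu b).
    have spv := primitive_on_sqint (sv' b) (Pv b).
    have I1 := integrableD (mc j) (sqintM (mc j) spu (sv' b)) (sqintM (mc j) (su'' b) spv).
    rewrite -(RintegralZl _ (mc j) I1).
    rewrite /Rintegral; congr fine; apply: ae_eq_integral => //.
    - exact: (measurable_int mu (integrableD (mc j) (sqintM (mc j) (s1 _) (s2 _)) (sqintM (mc j) (s1 _) (s2 _)))).
    - exact: (measurable_int mu (integrableZl (mc j) (rho j) I1)).
    - move: ev eu; apply: filterS2 => x e1 e2 jx; congr EFin.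
      rewrite -/(u' j) -/(v j) in e1 e2 *; rewrite (e1 jx) (e2 jx) /feature /= partZ.
      by move: (Num.sqrt (rho j)) r2 => s <-; ring.
  by rewrite sum_bool2 addrACA !Ib /B !big_bool /=; ring.
(* The default value 0, reached at [n = N], is the boundary term of the clamped end. *)
pose L (n : nat) : R := if insub n is Some j then B j n%:R else 0.
have LE j : L j = B j j%:R by rewrite /L insubT//= => h; congr (B _ _); exact: val_inj.
have LS j : B j j.+1%:R = L j.+1.
  rewrite /L; case: insubP => [i _ ij|/=]; last first.
    rewrite -leqNgt => Nj; have jN : j.+1 = N by apply/eqP; rewrite eqn_leq Nj ltn_ord.
    rewrite /B big1// => b _; have -> : j.+1%:R = N%:R :> R by rewrite jN.
    by rewrite /v vN// part0 !mulr0.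
  have e : j.+1%:R = i%:R :> R by rewrite ij.
  rewrite /B e; apply: eq_bigr => b _; rewrite !mulrA; congr (_ * _).
    by rewrite -!partZ /u' (bi j i (esym ij)).
  by rewrite /v (vi j i (esym ij)).
rewrite hipE /hip_sum; under eq_bigr do rewrite cellE LS -LE.
rewrite -(big_mkord xpredT (fun i => L i.+1 - L i)) telescope_sumr//.
have -> : L N = 0 by rewrite /L insubF// ltnn.
rewrite sub0r (LE (Ordinal hN)) /B.
have K b : rho (Ordinal hN) * (part b (u' (Ordinal hN) 0) * part b (v (Ordinal hN) 0)) =
    part b (trace 0 (U.2 (Ordinal hN)) 0) ^+ 2.
  by rewrite mulrA expr2; congr (_ * _); rewrite -partZ /u' (b0 (Ordinal hN)).
rewrite (eq_bigr (fun b => part b (trace 0 (U.2 (Ordinal hN)) 0) ^+ 2)); last by move=> b _; exact: K.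
rewrite big_bool /=; case: (trace 0 _ 0) => x y /=.
by rewrite sqr_sqrtr ?addr_ge0 ?sqr_ge0//; ring.
Qed.

End Generator.


(** * Differentiability in H and Riemann sums *)

Section RiemannSums.
Import numFieldNormedType.Exports.
Local Open Scope classical_set_scope.
Local Open Scope complex_scope.
Context {R : realType} {N : nat} (rho : 'I_N -> R) (hrho : forall j, 0 < rho j).
Notation hnorm := (hnorm rho).
Implicit Types (X Y : state R N) (U W Z : R -> state R N) (s : seq R) (tag : nat -> R).

Lemma within_nbhsP (t : R) (P : R -> Prop) :
  (\forall x \near within halfline (nbhs t), P x) <->
  exists2 d : R, 0 < d & forall x : R, 0 <= x -> `|x - t| < d -> P x.
Proof.
rewrite near_withinE; split => [/nbhs_ballP[d /= d0 h]|[d d0 h]].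
  by exists d => // x x0 xt; apply: h => //; rewrite /ball /= distrC.
by exists d => // x /=; rewrite distrC => xt x0; apply: h.
Qed.

Lemma within_dnbhsP (t : R) (P : R -> Prop) :
  (\forall x \near within halfline t^', P x) <->
  exists2 d : R, 0 < d & forall x : R, 0 <= x -> x != t -> `|x - t| < d -> P x.
Proof.
rewrite near_withinE /dnbhs near_withinE; split => [/nbhs_ballP[d /= d0 h]|[d d0 h]].
  by exists d => // x x0 xt xd; apply: h => //; rewrite /ball /= distrC.
by exists d => // x /=; rewrite distrC => xd xt x0; apply: h.
Qed.

Lemma contHP U : contH rho U <-> forall t : R, 0 <= t -> inH (U t) /\
  forall e : R, 0 < e -> exists2 d : R, 0 < d &
    forall s : R, 0 <= s -> `|s - t| < d -> hnorm (U s - U t) < e.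
Proof.
split=> H t t0; have [hU h] := H t t0; split; [exact: hU| |exact: hU|].
  move=> e e0; move/cvgrPdist_lt: h => /(_ e e0) /within_nbhsP[d d0 h]; exists d => // s s0 st.
  by have := h s s0 st; rewrite sub0r normrN -hnormE ger0_norm ?hnorm_ge0.
apply/cvgrPdist_lt => e e0; apply/within_nbhsP; have [d d0 hd] := h e e0.
by exists d => // s s0 st; rewrite sub0r normrN -hnormE ger0_norm ?hnorm_ge0// hd.
Qed.

(** First order expansion replacing the difference quotient of [derivH]: no division occurs and
    [s = t] is allowed. *)
Definition diffH U (t : R) X := forall e : R, 0 < e -> exists2 d : R, 0 < d &
  forall s : R, 0 <= s -> `|s - t| < d -> hnorm (U s - U t - (s - t)%:C *: X) <= e * `|s - t|.

Lemma derivHP U (t : R) X : (forall s : R, 0 <= s -> inH (U s)) -> 0 <= t ->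
  derivH rho U t X <-> inH X /\ diffH U t X.
Proof.
move=> hU t0.
have E (s : R) : inH X -> 0 <= s -> s != t ->
    Hnorm rho (((s - t)^-1)%:C *: (U s - U t) - X) = `|s - t|^-1 * hnorm (U s - U t - (s - t)%:C *: X).
  move=> hX s0 st; have st0 : s - t != 0 by rewrite subr_eq0.
  have hD : inH (U s - U t - (s - t)%:C *: X).
    by apply: inHB; [apply: inHB; exact: hU|exact: inHZ].
  rewrite -normfV -hnormZ// hnormE; congr Hnorm.
  rewrite [in RHS]scalerBr scalerA -rmorphM mulVf// rmorph1 scale1r//.
split=> -[hX h]; split=> //.
  move=> e e0; move/cvgrPdist_lt: h => /(_ e e0) /within_dnbhsP[d d0 h]; exists d => // s s0 sd.
  have [->|st] := eqVneq s t.
    rewrite !subrr normr0 mulr0 rmorph0 scale0r subrr.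
    by rewrite -(subrr X) hnorm_Heq//; exact: Heq_refl.
  have := h s s0 st sd; rewrite sub0r normrN E// ger0_norm; last first.
    by rewrite mulr_ge0 ?hnorm_ge0.
  by rewrite mulrC ltr_pdivrMr ?normr_gt0 ?subr_eq0// => /ltW.
apply/cvgrPdist_le => e e0; apply/within_dnbhsP; have [d d0 hd] := h e e0.
exists d => // s s0 st sd; rewrite sub0r normrN E// ger0_norm; last first.
  by rewrite mulr_ge0 ?hnorm_ge0.
by rewrite mulrC ler_pdivrMr ?normr_gt0 ?subr_eq0// hd.
Qed.

Lemma inH_sum (n : nat) (F : 'I_n -> state R N) : (forall i, inH (F i)) -> inH (\sum_i F i).
Proof. by move=> h; elim/big_ind: _ => [|x y|i _]; [exact: inH0|exact: inHD|exact: h]. Qed.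

(** Errors proportional to the step lengths add up to an error proportional to the total length. The
    left end and the tags are quantified because the induction removes the first step. *)
Lemma rsum_bound U F (e : R) s : forall a tag, path <%R a s ->
  (forall r : R, a <= r -> inH (F r)) ->
  (forall i, (i < size s)%N -> inH (U (tag i)) /\
    hnorm ((s`_i - (a :: s)`_i)%:C *: U (tag i) - (F s`_i - F (a :: s)`_i)) <= (s`_i - (a :: s)`_i) * e) ->
  hnorm (\sum_(i < size s) (s`_i - (a :: s)`_i)%:C *: U (tag i) - (F (last a s) - F a)) <=
    (last a s - a) * e.
Proof.
elim: s => [|x s IH] a tag /=.
  move=> _ hF _; rewrite big_ord0 (subrr (F a)) (subrr a) mul0r subr0.
  by rewrite -(subrr (F a)) hnorm_Heq//; [exact: hF|exact: hF|exact: Heq_refl].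
move=> /andP[ax xs] hF h; rewrite big_ord_recl /=.
have [hU0 b0] := h 0%N isT; rewrite /= in b0.
have hx r : x <= r -> inH (F r) by move=> xr; apply: hF; rewrite (le_trans (ltW ax)).
have := IH x (tag \o S) xs hx (fun i => h i.+1).
have xl : x <= last x s.
  elim: s x xs {IH h hx ax hU0 b0} => //= y s IH x /andP[xy ys].
  exact: le_trans (ltW xy) (IH y ys).
set S2 := (X in hnorm (X - _) <= _ -> _).
set S1 := (X in _ -> hnorm (_ + X - _) <= _).
have -> : S1 = S2 by apply: eq_bigr => i _; rewrite /= /bump leq0n.
move=> h2.
have hS2 : inH S2.
  apply: inH_sum => i; apply: inHZ.
  by have [] := h i.+1 (ltn_ord i).
have -> : (x - a)%:C *: U (tag 0%N) + S2 - (F (last x s) - F a) =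
   ((x - a)%:C *: U (tag 0%N) - (F x - F a)) + (S2 - (F (last x s) - F x)).
  by rewrite !opprB [RHS]addrACA; congr (_ + _); rewrite addrA subrK.
have -> : (last x s - a) * e = (x - a) * e + (last x s - x) * e by ring.
have ha : inH (F a) by apply: hF.
have hFx : inH (F x) by exact: hx.
have hFl : inH (F (last x s)) by exact: hx.
have k1 : inH ((x - a)%:C *: U (tag 0%N) - (F x - F a)).
  by apply: inHB; [exact: inHZ|exact: inHB].
have k2 : inH (S2 - (F (last x s) - F x)) by apply: inHB => //; exact: inHB.
by have := hnorm_triangle hrho k1 k2; move/le_trans; apply; exact: lerD b0 h2.
Qed.

Lemma exists_partition (a b d : R) : 0 < d -> a <= b ->
  exists s, path (fun x y => (x < y) && (y - x < d)) a s /\ last a s = b.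
Proof.
move=> d0 ab.
(* Steps of length [d / 2] are taken until the remaining length is below [d]; [n] bounds their
   number. *)
have [n hn] : exists n : nat, b - a <= n%:R * (d / 2).
  exists (Num.truncn ((b - a) / (d / 2))).+1; rewrite -ler_pdivrMr ?divr_gt0//.
  exact/ltW/truncnS_gt.
elim: n a ab hn => [|n IH] a ab hn.
  exists [::]; split => //=; apply/eqP; rewrite eq_le ab /= -subr_le0.
  by move: hn; rewrite mul0r.
have [bd|bd] := ltP (b - a) d.
  move: ab; rewrite le_eqVlt => /predU1P[->|ab]; first by exists [::].
  by exists [:: b]; split => //=; rewrite ab bd.
have d2 : d / 2 < d by rewrite ltr_pdivrMr// ltr_pMr// ltr1n.
have h1 : a + d / 2 <= b by lra.
have h2 : b - (a + d / 2) <= n%:R * (d / 2) by move: hn; rewrite -natr1; lra.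
have [s [ps ls]] := IH _ h1 h2.
exists (a + d / 2 :: s); split => //=; rewrite ps andbT ltrDl divr_gt0//=.
by rewrite addrAC subrr add0r.
Qed.

End RiemannSums.

(** * Mild and classical solutions *)


Section ClassicalSolutions.
Import numFieldNormedType.Exports.
Local Open Scope classical_set_scope.
Local Open Scope complex_scope.
Context {R : realType} {N : nat} (rho : 'I_N -> R) (hrho : forall j, 0 < rho j).
Notation hnorm := (hnorm rho).
Implicit Types (X Y : state R N) (U V W Z : R -> state R N).

Lemma path_lt_bounds (s : seq R) : forall a, path <%R a s ->
  forall i, (i <= size s)%N -> a <= (a :: s)`_i <= last a s.
Proof.
elim: s => [|x s IH] a /=; first by move=> _ [|//] _; rewrite lexx.
move=> /andP[ax xs] [_|i] /=.
  have /andP[_ h] := IH x xs 0%N isT; by rewrite lexx (le_trans (ltW ax)).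
rewrite ltnS => si; have /andP[h1 h2] := IH x xs i si.
by rewrite h2 andbT (le_trans (ltW ax)).
Qed.

(** It suffices to compare, on short intervals, the increment of a candidate [W] with the length
    times any value of [U] taken there, uniformly on [[0, t]]. *)
Lemma is_intH_pieces U W (t : R) : 0 <= t -> (forall r : R, 0 <= r -> inH (U r)) ->
  (forall r : R, 0 <= r -> inH (W r)) -> Heq (W 0) 0 ->
  (forall e : R, 0 < e -> exists2 d : R, 0 < d & forall a r b : R, 0 <= a -> a <= r -> r <= b -> b <= t ->
     b - a < d -> hnorm ((b - a)%:C *: U r - (W b - W a)) <= (b - a) * e) ->
  is_intH rho U t (W t).
Proof.
move=> t0 hU hW W0 H; split; first exact: hW.
(* The total error is [t e / (t + 1) < e]; dividing by [t + 1] includes [t = 0]. *)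
move=> e e0; have e1 : 0 < e / (t + 1) by rewrite divr_gt0// ltr_wpDl.
have [d d0 hd] := H _ e1; exists d => // s tag [ps /eqP ls] htag.
have bd := path_lt_bounds ps.
have tag0 i : (i < size s)%N -> 0 <= tag i.
  move=> si; have [/andP[h _] _] := htag i si.
  by have /andP[h1 _] := bd i (ltnW si); exact: le_trans h1 h.
have hb : hnorm (riemann_sum U s tag - (W (last 0 s) - W 0)) <= (last 0 s - 0) * (e / (t + 1)).
  apply: (@rsum_bound _ _ _ hrho U W _ s 0 tag ps hW) => i si; split; first by apply: hU; exact: tag0.
  have [/andP[h1 h2] h3] := htag i si.
  have /andP[h4 _] := bd i (ltnW si); have /andP[_ h5] := bd i.+1 si.
  by apply: hd => //; rewrite -ls.
have hRS : inH (riemann_sum U s tag).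
  by apply: inH_sum => i; apply: inHZ; apply: hU; exact: tag0.
rewrite ls subr0 in hb; rewrite -hnormE.
have hW0 := hW 0 (lexx 0); have hWt := hW t t0.
have k1 : inH (riemann_sum U s tag - (W t - W 0)) by apply: inHB => //; exact: inHB.
have E : riemann_sum U s tag - W t = (riemann_sum U s tag - (W t - W 0)) - W 0.
  by rewrite opprB (addrC (W 0)) addrA addrK.
have z : hnorm (- W 0) = 0.
  by rewrite hnormN// -(subr0 (W 0)) hnorm_Heq//; exact: inH0.
have k2 : inH (- W 0) by rewrite -sub0r; apply: inHB => //; exact: inH0.
have := hnorm_triangle hrho k1 k2; rewrite -E z addr0 => h; apply: (le_lt_trans (le_trans h hb)).
rewrite mulrA ltr_pdivrMr ?ltr_wpDl// mulrDr mulr1 mulrC.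
by rewrite ltrDl.
Qed.

Lemma riemann_sum_cat U (p1 p2 : seq R) (a : R) (tag : nat -> R) :
  \sum_(i < size (p1 ++ p2)) ((p1 ++ p2)`_i - (a :: p1 ++ p2)`_i)%:C *: U (tag i) =
  \sum_(i < size p1) (p1`_i - (a :: p1)`_i)%:C *: U (tag i) +
  \sum_(i < size p2) (p2`_i - (last a p1 :: p2)`_i)%:C *: U (tag (size p1 + i)%N).
Proof.
rewrite -(big_mkord xpredT (fun i => ((p1 ++ p2)`_i - (a :: p1 ++ p2)`_i)%:C *: U (tag i))).
rewrite size_cat (@big_cat_nat _ _ _ (size p1)) ?leq_addr//=; congr (_ + _).
  rewrite big_mkord; apply: eq_bigr => i _.
  by rewrite nth_cat ltn_ord -cat_cons nth_cat /= ltnS (ltnW (ltn_ord i)).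
rewrite -{1}(add0n (size p1)) big_addn addKn big_mkord; apply: eq_bigr => i _.
rewrite addnC nth_cat ltnNge leq_addr addKn -cat_cons lastI cat_rcons nth_cat.
by rewrite size_belast ltnNge leq_addr /= addKn.
Qed.

(** Additivity of the integral combined with the mean value estimate: [Wt - Ws] is approximated by
    Riemann sums over [[s, t]] alone, on which [U] stays close to [X]. *)
Lemma is_intH_increment U (s t e : R) Ws Wt X : (forall r : R, 0 <= r -> inH (U r)) ->
  is_intH rho U s Ws -> is_intH rho U t Wt -> 0 <= s -> s <= t -> inH X ->
  (forall r : R, s <= r -> r <= t -> hnorm (U r - X) <= e) ->
  hnorm (Wt - Ws - (t - s)%:C *: X) <= (t - s) * e.
Proof.
move=> hU [hWs Is] [hWt It] s0 st hX hUX; apply/ler_addgt0Pr => e' e'0.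
have e2 : 0 < e' / 2 by rewrite divr_gt0.
have [d1 d10 H1] := Is _ e2; have [d2 d20 H2] := It _ e2.
pose d := Num.min d1 d2.
have d0 : 0 < d by rewrite lt_min d10.
have [p1 [g1 l1]] := exists_partition d0 s0.
have [p2 [g2 l2]] := exists_partition d0 st.
(* One partition of [[0, t]] through [s], tagged at right ends. Its first part, with the same tags,
   also approximates the integral up to [s], and cancels in the difference. *)
pose p := p1 ++ p2; pose tag i := p`_i.
have gp : path (fun x y => (x < y) && (y - x < d)) 0 p by rewrite cat_path g1 l1.
have lt_of (q : seq R) a : path (fun x y => (x < y) && (y - x < d)) a q -> path <%R a q.
  by apply: sub_path => x y /andP[].
have gaps (q : seq R) a i : path (fun x y => (x < y) && (y - x < d)) a q -> (i < size q)%N ->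
    (a :: q)`_i < q`_i /\ q`_i - (a :: q)`_i < d.
  by move=> /(pathP 0)/(_ i) h /h/andP[].
have lp : last 0 p = t by rewrite last_cat l1.
have K2 : hnorm (riemann_sum U p tag - Wt) < e' / 2.
  rewrite hnormE; apply: H2; first by split; [exact: lt_of|rewrite lp].
  move=> i ip; have [h1 h2] := gaps p 0 i gp ip.
  by rewrite lexx (ltW h1) (lt_le_trans h2)// ge_min lexx orbT.
have K1 : hnorm (riemann_sum U p1 tag - Ws) < e' / 2.
  rewrite hnormE; apply: H1; first by split; [exact: lt_of|rewrite l1].
  move=> i ip; have [h1 h2] := gaps p1 0 i g1 ip.
  rewrite /tag /p nth_cat ip lexx (ltW h1) (lt_le_trans h2)// ge_min lexx//.
have bd := path_lt_bounds (lt_of _ _ gp).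
have tag0 i : (i < size p)%N -> 0 <= tag i by move=> ip; have /andP[] := bd i.+1 ip.
pose S2 := \sum_(i < size p2) (p2`_i - (s :: p2)`_i)%:C *: U (tag (size p1 + i)%N).
have Ecat : riemann_sum U p tag = riemann_sum U p1 tag + S2.
  by rewrite /riemann_sum /p riemann_sum_cat l1.
have hS2 : inH S2.
  by apply: inH_sum => i; apply: inHZ; apply: hU; apply: tag0; rewrite size_cat ltn_add2l.
have hS1 : inH (riemann_sum U p1 tag).
  by apply: inH_sum => i; apply: inHZ; apply: hU; apply: tag0; rewrite size_cat ltn_addr.
have K : hnorm (S2 - (t%:C *: X - s%:C *: X)) <= (t - s) * e.
  have := @rsum_bound _ _ _ hrho U (fun r => r%:C *: X) e p2 s (fun i => tag (size p1 + i)%N) (lt_of _ _ g2).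
  rewrite l2; apply; first by move=> r _; exact: inHZ.
  have bd2 := path_lt_bounds (lt_of _ _ g2).
  move=> i ip; have tE : tag (size p1 + i)%N = p2`_i.
    by rewrite /tag /p nth_cat ltnNge leq_addr addKn.
  have := bd2 i.+1 ip; rewrite /= l2 => /andP[h1 h2].
  have h0 : 0 <= p2`_i by exact: le_trans h1.
  split; first by rewrite tE; exact: hU.
  have [/ltW g3 _] := gaps p2 s i g2 ip.
  have hD : inH (U p2`_i - X) := inHB (hU _ h0) hX.
  rewrite tE -scalerBl -rmorphB -scalerBr (hnormZ hrho _ hD).
  by rewrite ger0_norm ?subr_ge0// ler_wpM2l ?subr_ge0// hUX.
have E : Wt - Ws - (t - s)%:C *: X =
   - (riemann_sum U p tag - Wt) + ((S2 - (t%:C *: X - s%:C *: X)) + (riemann_sum U p1 tag - Ws)).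
  rewrite Ecat rmorphB scalerBl; move: (_ - s%:C *: X) (riemann_sum _ _ _) S2 {Ecat hS2 K} => G P Q.
  have -> : Q - G + (P - Ws) = P + Q + (- G - Ws) by rewrite addrACA (addrC Q).
  by rewrite opprB [RHS]addrA subrK addrA addrAC.
have k0 : inH Wt by [].
have kp : inH (riemann_sum U p tag) by rewrite Ecat; exact: inHD.
have k1 : inH (- (riemann_sum U p tag - Wt)) by rewrite opprB; exact: inHB.
have k2 : inH (S2 - (t%:C *: X - s%:C *: X)).
  exact: (inHB hS2 (inHB (inHZ t hX) (inHZ s hX))).
have k3 : inH (riemann_sum U p1 tag - Ws) by exact: inHB.
have T1 := hnorm_triangle hrho k1 (inHD k2 k3); have T2 := hnorm_triangle hrho k2 k3.
rewrite -E hnormN in T1; [|exact: hrho|exact: inHB].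
by lra.
Qed.

End ClassicalSolutions.


(** * Time derivatives of real functions and of the energy product *)

Section ClassicalSolutions.
Import numFieldNormedType.Exports.
Local Open Scope classical_set_scope.
Local Open Scope complex_scope.
Context {R : realType} {N : nat} (rho : 'I_N -> R) (hrho : forall j, 0 < rho j).
Notation hnorm := (hnorm rho).
Notation hip := (hip rho).
Notation diffH := (diffH rho).
Implicit Types (X Y : state R N) (U V W Z : R -> state R N).

Definition diffR (f : R -> R) (t l : R) := forall e : R, 0 < e -> exists2 d : R, 0 < d &
  forall s : R, 0 <= s -> `|s - t| < d -> `|f s - f t - (s - t) * l| <= e * `|s - t|.

Lemma diffR_derivR (f : R -> R) (t l : R) : diffR f t l -> derivR f t l.
Proof.
move=> H; apply/cvgrPdist_le => e e0; apply/within_dnbhsP; have [d d0 hd] := H e e0.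
exists d => // s s0 st sd; have st0 : s - t != 0 by rewrite subr_eq0.
have -> : l - (s - t)^-1 * (f s - f t) = - (s - t)^-1 * (f s - f t - (s - t) * l) by field.
rewrite normrM normrN normfV mulrC ler_pdivrMr ?normr_gt0//.
exact: hd.
Qed.

(** Only at time 0 is the derivative one-sided. On []s, t[] two-sided quotients exist and the sign
    of the derivative applies; at the ends continuity is enough. *)
Lemma diffR_nonincreasing (f l : R -> R) : (forall t : R, 0 <= t -> diffR f t (l t) /\ l t <= 0) ->
  forall s t : R, 0 <= s -> s <= t -> f t <= f s.
Proof.
move=> H s t s0 st.
have quo x : 0 < x -> h^-1 *: (f (h + x) - f x) @[h --> 0^'] --> l x.
  move=> x0; apply/cvgrPdist_le => e e0; have [d d0 hd] := (H x (ltW x0)).1 e e0.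
  near=> h; have h0 : h != 0 by near: h; exact: nbhs_dnbhs_neq.
  have hd' : `|h| < d by near: h; exact: dnbhs0_lt.
  have hx : `|h| < x by near: h; exact: dnbhs0_lt.
  have hx0 : 0 <= h + x by move: hx; rewrite ltr_norml => /andP[h1 h2]; lra.
  have := hd (h + x) hx0; rewrite addrK => /(_ hd') k.
  have -> : l x - h^-1 *: (f (h + x) - f x) = - h^-1 * (f (h + x) - f x - h * l x).
    by rewrite /GRing.scale /=; field.
  by rewrite normrM normrN normfV mulrC ler_pdivrMr ?normr_gt0.
have der x : 0 < x -> derivable f x 1 /\ derive1 f x = l x.
  move=> x0; have q := quo x x0; split; last exact: cvg_lim.
  apply/cvg_ex; exists (l x).
  suff -> : (fun h : R => h^-1 *: ((f \o shift x) (h *: 1) - f x)) =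
    (fun h : R => h^-1 *: (f (h + x) - f x)) by [].
  by apply/funext => h; rewrite /= /GRing.scale /= mulr1.
apply: (@ler0_derive1_le_cc _ f s t) => //.
- by move=> x; rewrite in_itv /= => /andP[sx _]; case: (der x (le_lt_trans s0 sx)).
- move=> x; rewrite in_itv /= => /andP[sx _].
  by have [_ ->] := der x (le_lt_trans s0 sx); case: (H x (ltW (le_lt_trans s0 sx))).
- apply/subspace_continuousP => x; rewrite /= in_itv /= => /andP[sx xt].
  have x0 := le_trans s0 sx.
  apply/cvgrPdist_le => e e0; rewrite near_withinE.
  have [d d0 hd] := (H x x0).1 1 ltr01.
  have d1 : 0 < Num.min d (e / (1 + `|l x|)) by rewrite lt_min d0 divr_gt0// ltr_pwDl.
  exists (Num.min d (e / (1 + `|l x|))) => // y /=; rewrite distrC lt_min => /andP[yd ye].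
  rewrite in_itv /= => /andP[sy _].
  have := hd y (le_trans s0 sy) yd; rewrite mul1r => k.
  have ye' : `|y - x| * (1 + `|l x|) < e by rewrite -ltr_pdivlMr// ltr_pwDl.
  rewrite distrC.
  have -> : f y - f x = (f y - f x - (y - x) * l x) + (y - x) * l x by ring.
  by rewrite (le_trans (ler_normD _ _))// normrM; lra.
- by rewrite in_itv /= st lexx.
- by rewrite in_itv /= lexx st.
Unshelve. all: by end_near. Qed.

Lemma hnorm_eq X Y : inH X -> inH Y -> Heq X Y -> hnorm X = hnorm Y.
Proof.
move=> hX hY XY.
have E : hnorm X * hnorm X = hnorm Y * hnorm Y.
  by rewrite (hnormM hrho hX) (hnormM hrho hY) (hip_Heq rho hX hY hX XY) hipC (hip_Heq rho hX hY hY XY).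
by apply/eqP; rewrite eq_le; apply/andP; split; apply: ler_of_sqr; rewrite ?hnorm_ge0// E.
Qed.

Lemma hip_abs_le X Y : inH X -> inH Y -> `|hip X Y| <= hnorm X * hnorm Y.
Proof.
move=> hX hY; rewrite ler_norml hip_le_hnorm// andbT lerNl.
have hZ := inHZ (-1) hX.
have -> : - hip X Y = hip ((-1)%:C *: X) Y by rewrite (hipZl rho _ hX hY) mulN1r.
by have := hip_le_hnorm hrho hZ hY; rewrite hnormZ// normrN1 mul1r.
Qed.

Lemma hip_diffR Z (t : R) X : (forall s : R, 0 <= s -> inH (Z s)) -> 0 <= t -> inH X ->
  diffH Z t X -> diffR (fun s => hip (Z s) (Z s)) t (2 * hip X (Z t)).
Proof.
move=> hZ t0 hX D e e0.
pose a := hnorm (Z t); pose b := hnorm X.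
have a0 : 0 <= a by exact: hnorm_ge0.
have b0 : 0 <= b by exact: hnorm_ge0.
(* The error is [2 <rem, Z t> + <Q, Q>], and each term gets half of [e |s - t|]: the first by [e1],
   the second by [|s - t| < e / (2 c)]. The bound [e1 <= 1] gives [|Q| <= |s - t| (b + 1)]. *)
pose e1 := Num.min 1 (e / (4 * (a + 1))).
have e10 : 0 < e1 by rewrite lt_min ltr01/= divr_gt0// mulr_gt0// ltr_wpDl.
have e11 : e1 <= 1 by rewrite ge_min lexx.
have e1a : e1 * (4 * (a + 1)) <= e.
  by rewrite -ler_pdivlMr ?mulr_gt0 ?ltr_wpDl// ge_min lexx orbT.
have [d d0 hd] := D e1 e10.
pose c := (b + 1) * (b + 1).
have c0 : 0 < c by rewrite mulr_gt0// ltr_wpDl.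
exists (Num.min d (e / (2 * c))); first by rewrite lt_min d0 divr_gt0// mulr_gt0.
move=> s s0; rewrite lt_min => /andP[sd sc].
have sc' : `|s - t| * (2 * c) < e by rewrite -ltr_pdivlMr// mulr_gt0.
pose rem := Z s - Z t - (s - t)%:C *: X.
have hs := hZ s s0; have ht := hZ t t0.
have hh : inH ((s - t)%:C *: X) by exact: inHZ.
have hrem : inH rem by apply: inHB => //; exact: inHB.
have nrem : hnorm rem <= e1 * `|s - t| by exact: hd.
pose Q := Z s - Z t.
have hQ : inH Q by exact: inHB.
have QE : Q = (s - t)%:C *: X + rem by rewrite /rem addrC subrK.
have nQ : hnorm Q <= `|s - t| * (b + 1).
  rewrite QE (le_trans (hnorm_triangle hrho hh hrem))// hnormZ// mulrDr lerD2l mulr1.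
  by rewrite (le_trans nrem)// ler_piMl.
have ZE : Z s = Z t + Q by rewrite /Q addrC subrK.
have hTQ := inHD ht hQ.
have -> : hip (Z s) (Z s) - hip (Z t) (Z t) - (s - t) * (2 * hip X (Z t)) =
   2 * hip rem (Z t) + hip Q Q.
  rewrite ZE (hipDl rho ht hQ hTQ) (hipC _ _ (Z t + Q)) (hipC _ Q (Z t + Q)).
  rewrite (hipDl rho ht hQ ht) (hipDl rho ht hQ hQ) (hipC _ (Z t) Q).
  rewrite {1 2}QE (hipDl rho hh hrem ht) (hipZl rho _ hX ht); ring.
have k1 := hip_abs_le hrem ht; have k2 := hip_abs_le hQ hQ.
have h0 : 0 <= `|s - t| by [].
rewrite (le_trans (ler_normD _ _))// normrM (ger0_norm (x := 2))//.
have n0 := hnorm_ge0 rho rem; have q0 := hnorm_ge0 rho Q.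
have k3 : hnorm rem * a <= e1 * `|s - t| * a by rewrite ler_wpM2r.
have k4 : hnorm Q * hnorm Q <= (`|s - t| * (b + 1)) * (`|s - t| * (b + 1)).
  by rewrite ler_pM.
have k5 : `|s - t| * (`|s - t| * (2 * c)) <= `|s - t| * e by rewrite ler_wpM2l// ltW.
have k6 : `|s - t| * (e1 * (4 * (a + 1))) <= `|s - t| * e by rewrite ler_wpM2l.
have k7 : 0 <= `|s - t| * e1 by rewrite mulr_ge0// ltW.
rewrite -/a in k1.
have : 2 * `|hip rem (Z t)| + `|hip Q Q| <= 2 * (e1 * `|s - t| * a) + (`|s - t| * (b + 1)) * (`|s - t| * (b + 1)).
  by apply: lerD; [rewrite ler_wpM2l// (le_trans k1)|rewrite (le_trans k2)].
move/le_trans; apply; rewrite /c in k5.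
by move: k5 k6 k7; move: `|s - t| => h; lra.
Qed.

End ClassicalSolutions.


(** * Contraction property of classical solutions *)

Section MildSolutions.
Import numFieldNormedType.Exports.
Local Open Scope classical_set_scope.
Local Open Scope complex_scope.
Context {R : realType} {N : nat} (hN : (0 < N)%N) (rho : 'I_N -> R) (hrho : forall j, 0 < rho j).
Notation hnorm := (hnorm rho).
Notation hip := (hip rho).
Notation opA := (opA rho).
Notation inDA := (inDA rho).
Notation diffH := (diffH rho).
Implicit Types (X Y : state R N) (U V W Z : R -> state R N).

Definition pathH U := forall t : R, 0 <= t -> inH (U t).

Lemma diffH_lin U V (t a : R) X Y : pathH U -> pathH V -> 0 <= t -> inH X -> inH Y ->
  diffH U t X -> diffH V t Y ->
  diffH (fun s => a%:C *: U s + V s) t (a%:C *: X + Y).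
Proof.
move=> hU hV t0 hX hY dU dV e e0.
have e1 : 0 < e / (2 * (1 + `|a|)) by rewrite divr_gt0// mulr_gt0// ltr_pwDl.
have e2 : 0 < e / 2 by rewrite divr_gt0.
have [d1 d10 H1] := dU _ e1; have [d2 d20 H2] := dV _ e2.
exists (Num.min d1 d2); first by rewrite lt_min d10.
move=> s s0; rewrite lt_min => /andP[s1 s2].
have k1 := H1 s s0 s1; have k2 := H2 s s0 s2.
set A := U s - U t - _ in k1; set B := V s - V t - _ in k2.
have hA : inH A by apply: inHB; [apply: inHB; [exact: hU|exact: hU]|exact: inHZ].
have hB : inH B by apply: inHB; [apply: inHB; [exact: hV|exact: hV]|exact: inHZ].
have -> : a%:C *: U s + V s - (a%:C *: U t + V t) - (s - t)%:C *: (a%:C *: X + Y) = a%:C *: A + B.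
  rewrite /A /B !scalerBr scalerDr !scalerA (mulrC a%:C (s - t)%:C).
  by rewrite !opprD (addrACA (a%:C *: U s)) (addrACA (a%:C *: U s - _)).

have hZ := inHZ a hA.
rewrite (le_trans (hnorm_triangle hrho hZ hB))// hnormZ//.
have k3 : `|a| * hnorm A <= `|a| * (e / (2 * (1 + `|a|)) * `|s - t|) by rewrite ler_wpM2l.
have k4 : `|a| * (e / (2 * (1 + `|a|))) <= e / 2.
  rewrite mulrA ler_pdivrMr ?mulr_gt0 ?ltr_pwDl//.
  have -> : e / 2 * (2 * (1 + `|a|)) = e + `|a| * e by field.
  by rewrite lerDr ltW.
have k5 : `|a| * (e / (2 * (1 + `|a|)) * `|s - t|) <= e / 2 * `|s - t|.
  by rewrite mulrA ler_wpM2r.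
by move: k2 k3 k5; move: (hnorm A) (hnorm B) => na nb; lra.
Qed.

Lemma diffH_Heq U V (t : R) X Y : pathH U -> pathH V -> 0 <= t -> inH X -> inH Y ->
  (forall s : R, 0 <= s -> Heq (U s) (V s)) -> Heq X Y -> diffH U t X -> diffH V t Y.
Proof.
move=> hU hV t0 hX hY UV XY dU e e0; have [d d0 hd] := dU e e0; exists d => // s s0 sd.
rewrite (le_trans _ (hd s s0 sd))// le_eqVlt; apply/orP; left; apply/eqP.
have rep V' X' : pathH V' -> inH X' -> inH (V' s - V' t - (s - t)%:C *: X').
  by move=> hV' hX'; apply: inHB; [apply: inHB; exact: hV'|exact: inHZ].
apply: (hnorm_eq hrho); [exact: rep|exact: rep|].
apply: HeqB; first by apply: HeqB; apply: Heq_sym; exact: UV.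
rewrite -[_ *: Y]addr0 -[_ *: X]addr0; apply: Heq_lin; [exact: Heq_sym|exact: Heq_refl].
Qed.

Lemma diffH_shift U (h t : R) X : 0 <= h -> 0 <= t -> diffH U (t + h) X -> diffH (fun s => U (s + h)) t X.
Proof.
move=> h0 t0 dU e e0; have [d d0 hd] := dU e e0; exists d => // s s0 sd.
have E : s + h - (t + h) = s - t by ring.
have := hd (s + h) (addr_ge0 s0 h0); rewrite E => hh; exact: (hh sd).
Qed.

Definition classical Z := forall t : R, 0 <= t -> inDA (Z t) /\ diffH Z t (opA (Z t)).

Lemma classical_pathH Z : classical Z -> pathH Z.
Proof. by move=> cZ t t0; have [dZ _] := cZ t t0; exact: (inDA_inH dZ). Qed.

Lemma classical_diffR Z (t : R) : classical Z -> 0 <= t ->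
  diffR (fun s => hip (Z s) (Z s)) t (- 2 * Normc.normc (trace 0 ((Z t).2 (Ordinal hN)) 0) ^+ 2).
Proof.
move=> cZ t0; have [dZ dd] := cZ t t0.
rewrite mulNr -mulrN -(dissipation hrho hN dZ).
by apply: (hip_diffR hrho (classical_pathH cZ) t0 (opA_inH dZ) dd).
Qed.

Lemma classical_nonincreasing Z (s t : R) : classical Z -> 0 <= s -> s <= t ->
  hip (Z t) (Z t) <= hip (Z s) (Z s).
Proof.
move=> cZ; apply: (@diffR_nonincreasing _ (fun r => hip (Z r) (Z r))
  (fun r => - 2 * Normc.normc (trace 0 ((Z r).2 (Ordinal hN)) 0) ^+ 2)) => r r0.
split; first exact: classical_diffR.
by rewrite mulNr oppr_le0 mulr_ge0// sqr_ge0.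
Qed.

Lemma classical_contraction Z (t : R) : classical Z -> 0 <= t -> hnorm (Z t) <= hnorm (Z 0).
Proof.
move=> cZ t0; have hZ := classical_pathH cZ; apply: ler_of_sqr; first exact: hnorm_ge0.
by rewrite !(hnormM hrho)//; [exact: classical_nonincreasing|exact: hZ|exact: hZ].
Qed.

Lemma classicalB Z1 Z2 : classical Z1 -> classical Z2 -> classical (fun t => Z1 t - Z2 t).
Proof.
move=> c1 c2 t t0; have [d1 D1] := c1 t t0; have [d2 D2] := c2 t t0.
have [dB AB] := inDAB d1 d2; split; first exact: dB.
have h1 := classical_pathH c1; have h2 := classical_pathH c2.
have D := diffH_lin (-1) h2 h1 t0 (opA_inH d2) (opA_inH d1) D2 D1.
apply: (diffH_Heq _ _ t0 _ _ _ _ D).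
- by move=> s s0; apply: inH_lin; [exact: h2|exact: h1].
- by move=> s s0; apply: inHB; [exact: h1|exact: h2].
- by apply: inH_lin; exact: opA_inH.
- exact: opA_inH.
- by move=> s s0; rewrite Hdiv_lin; exact: Heq_refl.
- by rewrite -Hdiv_lin; exact: Heq_sym.
Qed.

End MildSolutions.


(** * Uniqueness of mild solutions *)

Section MildTheory.
Import numFieldNormedType.Exports.
Local Open Scope classical_set_scope.
Local Open Scope complex_scope.
Context {R : realType} {N : nat} (hN : (0 < N)%N) (rho : 'I_N -> R) (hrho : forall j, 0 < rho j).
Notation opA := (opA rho).
Notation inDA := (inDA rho).
Notation diffH := (diffH rho).
Notation classical := (classical rho).
Implicit Types (X Y : state R N) (U V W Z : R -> state R N).

Lemma is_intH_0 U X : is_intH rho U 0 X -> Heq X 0.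
Proof.
move=> [hX H]; apply: (hnorm0_Heq hrho hX); apply/eqP; rewrite eq_le hnorm_ge0 andbT.
apply/ler_addgt0Pr => e e0; rewrite add0r; have [d d0 hd] := H e e0.
have := hd [::] (fun=> 0); rewrite /riemann_sum big_ord0 sub0r -hnormE hnormN// => h.
by apply/ltW/h.
Qed.

Lemma mild_choice X0 U : mild_solution rho X0 U -> exists W : R -> state R N,
  forall t : R, 0 <= t -> [/\ is_intH rho U t (W t), inDA (W t) & Heq (U t) (X0 + opA (W t))].
Proof.
move=> [_ _ H].
have H' (t : R) : exists Y, 0 <= t -> [/\ is_intH rho U t Y, inDA Y & Heq (U t) (X0 + opA Y)].
  have [t0|t0] := boolP (0 <= t); last by exists 0 => t1; case/negP: t0.
  by have [Y h] := H t t0; exists Y.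
by exists (fun t => projT1 (cid (H' t))) => t t0; exact: (projT2 (cid (H' t))).
Qed.

(** Near [t] the integrand stays within [e] of [U t], so [is_intH_increment] bounds the increments
    of [W]. That estimate is oriented, hence the two cases. *)
Lemma integral_diffH U W : contH rho U -> (forall t : R, 0 <= t -> is_intH rho U t (W t)) ->
  forall t : R, 0 <= t -> diffH W t (U t).
Proof.
move=> /contHP cU IW t t0 e e0.
have hU : pathH U by move=> r r0; case: (cU r r0).
have hW : pathH W by move=> r r0; case: (IW r r0).
have [d d0 hd] := (cU t t0).2 e e0; exists d => // s s0 sd.
have [st|ts] := leP t s.
  rewrite ger0_norm ?subr_ge0// mulrC.
  apply: (is_intH_increment hrho hU (IW t t0) (IW s s0) t0 st (hU t t0)) => r tr rs.
  apply/ltW/hd; first exact: le_trans tr.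
  rewrite ger0_norm ?subr_ge0//.
  by move: sd; rewrite ger0_norm ?subr_ge0//; lra.
have hA : inH (W t - W s - (t - s)%:C *: U t).
  by apply: inHB; [apply: inHB; exact: hW|apply: inHZ; exact: hU].
have -> : W s - W t - (s - t)%:C *: U t = - (W t - W s - (t - s)%:C *: U t).
  have -> : (t - s)%:C = - (s - t)%:C :> R[i] by rewrite -rmorphN opprB.
  by rewrite scaleNr opprK opprD opprB.
rewrite (hnormN hrho hA) ltr0_norm ?subr_lt0// opprB mulrC.
apply: (is_intH_increment hrho hU (IW s s0) (IW t t0) s0 (ltW ts) (hU t t0)) => r sr rt.
apply/ltW/hd; first exact: le_trans sr.
rewrite distrC ger0_norm ?subr_ge0//.
by move: sd; rewrite ltr0_norm ?subr_lt0//; lra.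
Qed.

Lemma opA0 X : inDA X -> Heq X 0 -> Heq (opA X) 0.
Proof.
move=> dX X0; have [_ h1] := inDA_Heq dX inH0 X0.
(* Even for the zero state [wd] is a choice; linearity applied to [X - X] shows that its image
   vanishes almost everywhere. *)
apply: (Heq_trans h1); have [_ h2] := inDAB dX dX.
by rewrite !subrr in h2.
Qed.

Lemma mild_unique X0 U1 U2 : mild_solution rho X0 U1 -> mild_solution rho X0 U2 ->
  forall t : R, 0 <= t -> Heq (U1 t) (U2 t).
Proof.
move=> m1 m2; have [W1 h1] := mild_choice m1; have [W2 h2] := mild_choice m2.
have [c1 _ _] := m1; have [c2 _ _] := m2.
have D1 := integral_diffH c1 (fun t t0 => let: And3 h _ _ := h1 t t0 in h).
have D2 := integral_diffH c2 (fun t t0 => let: And3 h _ _ := h2 t t0 in h).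
have dW1 (t : R) : 0 <= t -> inDA (W1 t) by move=> t0; case: (h1 t t0).
have dW2 (t : R) : 0 <= t -> inDA (W2 t) by move=> t0; case: (h2 t t0).
have hU1 : pathH U1 by move=> r r0; case: (c1 r r0).
have hU2 : pathH U2 by move=> r r0; case: (c2 r r0).
have hW1 : pathH W1 by move=> r r0; exact: (inDA_inH (dW1 r r0)).
have hW2 : pathH W2 by move=> r r0; exact: (inDA_inH (dW2 r r0)).
pose Z t := W1 t - W2 t.
have hZ : pathH Z by move=> r r0; apply: inHB; [exact: hW1|exact: hW2].
have dZ (t : R) : 0 <= t -> inDA (Z t).
  by move=> t0; have [] := inDAB (dW1 t t0) (dW2 t t0).
(* The common datum cancels between the two integrated equations, so the derivative [U1 - U2] of [Z]
   is the generator applied to [Z]. *)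
have EA (t : R) : 0 <= t -> Heq (U1 t - U2 t) (opA (Z t)).
  move=> t0; have [_ AZ] := inDAB (dW1 t t0) (dW2 t t0).
  apply: Heq_trans (Heq_sym AZ).
  have [_ _ e1] := h1 t t0; have [_ _ e2] := h2 t t0.
  apply: (Heq_trans (HeqB e1 e2)).
  have -> : X0 + opA (W1 t) - (X0 + opA (W2 t)) = opA (W1 t) - opA (W2 t).
    by rewrite opprD addrACA subrr add0r.
  exact: Heq_refl.
have cZ : classical Z.
  move=> t t0; split; first exact: dZ.
  have D := diffH_lin hrho (-1) hW2 hW1 t0 (hU2 t t0) (hU1 t t0) (D2 t t0) (D1 t t0).
  apply: (diffH_Heq hrho _ hZ t0 _ (opA_inH (dZ t t0)) _ _ D).
  - by move=> s s0; apply: inH_lin; [exact: hW2|exact: hW1].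
  - by apply: inH_lin; [exact: hU2|exact: hU1].
  - by move=> s s0; rewrite /Z Hdiv_lin; exact: Heq_refl.
  - by rewrite -Hdiv_lin; exact: EA.
move=> t t0; have ZT : Heq (Z t) 0.
  apply: (hnorm0_Heq hrho (hZ t t0)); apply/eqP; rewrite eq_le hnorm_ge0 andbT.
  apply: (le_trans (classical_contraction hN hrho cZ t0)).
  have e1 : Heq (W1 0) 0 by apply: (@is_intH_0 U1); case: (h1 0 (lexx 0)).
  have e2 : Heq (W2 0) 0 by apply: (@is_intH_0 U2); case: (h2 0 (lexx 0)).
  rewrite /Z (hnorm_Heq hrho (hW1 0 (lexx 0)) (hW2 0 (lexx 0)))//.
  exact: Heq_trans e1 (Heq_sym e2).
apply: HeqB0; apply: (Heq_trans (EA t t0)).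
exact: (opA0 (dZ t t0) ZT).
Qed.

End MildTheory.


(** * Regularity for data in the domain of the generator *)

Section Regularity.
Import numFieldNormedType.Exports.
Local Open Scope classical_set_scope.
Local Open Scope complex_scope.
Context {R : realType} {N : nat} (hN : (0 < N)%N) (rho : 'I_N -> R) (hrho : forall j, 0 < rho j).
Notation hnorm := (hnorm rho).
Notation opA := (opA rho).
Notation inDA := (inDA rho).
Notation diffH := (diffH rho).
Notation classical := (classical rho).
Implicit Types (X Y : state R N) (U V W Z : R -> state R N).

Lemma opA_increment X0 X Y A B : inDA A -> inDA B -> Heq X (X0 + opA A) -> Heq Y (X0 + opA B) ->
  Heq (X - Y) (opA (A - B)).
Proof.
move=> dA dB e1 e2; have [_ AB] := inDAB dA dB.
apply: Heq_trans (Heq_sym AB); apply: (Heq_trans (HeqB e1 e2)).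
have -> : X0 + opA A - (X0 + opA B) = opA A - opA B by rewrite opprD addrACA subrr add0r.
exact: Heq_refl.
Qed.

Lemma inDAZ (a : R) X : inDA X -> inDA (a%:C *: X) /\ Heq (opA (a%:C *: X)) (a%:C *: opA X).
Proof.
move=> dX; have [d0 a0] := inDAB dX dX; rewrite subrr in d0.
have [dZ aZ] := inDA_lin a dX d0; rewrite addr0 in dZ aZ; split; first exact: dZ.
apply: (Heq_trans aZ); rewrite -[X in Heq _ X]addr0.
apply: Heq_lin; first exact: Heq_refl.
by apply: opA0 => //; exact: Heq_refl.
Qed.

Section OneSolution.
Variables (X0 : state R N) (U V : R -> state R N).
Hypotheses (dX0 : inDA X0) (mU : mild_solution rho X0 U) (mV : mild_solution rho (opA X0) V).

Let hU : pathH U. Proof. by move=> r r0; have [c _ _] := mU; case: (c r r0). Qed.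
Let hV : pathH V. Proof. by move=> r r0; have [c _ _] := mV; case: (c r r0). Qed.

Lemma integrated_classical : exists Z : R -> state R N, [/\ classical Z, Heq (Z 0) X0 &
  forall t : R, 0 <= t -> diffH Z t (V t) /\ Heq (opA (Z t)) (V t)].
Proof.
have [Y hY] := mild_choice mV; have [cV _ _] := mV.
have DY := integral_diffH hrho cV (fun t t0 => let: And3 h _ _ := hY t t0 in h).
have dY (t : R) : 0 <= t -> inDA (Y t) by move=> t0; case: (hY t t0).
have hYp : pathH Y by move=> r r0; exact: (inDA_inH (dY r r0)).
have hX0 := inDA_inH dX0.
exists (fun t => X0 + Y t).
have hZ : pathH (fun t => X0 + Y t) by move=> r r0; apply: inHD; [exact: hX0|exact: hYp].
have D (t : R) : 0 <= t -> diffH (fun t => X0 + Y t) t (V t).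
  move=> t0 e e0; have [d d0 hd] := DY t t0 e e0; exists d => // s s0 sd.
  have -> : X0 + Y s - (X0 + Y t) = Y s - Y t by rewrite opprD addrACA subrr add0r.
  exact: (hd s s0 sd).
have A (t : R) : 0 <= t -> Heq (opA (X0 + Y t)) (V t).
  move=> t0; have [_ e] := inDAD dX0 (dY t t0); apply: (Heq_trans e).
  by apply: Heq_sym; case: (hY t t0).
split.
- move=> t t0; have [dZ _] := inDAD dX0 (dY t t0); split; first exact: dZ.
  apply: (diffH_Heq hrho hZ hZ t0 (hV t0) (opA_inH dZ) _ (Heq_sym (A t t0)) (D t t0)).
  by move=> s s0; exact: Heq_refl.
- rewrite -[X in Heq _ X]addr0; apply: HeqD; first exact: Heq_refl.
  by apply: (@is_intH_0 _ _ _ hrho V); case: (hY 0 (lexx 0)).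
- by move=> t t0; split; [exact: D|exact: A].
Qed.

Lemma mild_eq_classical Z : classical Z -> Heq (Z 0) X0 -> forall t : R, 0 <= t -> Heq (U t) (Z t).
Proof.
move=> cZ Z0 t t0; have hZ := classical_pathH cZ.
have [W hW] := mild_choice mU; have [cU U0 _] := mU.
have DW := integral_diffH hrho cU (fun t t0 => let: And3 h _ _ := hW t t0 in h).
have dW (r : R) : 0 <= r -> inDA (W r) by move=> r0; case: (hW r r0).
have hWp : pathH W by move=> r r0; exact: (inDA_inH (dW r r0)).
have EU (r : R) : 0 <= r -> Heq (U r) (X0 + opA (W r)) by move=> r0; case: (hW r r0).
apply: (Heq_hnorm hrho (hU t0) (hZ t t0)); apply/eqP; rewrite eq_le hnorm_ge0 andbT.
apply/ler_addgt0Pr => e e0; rewrite add0r.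
have e2 : 0 < e / 2 by rewrite divr_gt0.
have [d1 d10 H1] := DW t t0 _ e2; have [d2 d20 H2] := DW 0 (lexx 0) _ e2.
(* One increment below both thresholds makes the quotient [e / 2]-close to [U] at the two times that
   matter, 0 and [t]. *)
pose h := Num.min d1 d2 / 2.
have m0 : 0 < Num.min d1 d2 by rewrite lt_min d10.
have h0 : 0 < h by rewrite divr_gt0.
have hm : h < Num.min d1 d2 by rewrite /h ltr_pdivrMr// ltr_pMr// ltr1n.
have hd1 : h < d1 by rewrite (lt_le_trans hm)// ge_min lexx.
have hd2 : h < d2 by rewrite (lt_le_trans hm)// ge_min lexx orbT.
(* [Q 0] is close to [U 0], which agrees with [Z 0]. Contraction of [Q - Z] transfers this to time
   [t], where [Q t] is close to [U t]. *)
pose Q s := (h^-1)%:C *: (W (s + h) - W s).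
have sh (s : R) : 0 <= s -> 0 <= s + h by move=> s0; rewrite addr_ge0// ltW.
have dQ (s : R) : 0 <= s -> inDA (Q s) /\ Heq (opA (Q s)) ((h^-1)%:C *: (U (s + h) - U s)).
  move=> s0; have [dB _] := inDAB (dW _ (sh s s0)) (dW _ s0).
  have [dq aq] := inDAZ (h^-1) dB; split; first exact: dq.
  apply: (Heq_trans aq); rewrite -[X in Heq X]addr0 -[X in Heq _ X]addr0.
  apply: Heq_lin; last exact: Heq_refl.
  apply: Heq_sym; exact: (opA_increment (dW _ (sh s s0)) (dW _ s0) (EU _ (sh s s0)) (EU _ s0)).
have hQ : pathH Q by move=> s s0; have [q _] := dQ s s0; exact: (inDA_inH q).
have hWs : pathH (fun s => W (s + h)) by move=> s s0; apply: hWp; exact: sh.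
have hUs : pathH (fun s => U (s + h)) by move=> s s0; apply: hU; exact: sh.
have cQ : classical Q.
  move=> s s0; have [q aq] := dQ s s0; split; first exact: q.
  have Dsh := diffH_shift (ltW h0) s0 (DW (s + h) (sh s s0)).
  have D1 := diffH_lin hrho (-1) hWp hWs s0 (hU s0) (hUs s s0) (DW s s0) Dsh.
  have hD1 : pathH (fun r => (-1)%:C *: W r + W (r + h)).
    by move=> r r0; apply: inH_lin; [exact: hWp|exact: hWs].
  have hX1 : inH ((-1)%:C *: U s + U (s + h)) by apply: inH_lin; [exact: hU|exact: hUs].
  have p0 : pathH (fun=> 0 : state R N) by move=> r r0; exact: inH0.
  have D0 : diffH (fun=> 0 : state R N) s 0.
    move=> e' e'0; exists 1 => // r r0 _; rewrite scaler0 !subrr.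
    by rewrite -(subrr (0 : state R N)) (hnorm_Heq hrho inH0 inH0 (@Heq_refl _ _ 0)) mulr_ge0// ltW.
  have D2 := diffH_lin hrho (h^-1) hD1 p0 s0 hX1 inH0 D1 D0.
  apply: (diffH_Heq hrho _ hQ s0 _ (opA_inH q) _ _ D2).
  - by move=> r r0; apply: inH_lin; [exact: hD1|exact: inH0].
  - by apply: inH_lin; [exact: hX1|exact: inH0].
  - by move=> r r0; rewrite /Q addr0 -Hdiv_lin; exact: Heq_refl.
  - by rewrite addr0 -Hdiv_lin; exact: Heq_sym.
have near (s d : R) : 0 <= s -> (forall r : R, 0 <= r -> `|r - s| < d ->
    hnorm (W r - W s - (r - s)%:C *: U s) <= e / 2 * `|r - s|) -> h < d -> hnorm (Q s - U s) <= e / 2.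
  move=> s0 H hd; have := H (s + h) (sh s s0); rewrite addrAC subrr add0r gtr0_norm// => /(_ hd) k.
  have hT : inH (W (s + h) - W s - h%:C *: U s).
    by apply: inHB; [apply: inHB; [exact: hWs|exact: hWp]|apply: inHZ; exact: hU].
  have -> : Q s - U s = (h^-1)%:C *: (W (s + h) - W s - h%:C *: U s).
    by rewrite scalerBr scalerA -rmorphM mulVf ?gt_eqF// rmorph1 scale1r.
  by rewrite hnormZ// gtr0_norm ?invr_gt0// mulrC ler_pdivrMr.
have n1 := near t d1 t0 H1 hd1; have n2 := near 0 d2 (lexx 0) H2 hd2.
have k := classical_contraction hN hrho (classicalB hrho cQ cZ) t0.
have hQt := hQ t t0; have hUt := hU t0; have hZt := hZ t t0.
have hQ0 := hQ 0 (lexx 0); have hU0 := hU (lexx 0); have hZ0 := hZ 0 (lexx 0).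
have z : hnorm (U 0 - Z 0) = 0.
  by apply: (hnorm_Heq hrho hU0 hZ0); exact: Heq_trans U0 (Heq_sym Z0).
have tri A B C : inH A -> inH B -> inH C -> hnorm (A - C) <= hnorm (A - B) + hnorm (B - C).
  move=> hA hB hC; have := hnorm_triangle hrho (inHB hA hB) (inHB hB hC).
  by rewrite addrA subrK.
have t1 := tri _ _ _ hUt hQt hZt; have t2 := tri _ _ _ hQ0 hU0 hZ0.
have sym : hnorm (U t - Q t) = hnorm (Q t - U t).
  by rewrite -(hnormN hrho (inHB hQt hUt)) opprB.
rewrite z in t2; rewrite sym in t1.
by have := splitr e; lra.
Qed.

Lemma mild_classical : classical U /\ forall t : R, 0 <= t -> Heq (opA (U t)) (V t) /\ diffH U t (V t).
Proof.
have [Z [cZ Z0 hZV]] := integrated_classical.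
have UZ := mild_eq_classical cZ Z0; have hZ := classical_pathH cZ.
have dU (t : R) : 0 <= t -> inDA (U t) /\ Heq (opA (Z t)) (opA (U t)).
  by move=> t0; have [dZ _] := cZ t t0; exact: (inDA_Heq dZ (hU t0) (Heq_sym (UZ t t0))).
have UZs : forall s : R, 0 <= s -> Heq (Z s) (U s) by move=> s s0; apply: Heq_sym; exact: UZ.
split => t t0.
  have [d A] := dU t t0; have [dZ D] := cZ t t0; split; first exact: d.
  exact: (diffH_Heq hrho hZ hU t0 (opA_inH dZ) (opA_inH d) UZs A D).
have [D A] := hZV t t0; have [d A'] := dU t t0; split; first exact: (Heq_trans (Heq_sym A') A).
exact: (diffH_Heq hrho hZ hU t0 (hV t0) (hV t0) UZs (Heq_refl _) D).
Qed.

Lemma mild_regular : [/\ contDA rho U, C1H rho U &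
  forall t : R, 0 <= t -> derivH rho U t (opA (U t))].
Proof.
have [cU AV] := mild_classical; have [coU _ _] := mU; have [coV _ _] := mV.
split.
- move=> t t0; have [dU _] := cU t t0; split; first exact: dU.
  apply/cvgrPdist_lt => e e0; apply/within_nbhsP.
  have e2 : 0 < e / 2 by rewrite divr_gt0.
  have [d1 d10 H1] := ((contHP rho U).1 coU t t0).2 _ e2.
  have [d2 d20 H2] := ((contHP rho V).1 coV t t0).2 _ e2.
  exists (Num.min d1 d2); first by rewrite lt_min d10.
  move=> s s0; rewrite lt_min => /andP[s1 s2].
  have k1 := H1 s s0 s1; have k2 := H2 s s0 s2.
  have [dUs _] := cU s s0; have [dB AB] := inDAB dUs dU.
  (* The second half of the graph norm is thus an increment of [V], continuous in H as a mild
     solution. *)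
  have E : Heq (opA (U s - U t)) (V s - V t).
    by apply: (Heq_trans AB); apply: HeqB; [case: (AV s s0)|case: (AV t t0)].
  rewrite /graph_norm sub0r normrN -!hnormE.
  rewrite (hnorm_eq hrho (opA_inH dB) (inHB (hV s0) (hV t0)) E).
  rewrite ger0_norm ?addr_ge0 ?hnorm_ge0//.
  by have := splitr e; lra.
- split; first exact: coU.
  exists V; first exact: coV.
  by move=> t t0; apply/derivHP => //; split; [exact: hV|case: (AV t t0)].
- move=> t t0; have [dU D] := cU t t0; apply/derivHP => //.
  by split; [exact: opA_inH|exact: D].
Qed.

End OneSolution.

End Regularity.

(** * Translations in the space of square integrable functions *)


Section ChangeOfVariables.
Import numFieldNormedType.Exports.
Local Open Scope classical_set_scope.
Context {R : realType}.
Notation mu := (@lebesgue_measure R).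
Implicit Types (f g : R -> R) (a b : R).

Lemma measurable_affine a b : measurable_fun setT (fun x : R => a * x + b).
Proof. by apply: measurable_funD => //; apply: measurable_funM. Qed.

(** The right-hand side is a measure in [A], a scaled image of Lebesgue measure; by uniqueness it
    suffices to compare the two on intervals []c, d]]. *)
Lemma lebesgue_measure_affine a b (A : set (measurableTypeR R)) : a != 0 -> measurable A ->
  mu A = (`|a|%:E * mu ((fun x => (a * x + b)%R) @^-1` A))%E.
Proof.
move=> a0 mA.
pose phi : measurableTypeR R -> measurableTypeR R := fun x => a * x + b.
have mphi : measurable_fun setT phi by exact: measurable_affine.
have a0' : 0 <= `|a| by [].
pose nu : {measure set (measurableTypeR R) -> \bar R} := mscale (NngNum a0') (pushforward mu phi).
have H := @lebesgue_measure_unique R (nu mphi).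
rewrite (H _ A mA)// => _ [[c d] _ <-].
have [dc|cd] := leP d c.
  by rewrite set_itv_ge ?measure0// bnd_simp -leNgt.
rewrite lebesgue_measure_itv /= lte_fin cd /nu /= /mscale /pushforward /phi.
have [ap|an] := ltP 0 a.
  rewrite [X in (_ * mu X)%E](_ : _ = `](c - b) / a, (d - b) / a]%classic); last first.
    apply/seteqP; split => x /=; rewrite !in_itv /= ltr_pdivrMr// ler_pdivlMr// (mulrC x);
      by rewrite ltrBlDr lerBrDr.
  rewrite lebesgue_measure_itv /= lte_fin ltr_pM2r ?invr_gt0// ltrD2r cd gtr0_norm//.
  by rewrite -!EFinD -EFinM; congr EFin; field; rewrite gt_eqF.
have {}an : a < 0 by rewrite lt_neqAle a0.
(* A negative slope exchanges the closed and the open end. *)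
rewrite [X in (_ * mu X)%E](_ : _ = `[(d - b) / a, (c - b) / a[%classic); last first.
  apply/seteqP; split => x /=; rewrite !in_itv /= ltr_ndivlMr// ler_ndivrMr// (mulrC x);
    by rewrite ltrBlDr lerBrDr andbC.
rewrite lebesgue_measure_itv /= lte_fin ltr_nM2r ?invr_lt0// ltrD2r cd ltr0_norm//.
by rewrite -!EFinD -EFinM; congr EFin; field; rewrite lt_eqF.
Qed.

Lemma ge0_integral_affine a b (f : R -> \bar R) : a != 0 -> measurable_fun setT f ->
  (forall x, 0 <= f x)%E ->
  (\int[mu]_x f x = `|a|%:E * \int[mu]_x f (a * x + b)%R)%E.
Proof.
move=> a0 mf f0.
pose phi : measurableTypeR R -> measurableTypeR R := fun x => a * x + b.
have mphi : measurable_fun setT phi by exact: measurable_affine.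
have a0' : 0 <= `|a| by [].
pose nu : {measure set (measurableTypeR R) -> \bar R} := mscale (NngNum a0') (pushforward mu phi).
rewrite (eq_measure_integral (nu mphi)); last first.
  by move=> A mA _; have X := lebesgue_measure_affine b a0 mA; exact: X.
rewrite ge0_integral_mscale//; congr (_ * _)%E.
by rewrite ge0_integral_pushforward.
Qed.

Lemma integrable_affine a b (F : R -> R) : a != 0 -> mu.-integrable setT (EFin \o F) ->
  mu.-integrable setT (EFin \o (fun x => F (a * x + b))).
Proof.
move=> a0 /integrableP[mF iF]; apply/integrableP; split.
  exact: (measurableT_comp mF (measurable_affine a b)).
move: iF; rewrite (ge0_integral_affine b a0) //; last exact: measurableT_comp.
move=> h; rewrite ltNge; apply/negP; rewrite leye_eq => /eqP h2; move: h.
by rewrite /= h2 gt0_muley ?ltxx// lte_fin normr_gt0.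
Qed.

Lemma Rintegral_affine a b (F : R -> R) : a != 0 -> mu.-integrable setT (EFin \o F) ->
  \int[mu]_x F x = `|a| * \int[mu]_x F (a * x + b).
Proof.
move=> a0 iF; have iFa := integrable_affine b a0 iF.
have mF := measurable_int mu iF.
have fp := integrable_fin_num measurableT (integrable_funepos measurableT iFa).
have fn := integrable_fin_num measurableT (integrable_funeneg measurableT iFa).
pose G x := F (a * x + b).
have e1 : (\int[mu]_x (EFin \o F) x = `|a|%:E * \int[mu]_x (EFin \o G)^\+ x -
    `|a|%:E * \int[mu]_x (EFin \o G)^\- x)%E.
  rewrite integralE; congr (_ - _)%E.
  - rewrite (ge0_integral_affine b a0 (measurable_funepos mF))//.
    by congr (_ * _)%E; apply: eq_integral => x _; rewrite funepos.unlock.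
  - rewrite (ge0_integral_affine b a0 (measurable_funeneg mF))//.
    by congr (_ * _)%E; apply: eq_integral => x _; rewrite funeneg.unlock.
have e2 : (\int[mu]_x (EFin \o G) x = \int[mu]_x (EFin \o G)^\+ x - \int[mu]_x (EFin \o G)^\- x)%E.
  by rewrite integralE.
rewrite /Rintegral [X in fine X = _]e1 [X in _ = _ * fine X]e2.
rewrite -(fineK fp) -(fineK fn) -!EFinM -!EFinB /=.
by rewrite mulrBr.
Qed.

Lemma sqint_affine a b (f : R -> R) : a != 0 -> sqint setT f ->
  sqint setT (fun x => f (a * x + b)).
Proof.
move=> a0 [mf f2]; split; first exact: (measurableT_comp mf (measurable_affine a b)).
exact: (integrable_affine b a0 (F := fun x => f x ^+ 2)).
Qed.

End ChangeOfVariables.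

(** * Mean square bounds for averages in a parameter *)

Section Averages.
Import numFieldNormedType.Exports.
Local Open Scope classical_set_scope.
Context {R : realType}.
Notation mu := (@lebesgue_measure R).

Lemma itv_lty (p q : R) : (mu `[p, q]%classic < +oo)%E.
Proof. by rewrite lebesgue_measure_itv; case: ifP => _; rewrite ?ltry// -EFinD ltry. Qed.

(** Nonnegativity of the variance: the square of [g - m] has nonnegative integral, [m] being the
    mean of [g]. *)
Lemma Rintegral_CauchySchwarz (p q : R) (g : R -> R) : p <= q -> sqint `[p, q] g ->
  (\int[mu]_(s in `[p, q]) g s) ^+ 2 <= (q - p) * \int[mu]_(s in `[p, q]) (g s ^+ 2).
Proof.
rewrite le_eqVlt => /predU1P[<-|pq] sg.
  by rewrite set_itv1 !Rintegral_set1 expr0n mulr0.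
have mI : measurable (`[p, q]%classic : set (measurableTypeR R)) by exact: measurable_itv.
have Ig := sqint_integrable mI (itv_lty p q) sg; have [_ I2] := sg.
pose m := (\int[mu]_(s in `[p, q]) g s) / (q - p).
have qp : q - p != 0 by rewrite subr_eq0 gt_eqF.
have H : 0 <= \int[mu]_(s in `[p, q]) (g s ^+ 2 - (2 * m) * g s + m ^+ 2).
  apply: Rintegral_ge0 => s _.
  have -> : g s ^+ 2 - 2 * m * g s + m ^+ 2 = (g s - m) ^+ 2 by ring.
  exact: sqr_ge0.
have Ic : mu.-integrable `[p, q] (EFin \o (fun=> m ^+ 2)).
  exact: (sqint_integrable mI (itv_lty p q) (sqint_cst _ mI (itv_lty p q))).
have Im := integrableZl mI (2 * m) Ig.
have Ec : \int[mu]_(s in `[p, q]) (m ^+ 2) = m ^+ 2 * (q - p).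
  by rewrite Rintegral_cst//= lebesgue_measure_itv /= lte_fin pq.
rewrite (RintegralD mI (integrableB mI I2 Im) Ic) (RintegralB mI I2 Im) in H.
rewrite (RintegralZl _ mI Ig) Ec in H.
have qp0 : 0 < q - p by rewrite subr_gt0.
have E : \int[mu]_(s in `[p, q]) g s = m * (q - p) by rewrite /m divfK.
rewrite E in H *.
have : 0 <= (q - p) * (\int[mu]_(s in `[p, q]) (g s ^+ 2) - 2 * m * (m * (q - p)) + m ^+ 2 * (q - p)).
  by rewrite mulr_ge0// ltW.
by move: (Rintegral _ _ _) => I; lra.
Qed.

(* Cauchy-Schwarz in the averaged variable, then Tonelli. *)
Lemma average_bound (D : set R) (E : R -> R) (k : R -> R -> R) (p q K : R) :
  measurable (D : set (measurableTypeR R)) -> p <= q -> 0 <= K ->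
  measurable_fun D E -> measurable_fun setT (fun z : R * R => k z.1 z.2) ->
  (forall y, D y -> sqint `[p, q] (k ^~ y) /\ E y = \int[mu]_(s in `[p, q]) k s y) ->
  (forall s, p <= s <= q -> (\int[mu]_(y in D) (k s y ^+ 2)%:E <= K%:E)%E) ->
  (\int[mu]_(y in D) (E y ^+ 2)%:E <= ((q - p) * ((q - p) * K))%:E)%E.
Proof.
move=> mD pq K0 mE mk hE hK.
have mI : measurable (`[p, q]%classic : set (measurableTypeR R)) by exact: measurable_itv.
have qp0 : 0 <= q - p by rewrite subr_ge0.
pose h (z : R * R) : \bar R := (k z.1 z.2 ^+ 2 * \1_(`[p, q]%classic) z.1 * \1_D z.2)%:E.
have mh : measurable_fun setT h.
  apply/measurable_EFinP; apply: measurable_funM.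
    apply: measurable_funM; first exact: measurable_funX.
    by apply: measurableT_comp => //; exact: measurable_indic.
  by apply: measurableT_comp => //; exact: measurable_indic.
have h0 z : (0 <= h z)%E.
  by rewrite /h lee_fin; apply: mulr_ge0 => //; apply: mulr_ge0 => //; exact: sqr_ge0.
have T := fubini_tonelli (m1 := mu) (m2 := mu) h mh h0.
have mG : measurable_fun setT (fun y => \int[mu]_s h (s, y))%E.
  exact: (measurable_fun_fubini_tonelli_G (m1 := mu) h mh h0).
have mF : measurable_fun setT (fun s => \int[mu]_y h (s, y))%E.
  exact: (measurable_fun_fubini_tonelli_F (m2 := mu) h mh h0).
have inn y : D y -> (\int[mu]_s h (s, y) = \int[mu]_(s in `[p, q]) (k s y ^+ 2)%:E)%E.
  move=> Dy; rewrite [RHS]integral_mkcond; apply: eq_integral => s _.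
  by rewrite /h /= patchE !indicE (mem_set Dy) mulr1; case: ifP => _; rewrite ?mulr1 ?mulr0.
have oin s : (\int[mu]_y h (s, y) = (\1_(`[p, q]%classic) s)%:E * \int[mu]_(y in D) (k s y ^+ 2)%:E)%E.
  rewrite [in RHS]integral_mkcond indicE; have [si|si] := boolP (s \in `[p, q]%classic).
    rewrite mul1e; apply: eq_integral => y _; rewrite /h /= patchE !indicE si mulr1.
    by case: ifP => _; rewrite ?mulr1 ?mulr0.
  rewrite mul0e; apply: integral0_eq => y _.
  by rewrite /h /= indicE (negbTE si) mulr0 mul0r.
have hs0 y : (0 <= \int[mu]_s h (s, y))%E by apply: integral_ge0 => s _; exact: h0.
have hy0 s : (0 <= \int[mu]_y h (s, y))%E by apply: integral_ge0 => y _; exact: h0.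
have mGD := measurable_funTS mG : measurable_fun D _.
have mI1 : measurable_fun setT (EFin \o (\1_(`[p, q]%classic) : R -> R)).
  by apply/measurable_EFinP; exact: measurable_indic.
have qpE : (0 <= (q - p)%:E)%E by rewrite lee_fin.
apply: (@le_trans _ _ ((q - p)%:E * \int[mu]_(y in D) \int[mu]_s h (s, y))%E).
  rewrite -(ge0_integralZl mu mD mGD (fun y _ => hs0 y) qpE).
  apply: (ge0_le_integral mu mD).
  - by move=> y _; rewrite lee_fin sqr_ge0.
  - by apply/measurable_EFinP; exact: measurable_funX.
  - exact: (measurable_funeM _ mGD).
  - move=> y Dy; have [sk ->] := hE y Dy; rewrite (inn y Dy).
    have fk : (\int[mu]_(s in `[p, q]) (k s y ^+ 2)%:E)%E \is a fin_num.
      by case: sk => _; exact: (integrable_fin_num mI).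
    rewrite -(fineK fk) -EFinM lee_fin.
    exact: (Rintegral_CauchySchwarz pq sk).
rewrite EFinM; apply: (lee_wpmul2l qpE).
apply: (@le_trans _ _ (\int[mu]_y \int[mu]_s h (s, y))%E).
  exact: (ge0_subset_integral mu mD measurableT mG (fun y _ => hs0 y) (@subsetT _ _)).
rewrite -T.
apply: (@le_trans _ _ (\int[mu]_s ((EFin \o (\1_(`[p, q]%classic) : R -> R)) s * K%:E))%E).
  apply: (ge0_le_integral mu measurableT (fun s _ => hy0 s) mF).
  - apply: emeasurable_funM; [exact: mI1|exact: measurable_cst].
  - move=> s _; rewrite oin /= indicE; have [si|si] := boolP (s \in `[p, q]%classic).
      by rewrite !mul1e; apply: hK; move: si; rewrite inE /= in_itv.
    by rewrite !mul0e.
rewrite (ge0_integralZr mu measurableT mI1); [|by move=> s _; rewrite /= lee_fin|by rewrite lee_fin].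
have -> : (\int[mu]_s (EFin \o (\1_(`[p, q]%classic) : R -> R)) s = mu `[p, q]%classic)%E.
  by have := integral_indic mu measurableT mI; rewrite setIT.
rewrite lebesgue_measure_itv /= lte_fin.
case: ifP => _; first by rewrite -EFinD -EFinM.
by rewrite mul0e lee_fin mulr_ge0.
Qed.

End Averages.


(** * Continuity of translations in L^2 *)

Section Translation.
Import numFieldNormedType.Exports.
Local Open Scope classical_set_scope.
Context {R : realType}.
Notation mu := (@lebesgue_measure R).
Implicit Types (f g : R -> R).

Definition sqn f : R := \int[mu]_x (f x ^+ 2).

Lemma sqn_ge0 f : 0 <= sqn f.
Proof. by apply: Rintegral_ge0 => x _; exact: sqr_ge0. Qed.

Lemma sqnD f g : sqint setT f -> sqint setT g -> sqn (fun x => f x + g x) <= 2 * sqn f + 2 * sqn g.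
Proof.
move=> sf sg; have mT : measurable ([set: R] : set (measurableTypeR R)) by exact: measurableT.
have [_ f2] := sf; have [_ g2] := sg; have [_ fg2] := sqintD mT sf sg.
rewrite -(RintegralZl _ mT f2) -(RintegralZl _ mT g2).
have I1 := integrableZl mT 2 f2; have I2 := integrableZl mT 2 g2.
rewrite -(RintegralD mT I1 I2).
apply: (le_Rintegral mT fg2 (integrableD mT I1 I2)) => x _ /=.
by have := sqr_ge0 (f x - g x); lra.
Qed.

Lemma sqint_shift f (h : R) : sqint setT f -> sqint setT (fun x => f (x + h)).
Proof.
move=> sf; have := sqint_affine h (oner_neq0 R) sf.
by under eq_fun do rewrite mul1r.
Qed.

Lemma sqn_shift f (h : R) : sqint setT f -> sqn (fun x => f (x + h)) = sqn f.
Proof.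
move=> [mf f2]; rewrite /sqn.
rewrite (Rintegral_affine h (oner_neq0 R) (F := fun x => f x ^+ 2) f2) normr1 mul1r.
by apply: eq_Rintegral => x _; rewrite mul1r.
Qed.

Definition shift_cont f := forall e : R, 0 < e -> exists2 d : R, 0 < d &
  forall h : R, `|h| < d -> sqn (fun x => f (x + h) - f x) < e.

Lemma shift_cont_approx f : sqint setT f ->
  (forall e : R, 0 < e -> exists g, [/\ sqint setT g, shift_cont g & sqn (fun x => f x - g x) < e]) ->
  shift_cont f.
Proof.
move=> sf H e e0; have mT : measurable ([set: R] : set (measurableTypeR R)) by exact: measurableT.
(* In the splitting through [g], two uses of [sqnD] give the three terms the weights 2, 4 and 4, so
   the total is below [10 e / 16]. *)
have e16 : 0 < e / 16 by rewrite divr_gt0.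
have [g [sg cg fg]] := H _ e16; have [d d0 hd] := cg _ e16.
exists d => // h hh.
have s1 := sqintB mT sf sg; have s2 := sqint_shift h s1.
have s3 := sqintB mT (sqint_shift h sg) sg.
have s1' := sqintN mT s1.
have E : (fun x => f (x + h) - f x) =
   (fun x => (f (x + h) - g (x + h)) + ((g (x + h) - g x) + - (f x - g x))).
  by apply/funext => x; ring.
rewrite E (le_lt_trans (sqnD s2 (sqintD mT s3 s1')))//.
have k1 := sqn_shift h s1; rewrite k1.
have k2 := sqnD s3 s1'; have k3 := hd h hh.
have k4 : sqn (fun x => - (f x - g x)) = sqn (fun x => f x - g x).
  by apply: eq_Rintegral => x _; rewrite sqrrN.
rewrite k4 in k2.
move: (sqn (fun x => f x - g x)) (sqn (fun x => g (x + h) - g x)) fg k2 k3 => a b fg k2 k3.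
lra.
Qed.

Lemma dominated_sqn (F : nat -> R -> R) (G : R -> R) :
  (forall n, measurable_fun setT (F n)) -> mu.-integrable setT (EFin \o G) ->
  (forall n x, F n x ^+ 2 <= G x) ->
  {ae mu, forall x, F n x @[n --> \oo] --> (0 : R)} ->
  sqn (F n) @[n --> \oo] --> (0 : R).
Proof.
move=> mF iG FG F0.
have mG : measurable_fun setT (EFin \o G) by exact: (measurable_int mu).
have [] := @dominated_convergence _ _ _ mu setT measurableT (fun n x => (F n x ^+ 2)%:E) (cst 0%E) (EFin \o G).
- by move=> n; apply/measurable_EFinP; exact: measurable_funX (mF n).
- exact: measurable_cst.
- apply: (filterS _ F0); first exact: (ae_filter_ringOfSetsType mu).
  move=> x h _; apply: cvg_EFin; first exact: nearW.
  have -> : (0 : R) = 0 ^+ 2 by rewrite expr0n.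
  by under eq_fun do rewrite expr2; rewrite expr2; apply: cvgM.
- exact: iG.
- by apply: aeW => x n _; rewrite /= lee_fin ger0_norm ?sqr_ge0//; exact: FG.
move=> _ _; rewrite integral0 => h.
by have /fine_cvgP[_] := h.
Qed.

Definition trunc (n : R) (y : R) : R := Num.max (- n) (Num.min y n).

Lemma trunc_le n y : 0 <= n -> `|trunc n y| <= n.
Proof.
move=> n0; rewrite ler_norml /trunc le_max lexx /= ge_max ge_min lexx orbT andbT.
by rewrite (le_trans _ n0)// oppr_le0.
Qed.

Lemma trunc_id n y : `|y| <= n -> trunc n y = y.
Proof.
by rewrite ler_norml => /andP[ny yn]; rewrite /trunc (min_idPl yn) (max_idPr ny).
Qed.

Lemma trunc_norm n y : 0 <= n -> `|trunc n y| <= `|y|.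
Proof.
move=> n0; have [yn|ny] := leP `|y| n; first by rewrite trunc_id.
exact: le_trans (trunc_le y n0) (ltW ny).
Qed.

Lemma maxr_dist (a y z : R) : `|Num.max a y - Num.max a z| <= `|y - z|.
Proof.
have := ler_norm (y - z); have := ler_norm (- (y - z)); rewrite normrN.
move: (normr_ge0 (y - z)); move: `|y - z| => d d0 d1 d2.
by rewrite ler_norml; apply/andP; split; rewrite !maxElt; case: ltP => ?; case: ltP => ?; lra.
Qed.

Lemma trunc_dist n y z : `|trunc n y - trunc n z| <= `|y - z|.
Proof.
rewrite /trunc (le_trans (maxr_dist _ _ _))//.
have minE x : Num.min x n = - Num.max (- n) (- x) by rewrite -oppr_min opprK minC.
rewrite !minE -opprD normrN (le_trans (maxr_dist _ _ _))//.
by rewrite -opprD normrN.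
Qed.

Lemma continuous_trunc n : continuous (trunc n).
Proof.
move=> x; apply: (@continuous_max _ _ (cst (- n)) (fun y => Num.min y n)); first exact: cst_continuous.
by apply: (@continuous_min _ _ id (cst n)); [exact: id|exact: cst_continuous].
Qed.

Definition window (M : R) : set R := `[- M, M]%classic.

Lemma measurable_window M : measurable (window M : set (measurableTypeR R)).
Proof. exact: measurable_itv. Qed.

Lemma windowE M x : window M x = (`|x| <= M) :> Prop.
Proof. by rewrite /window /= in_itv /= ler_norml. Qed.

Lemma integrable_window M (k : R) : mu.-integrable setT (EFin \o (fun x => k * \1_(window M) x)).
Proof.
have mW := measurable_window M.
have iW : mu.-integrable (window M) (EFin \o (fun=> k)).
  exact: (sqint_integrable mW (itv_lty _ _) (sqint_cst _ mW (itv_lty _ _))).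
have -> : (fun x => k * \1_(window M) x) = (fun=> k) \_ (window M).
  by apply/funext => x; rewrite patchE indicE; case: ifP => _; rewrite ?mulr1 ?mulr0.
exact: integrable_patch iW.
Qed.

Lemma sqint_window M (f : R -> R) : measurable_fun setT f ->
  (forall x, `|f x| <= M * \1_(window M) x) -> sqint setT f.
Proof.
move=> mf fM; split; first exact: mf.
apply: (@le_integrable _ _ _ mu setT measurableT _ _ _ _ (integrable_window M (M ^+ 2))).
  by apply/measurable_EFinP; exact: measurable_funX mf.
move=> x _; rewrite /= lee_fin; have := fM x.
rewrite indicE; case: (x \in window M); rewrite ?mulr1 ?mulr0 => h.
  by rewrite !normrX; apply: lerXn2r; rewrite ?nnegrE// (le_trans h)// ler_norm.
have /eqP -> : f x == 0 by rewrite -normr_le0.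
by rewrite expr0n normr0.
Qed.

Lemma ae_neq (y : R) : {ae mu, forall x, x <> y}.
Proof.
exists [set y]; split; [exact: measurable_set1|exact: lebesgue_measure_set1|].
by move=> x /= /contrapT.
Qed.

Lemma cut_continuous_at (k : R -> R) M x : continuous k -> x <> M -> x <> - M ->
  {for x, continuous (fun x => k x * \1_(window M) x)}.
Proof.
move=> ck xM xN; have [xl|xl] := boolP (`|x| < M).
  apply: (@cvg_trans _ (k y @[y --> x])); last first.
    have -> : k x * \1_(window M) x = k x by rewrite indicE mem_set ?mulr1// windowE ltW.
    exact: ck.
  apply: near_eq_cvg.
  have : \forall y \near x, `|y| < M.
    exact: (cvgr_lt _ (@norm_continuous R R x) _ xl).
  by apply: filterS => y yM; rewrite indicE mem_set ?mulr1// windowE ltW.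
have {}xl : M < `|x|.
  rewrite lt_neqAle leNgt xl andbT; apply/eqP => Mx.
  have : `|x| = x \/ `|x| = - x by have [x0|x0] := leP 0 x; [left; exact: ger0_norm|right; exact: ltr0_norm].
  by case=> h; [apply: xM|apply: xN]; rewrite Mx h ?opprK.
apply: (@cvg_trans _ ((0 : R) @[y --> x])); last first.
  have -> : k x * \1_(window M) x = 0.
    by rewrite indicE memNset ?mulr0// windowE; apply/negP; rewrite -ltNge.
  exact: (@cvg_cst _ (0 : R) _ (nbhs x)).
apply: near_eq_cvg.
have : \forall y \near x, M < `|y|.
  exact: (cvgr_gt _ (@norm_continuous R R x) _ xl).
apply: filterS => y yM; rewrite indicE memNset ?mulr0// windowE; apply/negP.
by rewrite -ltNge.
Qed.

(** Otherwise some shifts [h n] tending to 0 keep the norm above [e]. But the cut function is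
    continuous except possibly at [M] and [- M], so dominated convergence sends the norm to 0. *)
Lemma shift_cont_cut (k : R -> R) M : 0 < M -> continuous k -> (forall x, `|k x| <= M) ->
  shift_cont (fun x => k x * \1_(window M) x).
Proof.
move=> M0 ck kM; set f := (fun x => _); move=> e e0.
apply: contrapT => /forall2NP H.
have mk : measurable_fun setT k by exact: continuous_measurable_fun.
have mf : measurable_fun setT f.
  by apply: measurable_funM => //; apply: measurable_indic; exact: measurable_window.
have fM x : `|f x| <= M * \1_(window M) x.
  by rewrite /f normrM ler_pM// ger0_norm.
have sf := sqint_window mf fM.
have /choice[h hP] : forall n : nat, exists h : R, `|h| < n.+1%:R^-1 /\ e <= sqn (fun x => f (x + h) - f x).
  move=> n; have [|] := H n.+1%:R^-1; first by move=> /negP; rewrite invr_gt0 ltr0Sn.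
  move=> /existsNP[h /not_implyP[hh hn]]; exists h; split => //.
  by rewrite leNgt; apply/negP.
have h0 : h n @[n --> \oo] --> (0 : R).
  apply/cvgrPdist_lt => d d0; have := @cvg_harmonic R.
  move=> /cvgrPdist_lt/(_ _ d0); apply: filterS => n.
  rewrite !sub0r !normrN /harmonic /= => hd; apply: lt_trans hd.
  by rewrite [X in _ < X]ger0_norm ?invr_ge0//; have [] := hP n.
have h1 n : `|h n| <= 1.
  have [hn _] := hP n; rewrite (le_trans (ltW hn))// invf_le1 ?ltr0Sn//.
  by rewrite ler1n.
have cF : sqn (fun x => f (x + h n) - f x) @[n --> \oo] --> (0 : R).
  (* Both terms are bounded by [M], and shifts of size at most 1 stay inside the window of radius
     [M + 1]. *)
  apply: (dominated_sqn (G := fun x => (M + M) ^+ 2 * \1_(window (M + 1)) x)).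
  - by move=> n; have [] := sqintB measurableT (sqint_shift (h n) sf) sf.
  - exact: integrable_window.
  - move=> n x; rewrite indicE.
    have f0 y : M < `|y| -> f y = 0.
      move=> yM; rewrite /f indicE memNset ?mulr0// windowE; apply/negP.
      by rewrite -ltNge.
    have [xI|xI] := boolP (x \in window (M + 1)).
      rewrite mulr1 -[leLHS]ger0_norm ?sqr_ge0// normrX; apply: lerXn2r; first by rewrite nnegrE.
        by rewrite nnegrE addr_ge0 // ltW.
      rewrite (le_trans (ler_normB _ _))// lerD//.
        by rewrite (le_trans (fM _))// -[leRHS]mulr1 ler_pM2l// indicE; case: (_ \in _).
      by rewrite (le_trans (fM _))// -[leRHS]mulr1 ler_pM2l// indicE; case: (_ \in _).
    have {}xI : M + 1 < `|x|.
      by rewrite ltNge; apply/negP => h2; move/negP: xI; apply; rewrite inE windowE.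
    have hn := h1 n.
    rewrite (f0 x) ?(f0 (x + h n)) ?subr0 ?expr0n ?mulr0//; last by rewrite (lt_trans _ xI)// ltrDl.
    have := ler_normB (x + h n) (h n); rewrite addrK => h2.
    by move: (`|x|) (`|h n|) (`|x + h n|) xI hn h2 => p q r; lra.
  - have F := ae_filter_ringOfSetsType mu.
    have A := @filterI _ _ F _ _ (ae_neq M) (ae_neq (- M)).
    apply: (@filterS _ _ F _ _ _ A) => x [xM xN].
    have cx := cut_continuous_at ck xM xN.
    rewrite -(subrr (f x)); apply: cvgB; last exact: cvg_cst.
    have h3 : (x + h n) @[n --> \oo] --> x + 0 by apply: cvgD; [exact: cvg_cst|exact: h0].
    by rewrite addr0 in h3; exact: (cvg_comp _ _ h3 cx).
have := cF => /cvgrPdist_lt/(_ _ e0)[n _ /(_ n (leqnn n))].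
rewrite sub0r normrN ger0_norm ?sqn_ge0//.
by have [_] := hP n; rewrite leNgt => /negP.
Qed.

(** Continuous functions approximate [f] in L^1 on the window, and truncation at height [M] does not
    increase the distance. Between functions bounded by [M], the square of the difference is at most
    [2 M] times its modulus, so L^1 closeness becomes L^2 closeness. *)
Lemma shift_cont_bounded f M : 0 < M -> measurable_fun setT f ->
  (forall x, `|f x| <= M * \1_(window M) x) -> shift_cont f.
Proof.
move=> M0 mf fM; have sf := sqint_window mf fM.
have mW := measurable_window M.
apply: shift_cont_approx => // e e0.
have iW : mu.-integrable (window M) (EFin \o f).
  by apply: (sqint_integrable mW (itv_lty _ _)); exact: (sqintS mW measurableT).
have [g_ [cg ig]] := approximation_continuous_integrable mW (itv_lty _ _) iW.
move=> /fine_cvgP[[m1 _ fin]] /cvgrPdist_lt.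
have e2 : 0 < e / (2 * M) by rewrite divr_gt0// mulr_gt0.
move=> /(_ _ e2)[m2 _ lim].
pose n := (m1 + m2)%N; have fn := fin n (leq_addr _ _); have := lim n (leq_addl _ _).
move: (ig n) (cg n) => iG cG; rewrite sub0r normrN /= => ln.
pose k := fun x => trunc M (g_ n x).
have ck : continuous k by move=> x; exact: (continuous_comp (cG x) (@continuous_trunc M _)).
have kM x : `|k x| <= M by apply: trunc_le; exact: ltW.
have mG : measurable_fun setT (fun x => k x * \1_(window M) x).
  by apply: measurable_funM; [exact: continuous_measurable_fun|exact: measurable_indic].
have GM x : `|k x * \1_(window M) x| <= M * \1_(window M) x.
  by rewrite normrM ler_pM// ger0_norm.
have sG := sqint_window mG GM.
exists (fun x => k x * \1_(window M) x); split => //; first exact: shift_cont_cut.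
have iN := integrable_norm (integrableB mW iW iG).
have E : \int[mu]_(x in window M) `|f x - g_ n x| < e / (2 * M).
  by rewrite /Rintegral; apply: le_lt_trans ln; exact: ler_norm.
have [_ i2] := sqintB measurableT sf sG.
have i2M := integrableZl mW (2 * M) iN.
apply: (@le_lt_trans _ _ (\int[mu]_(x in window M) (2 * M * `|f x - g_ n x|))).
  rewrite /sqn [leRHS]Rintegral_mkcond.
  have i3 : mu.-integrable setT (EFin \o ((fun x => 2 * M * `|f x - g_ n x|) \_ (window M))).
    rewrite -restrict_EFin; exact/(integrable_mkcond _ mW).1.
  apply: (le_Rintegral measurableT i2 i3) => x _; rewrite patchE indicE.
  have [xI|xI] := boolP (x \in window M).
    rewrite mulr1 -[leLHS]ger0_norm ?sqr_ge0// expr2 normrM.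
    have f1 : `|f x| <= M by have := fM x; rewrite indicE xI mulr1.
    rewrite ler_pM//.
      by rewrite (le_trans (ler_normB _ _))// mulrDl mul1r lerD.
    by rewrite -{1}(trunc_id f1) trunc_dist.
  have := fM x; rewrite indicE (negbTE xI) !mulr0 normr_le0 => /eqP ->.
  by rewrite subr0 expr0n.
rewrite (RintegralZl _ mW iN) mulrC -ltr_pdivlMr// mulr_gt0//.
Qed.

(** Truncation in height and support: [F n x] equals [f x] once [n] exceeds [|x| + |f x|], and the
    squared differences are dominated by [4 f ^ 2]. *)
Lemma translation_continuity f : sqint setT f -> shift_cont f.
Proof.
move=> sf; have [mf f2] := sf; apply: shift_cont_approx => // e e0.
pose F (n : nat) x := trunc n.+1%:R (f x) * \1_(window n.+1%:R) x.
have mF n : measurable_fun setT (F n).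
  apply: measurable_funM; last by apply: measurable_indic; exact: measurable_window.
  apply: measurableT_comp mf; apply: continuous_measurable_fun; exact: continuous_trunc.
have FM n x : `|F n x| <= n.+1%:R * \1_(window n.+1%:R) x.
  by rewrite /F normrM ler_pM// ?trunc_le// ger0_norm.
have sF n := sqint_window (mF n) (FM n).
have : sqn (fun x => f x - F n x) @[n --> \oo] --> (0 : R).
  apply: (dominated_sqn (G := fun x => 4 * f x ^+ 2)).
  - by move=> n; have [] := sqintB measurableT sf (sF n).
  - exact: (integrableZl measurableT 4 f2).
  - move=> n x; have : `|F n x| <= `|f x|.
      rewrite /F normrM -[leRHS]mulr1 ler_pM// ?trunc_norm//.
      by rewrite indicE; case: (_ \in _); rewrite ?normr1 ?normr0.
    have -> : 4 * f x ^+ 2 = (2 * `|f x|) ^+ 2.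
      by rewrite exprMn -normrX (ger0_norm (sqr_ge0 _)) -natrX.
    move=> FF; rewrite -[leLHS](ger0_norm (sqr_ge0 _)) normrX.
    apply: lerXn2r; [by rewrite nnegrE|by rewrite nnegrE mulr_ge0|].
    by rewrite (le_trans (ler_normB _ _))// mulrDl mul1r lerD.
  - apply: aeW => x; apply: cvg_near_cst.
    exists (Num.bound (`|x| + `|f x|)) => // n /= hn.
    have hb : `|x| + `|f x| <= n.+1%:R.
      apply: (le_trans (ltW (archi_boundP _))); first by rewrite addr_ge0.
      by rewrite ler_nat (leq_trans hn).
    rewrite /F trunc_id ?(le_trans _ hb) ?lerDr// indicE mem_set ?mulr1 ?subrr//.
    by rewrite windowE (le_trans _ hb)// lerDl.
move=> /cvgrPdist_lt/(_ _ e0)[n _ /(_ n (leqnn n))].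
rewrite sub0r normrN ger0_norm ?sqn_ge0// => hn.
exists (F n); split => //; apply: (shift_cont_bounded _ (mF n) (FM n)).
by rewrite ltr0Sn.
Qed.

End Translation.

(** * Travelling waves *)



Section Primitives.
Import numFieldNormedType.Exports.
Local Open Scope classical_set_scope.
Context {R : realType}.
Notation mu := (@lebesgue_measure R).
Implicit Types (f g F G : R -> R).

(** Signals live on the whole time axis, with no control at infinity. *)
Definition lsq f := forall p q : R, sqint `[p, q] f.

Definition isprim F f := forall s t : R, s <= t -> F t - F s = \int[mu]_(x in `[s, t]) f x.

Lemma lsq_integrable f p q : lsq f -> mu.-integrable `[p, q] (EFin \o f).
Proof. by move=> lf; exact: (sqint_integrable (measurable_itv _) (itv_lty p q) (lf p q)). Qed.

Lemma lsqD f g : lsq f -> lsq g -> lsq (fun x => f x + g x).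
Proof. by move=> lf lg p q; apply: (sqintD (measurable_itv _)). Qed.

Lemma lsqZ (a : R) f : lsq f -> lsq (fun x => a * f x).
Proof. by move=> lf p q; apply: (sqintZ _ (measurable_itv _)). Qed.

Lemma sqint_lsq f : sqint setT f -> lsq f.
Proof. by move=> sf p q; exact: (sqintS (measurable_itv _) measurableT _ sf). Qed.

Lemma affine_itv (k m p q x : R) : p <= x <= q ->
  - (`|k| * (`|p| + `|q|) + `|m|) <= k * x + m <= `|k| * (`|p| + `|q|) + `|m|.
Proof.
move=> /andP[px xq]; rewrite -ler_norml (le_trans (ler_normD _ _))// lerD2r normrM ler_wpM2l//.
have := ler_norm q; have := ler_norm (- p); rewrite normrN => h1 h2.
rewrite ler_norml; have := normr_ge0 p; have := normr_ge0 q => h3 h4.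
by apply/andP; split; lra.
Qed.

Lemma lsq_affine (k m : R) f : k != 0 -> lsq f -> lsq (fun x => f (k * x + m)).
Proof.
move=> k0 lf p q; pose M := `|k| * (`|p| + `|q|) + `|m|.
have mM : measurable (`[- M, M]%classic : set (measurableTypeR R)) by exact: measurable_itv.
have s1 := sqint_affine m k0 (sqint_restrict mM (lf (- M) M)).
apply: (eq_sqint (measurable_itv _) _ (sqint_lsq s1 p q)) => x /=; rewrite in_itv /= => xpq.
by rewrite patchE mem_set//= in_itv /=; exact: affine_itv.
Qed.

Lemma Rintegral_chasles f (s r t : R) : lsq f -> s <= r -> r <= t ->
  \int[mu]_(x in `[s, t]) f x = \int[mu]_(x in `[s, r]) f x + \int[mu]_(x in `[r, t]) f x.
Proof.
move=> lf sr rt.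
have H := @Rintegral_itvB _ f (BLeft s) (BRight t) r (lsq_integrable s t lf) _ _.
rewrite -[LHS](subrK (\int[mu]_(x in `[s, r]) f x)) H ?bnd_simp// addrC; congr (_ + _).
apply: Rintegral_itv_obnd_cbnd.
by apply: integrableS (lsq_integrable r t lf) => //; exact: subset_itv_oc_cc.
Qed.

Lemma exists_prim f (a : R) : lsq f -> exists2 F, isprim F f & F 0 = a.
Proof.
move=> lf.
(* Integrals over sets carry no orientation, hence the case distinction on the sign of [t]. *)
pose F t : R := a + (if 0 <= t then \int[mu]_(x in `[0, t]) f x else - \int[mu]_(x in `[t, 0]) f x).
exists F; last by rewrite /F lexx set_itv1 Rintegral_set1 addr0.
move=> s t st; rewrite /F opprD addrACA subrr add0r.
have [s0|s0] := leP 0 s.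
  rewrite (le_trans s0 st); apply/eqP; rewrite subr_eq addrC.
  by rewrite (Rintegral_chasles lf s0 st).
have [t0|t0] := leP 0 t.
  by rewrite opprK addrC; apply/esym; exact: (Rintegral_chasles lf (ltW s0) t0).
rewrite opprK addrC; apply/eqP; rewrite subr_eq; apply/eqP.
exact: (Rintegral_chasles lf st (ltW t0)).
Qed.

Lemma isprim_continuous F f p q : lsq f -> isprim F f -> {within `[p, q], continuous F}.
Proof.
move=> lf Ff; have [pq|qp] := leP p q; last first.
  by rewrite set_itv_ge ?bnd_simp -?ltNge//; exact: continuous_subspace0.
have cI := parameterized_integral_continuous pq (lsq_integrable p q lf).
have : {within `[p, q], continuous (fun x => F p + parameterized_integral mu p x f)}.
  by move=> x; apply: cvgD; [exact: cvg_cst|exact: cI].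
apply: subspace_eq_continuous => x; rewrite inE /= in_itv /= => /andP[px _].
have E : F x = F p + \int[mu]_(y in `[p, x]) f y by rewrite -(Ff _ _ px) addrC subrK.
exact: esym E.
Qed.

Lemma isprim_lsq F f : lsq f -> isprim F f -> lsq F.
Proof. by move=> lf Ff p q; apply: continuous_sqint; exact: isprim_continuous Ff. Qed.

Lemma isprim_lin (a : R) F G f g : lsq f -> lsq g -> isprim F f -> isprim G g ->
  isprim (fun x => a * F x + G x) (fun x => a * f x + g x).
Proof.
move=> lf lg Ff Gg s t st; have mI : measurable (`[s, t]%classic : set (measurableTypeR R)) by exact: measurable_itv.
rewrite (RintegralD mI (integrableZl mI a (lsq_integrable s t lf)) (lsq_integrable s t lg)).
rewrite (RintegralZl _ mI (lsq_integrable s t lf)) -(Ff _ _ st) -(Gg _ _ st).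
by ring.
Qed.

Lemma isprimZ (a : R) F f : lsq f -> isprim F f -> isprim (fun x => a * F x) (fun x => a * f x).
Proof.
move=> lf Ff s t st; have mI : measurable (`[s, t]%classic : set (measurableTypeR R)) by exact: measurable_itv.
by rewrite (RintegralZl _ mI (lsq_integrable s t lf)) -(Ff _ _ st) mulrBr.
Qed.

Lemma isprim_affine F f (k m x y : R) : lsq f -> isprim F f -> k != 0 -> x <= y ->
  F (k * y + m) - F (k * x + m) = k * \int[mu]_(z in `[x, y]) f (k * z + m).
Proof.
move=> lf Ff k0 xy.
have key p q : (forall z, (p <= k * z + m <= q) = (x <= z <= y)) ->
    \int[mu]_(z in `[p, q]) f z = `|k| * \int[mu]_(z in `[x, y]) f (k * z + m).
  move=> h; rewrite [LHS]Rintegral_mkcond.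
  rewrite (Rintegral_affine m k0 (integrable_patch (measurable_itv _) (lsq_integrable p q lf))).
  rewrite [X in _ = _ * X]Rintegral_mkcond; congr (_ * _); apply: eq_Rintegral => z _.
  rewrite !patchE; have E : (k * z + m \in `[p, q]%classic) = (z \in `[x, y]%classic).
    by rewrite !mem_setE !in_itv /= h.
  by rewrite E.
have [kp|kn] := ltP 0 k.
  rewrite (Ff (k * x + m) (k * y + m)) ?lerD2r ?ler_pM2l//.
  by rewrite key ?gtr0_norm// => z; rewrite !lerD2r !ler_pM2l.
have {}kn : k < 0 by rewrite lt_neqAle k0.
rewrite -opprB (Ff (k * y + m) (k * x + m)) ?lerD2r ?ler_nM2l//.
by rewrite key ?ltr0_norm ?mulNr ?opprK// => z; rewrite !lerD2r !ler_nM2l// andbC.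
Qed.

Lemma isprim_shift F f (d : R) : lsq f -> isprim F f -> isprim (fun x => F (x - d)) (fun x => f (x - d)).
Proof.
move=> lf Ff s t st; have := isprim_affine (- d) lf Ff (oner_neq0 R) st.
by rewrite !mul1r => ->; apply: eq_Rintegral => z _; rewrite mul1r.
Qed.

Lemma isprim_eq0 F f (t : R) : isprim F f -> (forall s, 0 < s -> f s = 0) -> 0 <= t -> F t = F 0.
Proof.
move=> Ff f0 t0; apply/eqP; rewrite -subr_eq0 (Ff _ _ t0); apply/eqP.
have z x : x \in `]0, t]%classic -> f x = 0 by rewrite inE /= in_itv /= => /andP[x0 _]; exact: f0.
have I0 : \int[mu]_(x in `]0, t]) f x = 0.
  have -> : \int[mu]_(x in `]0, t]) f x = \int[mu]_(x in `]0, t]) (fun=> 0) x by apply: eq_Rintegral => x /z.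
  by rewrite Rintegral_cst// mul0r.
rewrite -Rintegral_itv_obnd_cbnd//.
apply: (@eq_integrable _ _ _ mu `]0, t] (measurable_itv _) (fun=> 0%E)); last exact: integrable0.
by move=> x xt; rewrite /= z.
Qed.

(** The combination of primitives is a primitive of a function that vanishes at positive times,
    hence constant. Four terms are what a node needs: two signals on each side. *)
Lemma delayed_relation (f1 f2 f3 f4 F1 F2 F3 F4 : R -> R) (p1 p2 p3 p4 d1 d2 d3 d4 t : R) :
  lsq f1 -> lsq f2 -> lsq f3 -> lsq f4 ->
  isprim F1 f1 -> isprim F2 f2 -> isprim F3 f3 -> isprim F4 f4 ->
  (forall s, 0 < s -> p1 * f1 (s - d1) + p2 * f2 (s - d2) + p3 * f3 (s - d3) + p4 * f4 (s - d4) = 0) ->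
  0 <= t ->
  p1 * F1 (t - d1) + p2 * F2 (t - d2) + p3 * F3 (t - d3) + p4 * F4 (t - d4) =
  p1 * F1 (0 - d1) + p2 * F2 (0 - d2) + p3 * F3 (0 - d3) + p4 * F4 (0 - d4).
Proof.
move=> l1 l2 l3 l4 i1 i2 i3 i4 h t0.
have sl f d : lsq f -> lsq (fun x => f (x - d)).
  by move=> lf; have := lsq_affine (- d) (oner_neq0 R) lf; under eq_fun do rewrite mul1r.
have L4 := lsqZ p4 (sl _ d4 l4); have L3 := lsqD (lsqZ p3 (sl _ d3 l3)) L4.
have L2 := lsqD (lsqZ p2 (sl _ d2 l2)) L3.
have J4 := isprimZ p4 (sl _ d4 l4) (isprim_shift d4 l4 i4).
have J3 := isprim_lin p3 (sl _ d3 l3) L4 (isprim_shift d3 l3 i3) J4.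
have J2 := isprim_lin p2 (sl _ d2 l2) L3 (isprim_shift d2 l2 i2) J3.
have J1 := isprim_lin p1 (sl _ d1 l1) L2 (isprim_shift d1 l1 i1) J2.
have := isprim_eq0 J1 _ t0; rewrite !addrA; apply.
by move=> s s0; rewrite !addrA; exact: h.
Qed.

End Primitives.



(** * Mean square continuity of travelling profiles *)

Section Transport.
Import numFieldNormedType.Exports.
Local Open Scope classical_set_scope.
Context {R : realType}.
Notation mu := (@lebesgue_measure R).
Implicit Types (f h a A : R -> R).

Lemma lsq_measurable a : lsq a -> measurable_fun setT a.
Proof.
move=> la; have -> : setT = \bigcup_n (window n%:R : set R).
  apply/esym/seteqP; split => // x _; exists (Num.bound `|x|) => //.
  by rewrite windowE ltW// archi_boundP.
apply/measurable_fun_bigcup; first by move=> n; exact: measurable_window.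
by move=> n; have [] := la (- n%:R) n%:R.
Qed.

Lemma sqint_EFin (D : set R) f : measurable (D : set (measurableTypeR R)) -> sqint D f ->
  (\int[mu]_(x in D) (f x ^+ 2)%:E)%E = (\int[mu]_(x in D) (f x ^+ 2))%:E.
Proof. by move=> mD [_ f2]; rewrite /Rintegral fineK//; exact: integrable_fin_num. Qed.

Lemma lsq_cell j a : lsq a -> sqint (cell j) a.
Proof. by move=> la; apply/sqint_cellP; exact: la. Qed.

Lemma lsq_phase a (k m t : R) : k != 0 -> lsq a -> lsq (fun x => a (t + (k * x + m))).
Proof.
move=> k0 la; have := lsq_affine (t + m) k0 la.
by under eq_fun do rewrite addrCA.
Qed.

(** Bounded times and a bounded cell involve [a] only on a window. Cut to it, [a] is square
    integrable on the line and translations are continuous; the change of variable explains the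
    factor [|k|]. *)
Lemma transport_continuity a (k m M e : R) j : lsq a -> k != 0 -> 0 < e ->
  exists2 d : R, 0 < d & forall s r : R, `|s| <= M -> `|r| <= M -> `|s - r| < d ->
    \int[mu]_(x in cell j) ((a (s + (k * x + m)) - a (r + (k * x + m))) ^+ 2) <= e.
Proof.
move=> la k0 e0; pose C := `|k| * (`|j%:R| + `|j.+1%:R|) + `|m|.
pose b := a \_ (window (M + C)); have mW := @measurable_window R (M + C).
have sb : sqint setT b by apply: sqint_restrict => //; exact: la.
have k0' : 0 < `|k| by rewrite normr_gt0.
have ek : 0 < `|k| * e by rewrite mulr_gt0.
have [d d0 hd] := translation_continuity sb ek.
exists d => // s r sM rM sr; have := hd _ sr => {}hd.
have mc := @measurable_cell R j.
have ab s' x : `|s'| <= M -> cell j x -> a (s' + (k * x + m)) = b (s' + (k * x + m)).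
  move=> s'M; rewrite /cell /= in_itv /= => /andP[x1 x2]; rewrite /b patchE mem_set// windowE.
  rewrite (le_trans (ler_normD _ _))// lerD// ler_norml.
  by apply: affine_itv; rewrite !ltW.
pose G y := (b (y + (s - r)) - b y) ^+ 2.
have [_ iG] := sqintB measurableT (sqint_shift (s - r) sb) sb.
have iG' := integrable_affine (m + r) k0 iG.
have E := Rintegral_affine (m + r) k0 iG.
rewrite -(ler_pM2l k0'); apply: (le_trans _ (ltW hd)); rewrite /sqn E ler_pM2l//.
rewrite [leLHS](_ : _ = \int[mu]_(x in cell j) G (k * x + (m + r))); last first.
  apply: eq_Rintegral => x; rewrite inE => jx; rewrite (ab s x sM jx) (ab r x rM jx) /G.
  by congr ((b _ - b _) ^+ 2); ring.
rewrite [leLHS]Rintegral_mkcond; apply: le_Rintegral => //.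
  apply: integrable_patch => //.
  by apply: (integrableS measurableT mc _ iG').
by move=> x _; rewrite patchE; case: ifP => // _; exact: sqr_ge0.
Qed.

(** At each point [x] the function squared is the integral over [s] in [[p, q]] of
    [a(s + ...) - a(r + ...)], which [average_bound] controls by the bound at each fixed [s]. *)
Lemma transport_average a A (k m p r q e : R) j : lsq a -> isprim A a -> k != 0 -> 0 <= e ->
  p <= q ->
  (forall s, p <= s <= q ->
    \int[mu]_(x in cell j) ((a (s + (k * x + m)) - a (r + (k * x + m))) ^+ 2) <= e) ->
  \int[mu]_(x in cell j) ((A (q + (k * x + m)) - A (p + (k * x + m)) - (q - p) * a (r + (k * x + m))) ^+ 2)
  <= (q - p) * ((q - p) * e).
Proof.
move=> la Aa k0 e0 pq H; have mc := @measurable_cell R j.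
have sD (s : R) : sqint (cell j) (fun x => a (s + (k * x + m)) - a (r + (k * x + m))).
  by apply: (sqintB mc); apply: lsq_cell; exact: lsq_phase.
have lA := isprim_lsq la Aa.
have sE : sqint (cell j) (fun x => A (q + (k * x + m)) - A (p + (k * x + m)) - (q - p) * a (r + (k * x + m))).
  apply: (sqintB mc); last by apply: (sqintZ _ mc); apply: lsq_cell; exact: lsq_phase.
  by apply: (sqintB mc); apply: lsq_cell; exact: lsq_phase.
rewrite -lee_fin -(sqint_EFin mc sE).
have ma := lsq_measurable la.
apply: (@average_bound _ (cell j) _ (fun s x => a (s + (k * x + m)) - a (r + (k * x + m)))) => //.
- by case: sE.
- apply: measurable_funB; apply: (measurableT_comp ma); apply: measurable_funD => //;
  by apply: measurable_funD => //; apply: measurable_funM.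
- move=> x _.
  have lx : lsq (fun s => a (s + (k * x + m))).
    have := lsq_affine (k * x + m) (oner_neq0 R) la.
    by under eq_fun do rewrite mul1r.
  have mI : measurable (`[p, q]%classic : set (measurableTypeR R)) by exact: measurable_itv.
  have sc := sqint_cst (a (r + (k * x + m))) mI (itv_lty p q).
  split; first exact: (sqintB mI (lx p q) sc).
  rewrite (RintegralB mI (lsq_integrable p q lx) (sqint_integrable mI (itv_lty p q) sc)).
  congr (_ - _).
    have := isprim_affine (k * x + m) la Aa (oner_neq0 R) pq.
    by rewrite !mul1r => ->; apply: eq_Rintegral => z _; rewrite mul1r.
  rewrite Rintegral_cst//= lebesgue_measure_itv /= lte_fin; move: pq; rewrite le_eqVlt.
  by case/predU1P => [->|pq]; rewrite ?ltxx ?pq /= ?subrr ?mulr0 ?mul0r// mulrC.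
- by move=> s sp; rewrite (sqint_EFin mc (sD s)) lee_fin; exact: H.
Qed.

End Transport.

(** * D'Alembert's formula on one cell *)

Section Waves.
Import numFieldNormedType.Exports.
Local Open Scope classical_set_scope.
Context {R : realType}.
Notation mu := (@lebesgue_measure R).
Variables (c : R) (c0 : 0 < c) (j : nat).
Implicit Types (f h F H : R -> R).

(** Minus the travel time to [x] from the emitting node: the left one for [false], the right one for
    [true]. *)
Definition phase (d : bool) (x : R) : R :=
  if d then c^-1 * x - c^-1 * j.+1%:R else - c^-1 * x + c^-1 * j%:R.

(** For the Riemann invariants [f = v - c u'] and [h = v + c u'], [wave] recovers [v] and [slope]
    recovers [u']. *)
Definition wave f h t x : R := 2^-1 * (f (t + phase false x) + h (t + phase true x)).

Definition slope f h t x : R := (2 * c)^-1 * (h (t + phase true x) - f (t + phase false x)).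

Lemma phase_left d : phase d j%:R = if d then - c^-1 else 0.
Proof. by case: d; rewrite /phase -1?mulrBr -?natr1; lra. Qed.

Lemma phase_right d : phase d j.+1%:R = if d then 0 else - c^-1.
Proof. by case: d; rewrite /phase -?natr1; lra. Qed.

Lemma wave_left f h t : wave f h t j%:R = 2^-1 * (f t + h (t - c^-1)).
Proof. by rewrite /wave !phase_left addr0. Qed.

Lemma wave_right f h t : wave f h t j.+1%:R = 2^-1 * (f (t - c^-1) + h t).
Proof. by rewrite /wave !phase_right addr0. Qed.

Lemma slope_left f h t : slope f h t j%:R = (2 * c)^-1 * (h (t - c^-1) - f t).
Proof. by rewrite /slope !phase_left addr0. Qed.

Lemma slope_right f h t : slope f h t j.+1%:R = (2 * c)^-1 * (h t - f (t - c^-1)).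
Proof. by rewrite /slope !phase_right addr0. Qed.

Lemma phaseE d x : phase d x = (if d then c^-1 else - c^-1) * x + (if d then - (c^-1 * j.+1%:R) else c^-1 * j%:R).
Proof. by case: d. Qed.

Lemma lsq_phased f (d : bool) t : lsq f -> lsq (fun x => f (t + phase d x)).
Proof.
move=> lf; under eq_fun do rewrite phaseE; apply: lsq_phase => //.
by case: d; rewrite ?oppr_eq0 invr_eq0 gt_eqF.
Qed.

Lemma isprim_phased F f (d : bool) t x : lsq f -> isprim F f -> j%:R <= x ->
  F (t + phase d x) = F (t + phase d j%:R) +
    (if d then c^-1 else - c^-1) * \int[mu]_(y in `[j%:R, x]) f (t + phase d y).
Proof.
move=> lf Ff jx; pose k := if d then c^-1 else - c^-1.
pose m := if d then - (c^-1 * j.+1%:R) else c^-1 * j%:R.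
have k0 : k != 0 by rewrite /k; case: (d); rewrite ?oppr_eq0 invr_eq0 gt_eqF.
have E y : t + phase d y = k * y + (t + m) by rewrite phaseE addrCA.
have := isprim_affine (t + m) lf Ff k0 jx; rewrite -!E => /eqP; rewrite subr_eq => /eqP ->.
by rewrite [RHS]addrC; congr (_ * _ + _); apply: eq_Rintegral => y _; rewrite E.
Qed.

Lemma sqint_wave f h t : lsq f -> lsq h -> sqint (cell j) (wave f h t).
Proof.
by move=> lf lh; apply: lsq_cell; apply: lsqZ; apply: lsqD; exact: lsq_phased.
Qed.

Lemma sqint_slope f h t : lsq f -> lsq h -> sqint (cell j) (slope f h t).
Proof.
move=> lf lh; have mc := @measurable_cell R j.
by apply: (sqintZ _ mc); apply: (sqintB mc); apply: lsq_cell; exact: lsq_phased.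
Qed.

Lemma wave_primitive F H f h t : lsq f -> lsq h -> isprim F f -> isprim H h ->
  primitive_on j (wave F H t) (slope f h t).
Proof.
move=> lf lh Ff Hh x /andP[jx _]; rewrite /wave /slope.
have mI : measurable (`[j%:R, x]%classic : set (measurableTypeR R)) by exact: measurable_itv.
have If := lsq_integrable j%:R x (lsq_phased false t lf).
have Ih := lsq_integrable j%:R x (lsq_phased true t lh).
rewrite (RintegralZl _ mI (integrableB mI Ih If)) (RintegralB mI Ih If).
rewrite (isprim_phased false t lf Ff jx) (isprim_phased true t lh Hh jx) /=.
by rewrite invfM; move: (Rintegral _ _ _) (Rintegral _ _ _) => *; ring.
Qed.

Lemma slope_primitive F H f h t : lsq f -> lsq h -> isprim F f -> isprim H h ->
  primitive_on j (slope F H t) (fun x => c^-1 ^+ 2 * wave f h t x).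
Proof.
move=> lf lh Ff Hh x /andP[jx _]; rewrite /wave /slope.
have mI : measurable (`[j%:R, x]%classic : set (measurableTypeR R)) by exact: measurable_itv.
have If := lsq_integrable j%:R x (lsq_phased false t lf).
have Ih := lsq_integrable j%:R x (lsq_phased true t lh).
have Is := integrableD mI If Ih.
rewrite (RintegralZl _ mI (integrableZl mI _ Is)) (RintegralZl _ mI Is) (RintegralD mI If Ih).
rewrite (isprim_phased false t lf Ff jx) (isprim_phased true t lh Hh jx) /=.
by rewrite invfM; move: (Rintegral _ _ _) (Rintegral _ _ _) => *; ring.
Qed.

End Waves.



(** * Signals emitted at the nodes *)

Section Signals.
Import numFieldNormedType.Exports.
Local Open Scope classical_set_scope.
Context {R : realType}.
Variables (N : nat) (c : nat -> R) (tau : R).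
Hypotheses (c0 : forall j, 0 < c j) (tau0 : 0 < tau) (htau : forall j, tau <= (c j)^-1).
Variable init : bool -> nat -> R -> R.
Hypothesis sinit : forall d j, sqint setT (init d j).
Implicit Types (g : bool -> nat -> R -> R).

(** The node conditions solved for the emitted signals in terms of the arriving, delayed ones. The
    clamped end reflects with coefficient -1, the damped end with [(c_0 - 1) / (c_0 + 1)]; at an
    interior node, continuity of [v] and of [c^2 u'] form a system with determinant
    [c_i + c_(i+1)]. *)
Definition node g (d : bool) (j : nat) (t : R) : R :=
  if d then
    if j.+1 == N then - g false j (t - (c j)^-1)
    else (c j + c j.+1)^-1 * (2 * c j.+1 * g true j.+1 (t - (c j.+1)^-1) +
                              (c j - c j.+1) * g false j (t - (c j)^-1))
  else if j is i.+1 then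
    (c i + c j)^-1 * ((c j - c i) * g true j (t - (c j)^-1) + 2 * c i * g false i (t - (c i)^-1))
  else (c 0%N + 1)^-1 * ((c 0%N - 1) * g true 0%N (t - (c 0%N)^-1)).

Definition step g d j t := if t <= 0 then init d j t else node g d j t.

Definition iterate n := iter n step init.

Lemma node_ext g1 g2 d j t : (forall d i, g1 d i (t - (c i)^-1) = g2 d i (t - (c i)^-1)) ->
  node g1 d j t = node g2 d j t.
Proof. by move=> e; rewrite /node; case: d => //; case: j => [|i]; rewrite ?e. Qed.

Lemma node_sqint g d j : (forall d j, sqint setT (g d j)) -> sqint setT (node g d j).
Proof.
move=> sg; have mT : measurable ([set: R] : set (measurableTypeR R)) by exact: measurableT.
have sh b i : sqint setT (fun t => g b i (t - (c i)^-1)) by exact: sqint_shift.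
rewrite /node; case: d; last case: j => [|i].
- case: (j.+1 == N); first exact: (sqintN mT (sh _ _)).
  exact: (sqintZ _ mT (sqintD mT (sqintZ _ mT (sh _ _)) (sqintZ _ mT (sh _ _)))).
- exact: (sqintZ _ mT (sqintZ _ mT (sh _ _))).
- exact: (sqintZ _ mT (sqintD mT (sqintZ _ mT (sh _ _)) (sqintZ _ mT (sh _ _)))).
Qed.

Lemma sqint_piecewise (f h : R -> R) : sqint setT f -> sqint setT h ->
  sqint setT (fun t => if t <= 0 then f t else h t).
Proof.
move=> sf sh; have mT : measurable ([set: R] : set (measurableTypeR R)) by exact: measurableT.
have m1 : measurable (`]-oo, 0]%classic : set (measurableTypeR R)) by exact: measurable_itv.
have m2 : measurable (`]0, +oo[%classic : set (measurableTypeR R)) by exact: measurable_itv.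
have s1 := sqint_restrict m1 (sqintS m1 mT (@subsetT _ _) sf).
have s2 := sqint_restrict m2 (sqintS m2 mT (@subsetT _ _) sh).
apply: (eq_sqint mT _ (sqintD mT s1 s2)) => t _.
by rewrite !patchE !mem_setE !in_itv /= andbT; case: leP => _; rewrite ?addr0 ?add0r.
Qed.

Lemma iterate_sqint n d j : sqint setT (iterate n d j).
Proof.
elim: n d j => [|n IH] d j; first exact: sinit.
by apply: sqint_piecewise; [exact: sinit|exact: node_sqint].
Qed.

(* Every delay is at least tau: n steps determine the signals up to time n tau. *)
Lemma iterate_stable n t d j : t <= n%:R * tau -> iterate n.+1 d j t = iterate n d j t.
Proof.
elim: n t d j => [|n IH] t d j; first by rewrite mul0r => h; rewrite /iterate /= /step h.
move=> h; rewrite {1}/iterate [iter n.+2 _ _]iterS -/(iterate _) {1}/step.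
rewrite [in RHS]/iterate [iter n.+1 _ _]iterS -/(iterate _) {1}/step; case: ifP => // _.
apply: node_ext => b i; apply: IH.
by rewrite lerBlDr (le_trans h)// -natr1 mulrDl mul1r lerD2l.
Qed.

Lemma iterate_add n m t d j : t <= n%:R * tau -> iterate (m + n) d j t = iterate n d j t.
Proof.
move=> h; elim: m => [//|m IH]; rewrite addSn iterate_stable// (le_trans h)// ler_wpM2r ?(ltW tau0)//.
by rewrite ler_nat leq_addl.
Qed.

(** The number of iterations may depend on [t]: enough to reach time [t] is taken, and by stability
    further ones change nothing. *)
Definition signal d j t := iterate (Num.bound (`|t| / tau)) d j t.

Lemma le_steps (t : R) : t <= (Num.bound (`|t| / tau))%:R * tau.
Proof.
rewrite -ler_pdivrMr// (le_trans _ (ltW (archi_boundP _)))//; last by rewrite divr_ge0// ltW.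
by rewrite ler_pM2r ?invr_gt0// ler_norm.
Qed.

Lemma signalE n d j t : t <= n%:R * tau -> signal d j t = iterate n d j t.
Proof.
move=> h; rewrite -(iterate_add (Num.bound (`|t| / tau)) d j h) addnC.
by rewrite iterate_add// le_steps.
Qed.

Lemma signal_le0 d j t : t <= 0 -> signal d j t = init d j t.
Proof. by move=> t0; rewrite (@signalE 0%N) ?mul0r. Qed.

Lemma signal_gt0 d j t : 0 < t -> signal d j t = node signal d j t.
Proof.
move=> t0; pose n := Num.bound (`|t| / tau); have tn : t <= n%:R * tau by exact: le_steps.
have tn1 : t <= n.+1%:R * tau by rewrite (le_trans tn)// ler_wpM2r ?(ltW tau0)// ler_nat.
rewrite (signalE d j tn1) /iterate iterS -/(iterate n) /step leNgt t0 /=.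
apply: node_ext => b i; rewrite (@signalE n)//.
by rewrite (le_trans _ tn)// gerBl invr_ge0 ltW.
Qed.

Lemma signal_lsq d j : lsq (signal d j).
Proof.
move=> p q; pose n := Num.bound (`|q| / tau).
apply: (eq_sqint (measurable_itv _) _ (sqint_lsq (iterate_sqint n d j) p q)) => x /=.
rewrite in_itv /= => /andP[_ xq]; apply/esym.
by rewrite (@signalE n)// (le_trans xq)// le_steps.
Qed.

(** This relation and the next three undo the inversion made in [node]. They are restricted to
    [0 < s] because earlier signals are prescribed by the datum. *)
Lemma signal_end j s : j.+1 = N -> 0 < s ->
  signal false j (s - (c j)^-1) + signal true j s = 0.
Proof. by move=> jN s0; rewrite (signal_gt0 true j s0) /node jN eqxx subrr. Qed.

Lemma signal_damped s : 0 < s ->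
  c 0%N * (signal true 0%N (s - (c 0%N)^-1) - signal false 0%N s) =
  signal false 0%N s + signal true 0%N (s - (c 0%N)^-1).
Proof.
move=> s0; rewrite (signal_gt0 false 0%N s0) /node; have cp := c0 0%N.
by move: (signal _ _ _) => y; field; rewrite gt_eqF// addr_gt0.
Qed.

Lemma signal_continuity j s : j.+1 != N -> 0 < s ->
  signal false j (s - (c j)^-1) + signal true j s =
  signal false j.+1 s + signal true j.+1 (s - (c j.+1)^-1).
Proof.
move=> jN s0; rewrite (signal_gt0 true j s0) (signal_gt0 false j.+1 s0) /node (negbTE jN).
have [p q] := (c0 j, c0 j.+1).
by move: (signal _ _ _) (signal _ _ _) => y z; field; rewrite gt_eqF// addr_gt0.
Qed.

Lemma signal_flux j s : j.+1 != N -> 0 < s ->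
  c j * (signal true j s - signal false j (s - (c j)^-1)) =
  c j.+1 * (signal true j.+1 (s - (c j.+1)^-1) - signal false j.+1 s).
Proof.
move=> jN s0; rewrite (signal_gt0 true j s0) (signal_gt0 false j.+1 s0) /node (negbTE jN).
have [p q] := (c0 j, c0 j.+1).
by move: (signal _ _ _) (signal _ _ _) => y z; field; rewrite gt_eqF// addr_gt0.
Qed.

End Signals.



(** * The energy norm in terms of Riemann invariants *)

Section TransportNorm.
Import numFieldNormedType.Exports.
Local Open Scope classical_set_scope.
Local Open Scope complex_scope.
Context {R : realType} {N : nat} (rho : 'I_N -> R) (hrho : forall j, 0 < rho j).
Notation mu := (@lebesgue_measure R).
Notation inH := (@inH R N).
Notation hnorm := (hnorm rho).
Variables (c : nat -> R).
Hypotheses (c0 : forall j, 0 < c j) (hc : forall j : 'I_N, c j ^+ 2 = rho j).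

Lemma sqint_int_half (j : nat) (e : R) (s : R) (f g h : R -> R) : s ^+ 2 = 1 ->
  sqint (cell j) f -> sqint (cell j) g -> sqint (cell j) h ->
  \int[mu]_(x in cell j) (g x ^+ 2) <= e -> \int[mu]_(x in cell j) (h x ^+ 2) <= e ->
  ae_eq mu (cell j) f (fun x => 2^-1 * (h x + s * g x)) ->
  \int[mu]_(x in cell j) (f x * f x) <= e.
Proof.
move=> s1 sf sg sh ge he fgh; have mc := @measurable_cell R j.
have sk : sqint (cell j) (fun x => 2^-1 * (h x + s * g x)).
  by apply: (sqintZ _ mc); apply: (sqintD mc sh); exact: (sqintZ _ mc).
rewrite (dot_ae sf sk sf fgh).
under eq_Rintegral do rewrite mulrC; rewrite (dot_ae sf sk sk fgh).
have [_ g2] := sg; have [_ h2] := sh.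
have I1 := integrableZl mc 2^-1 g2; have I2 := integrableZl mc 2^-1 h2.
apply: (@le_trans _ _ (\int[mu]_(x in cell j) (2^-1 * g x ^+ 2 + 2^-1 * h x ^+ 2))).
  apply: (le_Rintegral mc _ (integrableD mc I1 I2)); first exact: (sqintM mc sk sk).
  move=> x _; have := sqr_ge0 (h x - s * g x).
  have -> : 2^-1 * (h x + s * g x) * (2^-1 * (h x + s * g x)) =
    4^-1 * (h x ^+ 2 + 2 * (h x * (s * g x)) + s ^+ 2 * g x ^+ 2) by field.
  have -> : (h x - s * g x) ^+ 2 = h x ^+ 2 - 2 * (h x * (s * g x)) + s ^+ 2 * g x ^+ 2 by ring.
  by rewrite s1 mul1r; lra.
rewrite (RintegralD mc I1 I2) (RintegralZl _ mc g2) (RintegralZl _ mc h2).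
by move: (Rintegral _ _ _) (Rintegral _ _ _) ge he => *; lra.
Qed.

(** Each feature is a half sum or half difference of two invariants, so its squared norm is at most
    [e]; there are [4 N] features. *)
Lemma hnorm_transport (Z : state R N) (E : bool -> bool -> 'I_N -> R -> R) (e n : R) :
  inH Z -> 0 <= n -> (4 * N)%:R * e <= n ^+ 2 ->
  (forall b d (j : 'I_N), sqint (cell j) (E b d j)) ->
  (forall b d (j : 'I_N), \int[mu]_(x in cell j) (E b d j x ^+ 2) <= e) ->
  (forall b (j : 'I_N), ae_eq mu (cell j) (fun x => part b (Z.2 j x))
     (fun x => 2^-1 * (E b false j x + E b true j x))) ->
  (forall b (j : 'I_N), ae_eq mu (cell j) (fun x => part b (wd j (Z.1 j) x))
     (fun x => (2 * c j)^-1 * (E b true j x - E b false j x))) ->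
  hnorm Z <= n.
Proof.
move=> hZ n0 ne sE Ee Z2 Z1; apply: (ler_of_sqr n0); rewrite (hnormM hrho hZ) -expr2 (le_trans _ ne)// hipE.
apply: (@le_trans _ _ (\sum_(j < N) \sum_(k : bool * bool) e)); last first.
  under eq_bigr do rewrite sum_bool2.
  by rewrite sumr_const card_ord -[leLHS]mulr_natl natrM; move: (N%:R) => k; lra.
apply: ler_sum => j _; apply: ler_sum => -[a b] _.
have sF := feature_sqint rho j (a, b) hZ.
case: a sF => sF.
  apply: (@sqint_int_half _ _ (-1) _ (E b false j) (E b true j)) => //.
    by rewrite sqrrN expr1n.
  apply: filterS (Z1 b j) => x h jx; rewrite /feature /= h//.
  rewrite -(hc j) sqrtr_sqr gtr0_norm// invfM mulrA mulrCA mulfV ?gt_eqF// mulr1.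
  by rewrite mulN1r.
apply: (@sqint_int_half _ _ 1 _ (E b true j) (E b false j)) => //.
  by rewrite expr1n.
by apply: filterS (Z2 b j) => x h jx; rewrite /feature /= h// mul1r.
Qed.

(** The inverse of one plus the sum of the inverses lies below every [d i], and stays positive when
    [I] is empty. *)
Lemma uniform_delta (I : finType) (P : I -> R -> Prop) :
  (forall i d d', d' <= d -> P i d -> P i d') ->
  (forall i, exists2 d : R, 0 < d & P i d) -> exists2 d : R, 0 < d & forall i, P i d.
Proof.
move=> mP hP; have /choice[d hd] : forall i, exists d : R, 0 < d /\ P i d by move=> i; have [d] := hP i; exists d.
have d0 i : 0 < d i by case: (hd i).
have s0 : 0 <= \sum_i (d i)^-1.
  by apply: sumr_ge0 => i _; rewrite invr_ge0 ltW.
exists (1 + \sum_i (d i)^-1)^-1; first by rewrite invr_gt0 ltr_wpDr.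
move=> i; apply: (mP i (d i)); last by case: (hd i).
rewrite -[leRHS]invrK lef_pV2 ?posrE ?invr_gt0 ?ltr_wpDr//.
rewrite (bigD1 i)//= addrCA lerDl addr_ge0// sumr_ge0// => k _.
by rewrite invr_ge0 ltW.
Qed.

End TransportNorm.



(** * The d'Alembert solution is a mild solution *)

Section DAlembert.
Import numFieldNormedType.Exports.
Local Open Scope classical_set_scope.
Local Open Scope complex_scope.
Context {R : realType} {N : nat} (rho : 'I_N -> R) (hrho : forall j, 0 < rho j).
Notation mu := (@lebesgue_measure R).
Notation inH := (@inH R N).
Notation inDA := (inDA rho).
Notation opA := (opA rho).
Variables (c : nat -> R).
Hypotheses (c0 : forall j, 0 < c j) (hc : forall j : 'I_N, c j ^+ 2 = rho j).

Definition cplx (f : bool -> R) : R[i] := (f false +i* f true)%C.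

Lemma part_cplx b f : part b (cplx f) = f b.
Proof. by case: b. Qed.

Lemma isH1_cplx (j : nat) (w g : bool -> R -> R) :
  (forall b, sqint (cell j) (g b)) -> (forall b, primitive_on j (w b) (g b)) ->
  isH1 j (fun x => cplx (w^~ x)) (fun x => cplx (w^~ x)) (fun x => cplx (g^~ x)).
Proof.
move=> sg wg; apply/isH1_part; split.
- apply/L2_part => b; under eq_fun do rewrite part_cplx.
  exact: primitive_on_sqint (sg b) (wg b).
- by apply/L2_part => b; under eq_fun do rewrite part_cplx; exact: sg.
- exact: ae_eq_refl.
- by move=> b x xj; rewrite !part_cplx (wg b x xj); congr (_ + _);
    apply: eq_Rintegral => y _; rewrite part_cplx.
Qed.

(* Real and imaginary parts are indexed by the first boolean; the second one
   separates the signals leaving the left and the right node of each cell. *)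
Implicit Types (f F : bool -> bool -> nat -> R -> R).

Definition wv f b j t x := wave (c j) j (f b false j) (f b true j) t x.
Definition sl f b j t x := slope (c j) j (f b false j) (f b true j) t x.

Lemma wv_primitive f F b j t : (forall b d j, lsq (f b d j)) ->
  (forall b d j, isprim (F b d j) (f b d j)) -> primitive_on j (wv F b j t) (sl f b j t).
Proof. by move=> lf Ff; apply: wave_primitive. Qed.

Lemma sl_primitive f F b j t : (forall b d j, lsq (f b d j)) ->
  (forall b d j, isprim (F b d j) (f b d j)) ->
  primitive_on j (sl F b j t) (fun x => (c j)^-1 ^+ 2 * wv f b j t x).
Proof. by move=> lf Ff; apply: slope_primitive. Qed.

Lemma sqint_wv f b j t : (forall b d j, lsq (f b d j)) -> sqint (cell j) (wv f b j t).
Proof. by move=> lf; apply: sqint_wave. Qed.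

Lemma sqint_sl f b j t : (forall b d j, lsq (f b d j)) -> sqint (cell j) (sl f b j t).
Proof. by move=> lf; apply: sqint_slope. Qed.

Lemma primitive_onB (j : nat) (w g v h : R -> R) :
  sqint (cell j) g -> sqint (cell j) h -> primitive_on j w g -> primitive_on j v h ->
  primitive_on j (fun x => w x - v x) (fun x => g x - h x).
Proof.
move=> sg sh wg vh x xj; have := primitive_on_lin (-1) sh sg vh wg xj.
have E (a b : R) : -1 * a + b = b - a by ring.
by rewrite !E => ->; congr (_ + _); apply: eq_Rintegral => y _; rewrite E.
Qed.

(** Order of the terms: arriving from cell [i], emitted into cell [i], emitted into cell [j],
    arriving from cell [j]; arriving signals are delayed. End nodes use [i = j] with two zero
    coefficients. *)
Lemma node_relation f F b (i j : nat) (p1 p2 p3 p4 t : R) : (forall b d j, lsq (f b d j)) ->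
  (forall b d j, isprim (F b d j) (f b d j)) ->
  (forall s, 0 < s -> p1 * f b false i (s - (c i)^-1) + p2 * f b true i s +
     p3 * f b false j s + p4 * f b true j (s - (c j)^-1) = 0) -> 0 <= t ->
  p1 * F b false i (t - (c i)^-1) + p2 * F b true i t +
     p3 * F b false j t + p4 * F b true j (t - (c j)^-1) =
  p1 * F b false i (0 - (c i)^-1) + p2 * F b true i 0 +
     p3 * F b false j 0 + p4 * F b true j (0 - (c j)^-1).
Proof.
move=> lf Ff h t0.
have := @delayed_relation R (f b false i) (f b true i) (f b false j) (f b true j)
  (F b false i) (F b true i) (F b false j) (F b true j) p1 p2 p3 p4 (c i)^-1 0 0 (c j)^-1 t
  (lf _ _ _) (lf _ _ _) (lf _ _ _) (lf _ _ _) (Ff _ _ _) (Ff _ _ _) (Ff _ _ _) (Ff _ _ _).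
rewrite !subr0; apply => // s s0; rewrite !subr0; exact: h.
Qed.

Definition clamped f b t := forall j, j.+1 = N -> wv f b j t j.+1%:R = 0.
Definition connected f b t := forall j, (j.+1 < N)%N ->
  wv f b j t j.+1%:R = wv f b j.+1 t j.+1%:R.

Lemma clamped_prim f F b t : (forall b d j, lsq (f b d j)) ->
  (forall b d j, isprim (F b d j) (f b d j)) -> (forall s, 0 < s -> clamped f b s) -> 0 <= t ->
  forall j, j.+1 = N -> wv F b j t j.+1%:R - wv F b j 0 j.+1%:R = 0.
Proof.
move=> lf Ff h t0 j jN; rewrite /wv !wave_right.
have := @node_relation f F b j j 1 1 0 0 t lf Ff _ t0.
rewrite !mul1r !mul0r !addr0 => ->; first by rewrite subrr.
move=> s s0; have := h s s0 j jN; rewrite /wv wave_right !mul1r !mul0r !addr0 => /eqP.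
by rewrite mulf_eq0 invr_eq0 pnatr_eq0 /= => /eqP.
Qed.

Lemma connected_prim f F b t : (forall b d j, lsq (f b d j)) ->
  (forall b d j, isprim (F b d j) (f b d j)) -> (forall s, 0 < s -> connected f b s) -> 0 <= t ->
  forall j, (j.+1 < N)%N ->
  wv F b j t j.+1%:R - wv F b j 0 j.+1%:R = wv F b j.+1 t j.+1%:R - wv F b j.+1 0 j.+1%:R.
Proof.
move=> lf Ff h t0 j jN; rewrite /wv !wave_right !wave_left.
have H := @node_relation f F b j j.+1 1 1 (-1) (-1) t lf Ff.
have {}H := H _ t0; apply/eqP; rewrite -subr_eq0; apply/eqP.
have : forall s : R, 0 < s -> 1 * f b false j (s - (c j)^-1) + 1 * f b true j s +
   -1 * f b false j.+1 s + -1 * f b true j.+1 (s - (c j.+1)^-1) = 0.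
  move=> s s0; have := h s s0 j jN; rewrite /wv wave_right wave_left.
  by move: (f _ _ _ _) (f _ _ _ _) (f _ _ _ _) (f _ _ _ _) => *; lra.
move=> /H.
by move: (F _ _ _ _) (F _ _ _ _) (F _ _ _ _) (F _ _ _ _) (F _ _ _ _) (F _ _ _ _) (F _ _ _ _) (F _ _ _ _) => *; lra.
Qed.

(* f0 consists of the signals, f1 and f2 of their first and second primitives;
   then v, u and the time integral of u are the waves of f0, f1 and f2. *)
Variables (f0 f1 f2 : bool -> bool -> nat -> R -> R).
Hypotheses (l0 : forall b d j, lsq (f0 b d j)) (i1 : forall b d j, isprim (f1 b d j) (f0 b d j))
  (i2 : forall b d j, isprim (f2 b d j) (f1 b d j)).
Hypotheses (cl0 : forall b (s : R), 0 < s -> clamped f0 b s) (co0 : forall b (s : R), 0 < s -> connected f0 b s).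
Hypothesis damped0 : forall b (s : R), 0 < s ->
  c 0%N * (f0 b true 0%N (s - (c 0%N)^-1) - f0 b false 0%N s) =
  f0 b false 0%N s + f0 b true 0%N (s - (c 0%N)^-1).
Hypothesis flux0 : forall b (s : R) j, 0 < s -> (j.+1 < N)%N ->
  c j * (f0 b true j s - f0 b false j (s - (c j)^-1)) =
  c j.+1 * (f0 b true j.+1 (s - (c j.+1)^-1) - f0 b false j.+1 s).
Hypotheses (cl1 : forall b, clamped f1 b 0) (co1 : forall b, connected f1 b 0).

Let l1 b d j : lsq (f1 b d j). Proof. exact: isprim_lsq (i1 b d j). Qed.

(** The velocity satisfies the condition at positive times, so the displacement keeps its value at
    time 0, which is that of the datum. *)
Let clamped1 b t : 0 <= t -> clamped f1 b t.
Proof.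
move=> t0 j jN; have := clamped_prim l0 i1 (cl0 b) t0 jN.
by rewrite (cl1 b jN) subr0.
Qed.

Let connected1 b t : 0 <= t -> connected f1 b t.
Proof.
move=> t0 j jN; have := connected_prim l0 i1 (co0 b) t0 jN.
by rewrite (co1 b jN) => /addIr.
Qed.

Definition travel (t : R) : state R N :=
  (fun (j : 'I_N) x => cplx (fun b => wv f1 b j t x), fun (j : 'I_N) x => cplx (fun b => wv f0 b j t x)).

(** Subtracting the value at time 0 makes the integral start from zero and removes the constants of
    integration of [f2]. *)
Definition travel_int (t : R) : state R N :=
  (fun (j : 'I_N) x => cplx (fun b => wv f2 b j t x - wv f2 b j 0 x),
   fun (j : 'I_N) x => cplx (fun b => wv f1 b j t x - wv f1 b j 0 x)).

Lemma travel_isH1 (j : nat) t : isH1 j (fun x => cplx (fun b => wv f1 b j t x))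
  (fun x => cplx (fun b => wv f1 b j t x)) (fun x => cplx (fun b => sl f0 b j t x)).
Proof.
by apply: (@isH1_cplx j (fun b x => wv f1 b j t x) (fun b x => sl f0 b j t x)) => b;
  [exact: sqint_sl|exact: wv_primitive].
Qed.

Lemma diff_isH1 f F (j : nat) t : (forall b d j, lsq (f b d j)) ->
  (forall b d j, isprim (F b d j) (f b d j)) ->
  isH1 j (fun x => cplx (fun b => wv F b j t x - wv F b j 0 x))
  (fun x => cplx (fun b => wv F b j t x - wv F b j 0 x))
  (fun x => cplx (fun b => sl f b j t x - sl f b j 0 x)).
Proof.
move=> lf Ff; have mc := @measurable_cell R j.
apply: (@isH1_cplx j (fun b x => wv F b j t x - wv F b j 0 x) (fun b x => sl f b j t x - sl f b j 0 x)) => b.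
  by apply: (sqintB mc); exact: sqint_sl.
by apply: primitive_onB; [exact: sqint_sl|exact: sqint_sl|exact: wv_primitive|exact: wv_primitive].
Qed.

(** The wave equation integrated in time: [c^2] times the second space derivative of the time
    integral of [u] is [v(t) - v(0)]. *)
Lemma slope_isH1 (j : nat) t :
  isH1 j (fun x => cplx (fun b => sl f1 b j t x - sl f1 b j 0 x))
  (fun x => cplx (fun b => sl f1 b j t x - sl f1 b j 0 x))
  (fun x => cplx (fun b => (c j)^-1 ^+ 2 * wv f0 b j t x - (c j)^-1 ^+ 2 * wv f0 b j 0 x)).
Proof.
have mc := @measurable_cell R j.
apply: (@isH1_cplx j (fun b x => sl f1 b j t x - sl f1 b j 0 x)
  (fun b x => (c j)^-1 ^+ 2 * wv f0 b j t x - (c j)^-1 ^+ 2 * wv f0 b j 0 x)) => b.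
  by apply: (sqintB mc); apply: (sqintZ _ mc); exact: sqint_wv.
by apply: primitive_onB; [apply: (sqintZ _ mc); exact: sqint_wv|
  apply: (sqintZ _ mc); exact: sqint_wv|exact: sl_primitive|exact: sl_primitive].
Qed.

Lemma inV_cplx (w g : forall j : nat, bool -> R -> R) :
  (forall j : 'I_N, isH1 j (fun x => cplx (w j ^~ x)) (fun x => cplx (w j ^~ x)) (fun x => cplx (g j ^~ x))) ->
  (forall b j, j.+1 = N -> w j b j.+1%:R = 0) ->
  (forall b j, (j.+1 < N)%N -> w j b j.+1%:R = w j.+1 b j.+1%:R) ->
  inV (fun (j : 'I_N) x => cplx (w j ^~ x)).
Proof.
move=> H wN wc; have jj (j : nat) : j%:R <= j.+1%:R :> R by exact/ltW/natS_gt.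
have T (j : 'I_N) := isH1P (H j).
split.
- by move=> j; case: (T j).
- move=> j jN; have [_ _ tr] := T j; have NE : N%:R = j.+1%:R :> R by rewrite jN.
  rewrite NE tr ?lexx ?jj//.
  by apply: part_eqP => b; rewrite part_cplx part0 wN.
- move=> i j ij; have [_ _ tri] := T i; have [_ _ trj] := T j.
  have jE : j%:R = i.+1%:R :> R by rewrite ij.
  rewrite trj ?lexx ?jj// jE tri ?lexx ?jj//.
  have iN : (i.+1 < N)%N by rewrite ij.
  by apply: part_eqP => b; rewrite !part_cplx (wc b i iN) ij.
Qed.

Lemma inV_travel t : 0 <= t -> inV (travel t).1.
Proof.
move=> t0; apply: (inV_cplx (w := fun j b x => wv f1 b j t x) (g := fun j b x => sl f0 b j t x)).
- by move=> j; exact: travel_isH1.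
- by move=> b j jN; exact: clamped1.
- by move=> b j jN; exact: connected1.
Qed.

Lemma inH_travel t : 0 <= t -> inH (travel t).
Proof.
move=> t0; split; first exact: inV_travel.
by move=> j; apply/L2_part => b /=; under eq_fun do rewrite part_cplx; exact: sqint_wv.
Qed.

Lemma inDA_travel_int t : 0 <= t -> inDA (travel_int t).
Proof.
move=> t0; have jj (j : nat) : j%:R <= j.+1%:R :> R by exact/ltW/natS_gt.
have hV1 : inV (travel_int t).1.
  apply: (inV_cplx (w := fun j b x => wv f2 b j t x - wv f2 b j 0 x)
    (g := fun j b x => sl f1 b j t x - sl f1 b j 0 x)).
  - by move=> j; exact: diff_isH1.
  - by move=> b j jN; apply: (clamped_prim l1 i2) => // s s0; apply: clamped1; exact: ltW.
  - by move=> b j jN; apply: (connected_prim l1 i2) => // s s0; apply: connected1; exact: ltW.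
have hV2 : inV (travel_int t).2.
  apply: (inV_cplx (w := fun j b x => wv f1 b j t x - wv f1 b j 0 x)
    (g := fun j b x => sl f0 b j t x - sl f0 b j 0 x)).
  - by move=> j; exact: diff_isH1.
  - by move=> b j jN; rewrite !clamped1 ?subrr.
  - by move=> b j jN; rewrite !connected1.
have D2 (j : 'I_N) := isH1P (diff_isH1 j t l1 i2).
have D1 (j : 'I_N) := isH1P (diff_isH1 j t l0 i1).
have S1 (j : 'I_N) := isH1P (slope_isH1 j t).
have E (j : 'I_N) : H1 j (wd j ((travel_int t).1 j)) /\
  (forall x, j%:R <= x <= j.+1%:R -> trace j (wd j ((travel_int t).1 j)) x =
    cplx (fun b => sl f1 b j t x - sl f1 b j 0 x)).
  have [HD ae _] := D2 j; have [HS _ tr] := S1 j.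
  have [H1w _ trw] := H1_ae HS (H1_L2wd HD) (ae_eq_sym ae).
  by split => // x xj; rewrite trw; exact: tr.
split.
- by split => // j; split; [case: (D2 j)|case: (E j)].
- exact: hV2.
- move=> j j0; have [_ trs] := E j; have [_ _ trw] := D1 j.
  rewrite (_ : (0 : R) = j%:R); last by rewrite j0.
  rewrite trs ?lexx ?jj// trw ?lexx ?jj//; apply: part_eqP => b.
  rewrite partZ !part_cplx -hc /wv /sl j0 !slope_left !wave_left.
  (* The coefficients are those of [c (h - f) - (f + h)], the damping condition [rho u' = v] written
     in the invariants. *)
  have := @node_relation f0 f1 b 0%N 0%N 0 0 (- (c 0%N + 1)) (c 0%N - 1) t l0 i1 _ t0.
  have hh : forall s : R, 0 < s -> 0 * f0 b false 0%N (s - (c 0%N)^-1) + 0 * f0 b true 0%N s +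
      - (c 0%N + 1) * f0 b false 0%N s + (c 0%N - 1) * f0 b true 0%N (s - (c 0%N)^-1) = 0.
    by move=> s s0; have := damped0 b s0; move: (f0 _ _ _ _) (f0 _ _ _ _) => y z h; rewrite !mul0r; lra.
  move=> /(_ hh); have cn : c 0%N != 0 by rewrite gt_eqF.
  rewrite !mul0r !add0r invfM.
  move: (f1 _ _ _ _) (f1 _ _ _ _) (f1 _ _ _ _) (f1 _ _ _ _) => y1 y2 y3 y4 h.
  have K (a d : R) : c 0%N ^+ 2 * (2^-1 * (c 0%N)^-1 * a - 2^-1 * (c 0%N)^-1 * d) = 2^-1 * (c 0%N * (a - d)) by field.
  by rewrite K; move: h; lra.
- move=> i j ij; have [_ tri] := E i; have [_ trj] := E j.
  have iN : (i.+1 < N)%N by rewrite ij.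
  have jE : j%:R = i.+1%:R :> R by rewrite ij.
  rewrite trj ?lexx ?jj// jE tri ?lexx ?jj//; apply: part_eqP => b.
  rewrite !partZ !part_cplx -!hc /sl -!ij !slope_left !slope_right.
  (* The coefficients are those of the flux jump [c_i (h_i - f_i) - c_(i+1) (h_(i+1) - f_(i+1))]. *)
  have := @node_relation f0 f1 b i i.+1 (- c i) (c i) (c i.+1) (- c i.+1) t l0 i1 _ t0.
  have hh : forall s : R, 0 < s -> - c i * f0 b false i (s - (c i)^-1) + c i * f0 b true i s +
      c i.+1 * f0 b false i.+1 s + - c i.+1 * f0 b true i.+1 (s - (c i.+1)^-1) = 0.
    by move=> s s0; have := flux0 b s0 iN; move: (f0 _ _ _ _) (f0 _ _ _ _) (f0 _ _ _ _) (f0 _ _ _ _) => *; lra.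
  move=> /(_ hh); have cn k : c k != 0 by rewrite gt_eqF.
  have K k (a d : R) : c k ^+ 2 * ((2 * c k)^-1 * a - (2 * c k)^-1 * d) = 2^-1 * (c k * (a - d)) by field; exact: cn.
  rewrite !K.
  by move: (f1 _ _ _ _) (f1 _ _ _ _) (f1 _ _ _ _) (f1 _ _ _ _) (f1 _ _ _ _) (f1 _ _ _ _) (f1 _ _ _ _) (f1 _ _ _ _) => *; lra.
Qed.

Lemma opA_travel_int t : 0 <= t -> Heq (opA (travel_int t)) (travel t - travel 0).
Proof.
move=> t0 j; have [_ D2 _] := isH1P (diff_isH1 j t l1 i2).
have HD : H1 j ((travel_int t).1 j) by case: (isH1P (diff_isH1 j t l1 i2)).
have [HS S1 _] := isH1P (slope_isH1 j t).
have [_ E _] := H1_ae HS (H1_L2wd HD) (ae_eq_sym D2).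
split; first by apply: aeW => x _; apply: part_eqP => b; rewrite partB !part_cplx.
apply: filterS S1 => x h jx; rewrite /opA /= E (h jx); apply: part_eqP => b.
rewrite partZ partB !part_cplx -hc -mulrBr mulrA -exprMn mulfV ?gt_eqF//.
by rewrite expr1n mul1r.
Qed.

Lemma phase_transport (j : nat) (d : bool) : exists k m, k != 0 /\ forall x, phase (c j) j d x = k * x + m.
Proof.
have cj : (c j)^-1 != 0 by rewrite invr_eq0 gt_eqF.
by case: d; [exists (c j)^-1, (- ((c j)^-1 * j.+1%:R))|exists (- (c j)^-1), ((c j)^-1 * j%:R)];
  split; rewrite ?oppr_eq0.
Qed.

Let eq_leW (a b : R) : a = b -> a <= b. Proof. by move=> ->. Qed.

Lemma travel_delta (M e : R) : 0 < e -> exists2 d : R, 0 < d & forall b a (j : 'I_N) (s r : R),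
  `|s| <= M -> `|r| <= M -> `|s - r| < d ->
  \int[mu]_(x in cell j) ((f0 b a j (s + phase (c j) j a x) - f0 b a j (r + phase (c j) j a x)) ^+ 2) <= e.
Proof.
move=> e0.
pose P (i : bool * bool * 'I_N) (d : R) := forall s r : R, `|s| <= M -> `|r| <= M -> `|s - r| < d ->
  \int[mu]_(x in cell i.2) ((f0 i.1.1 i.1.2 i.2 (s + phase (c i.2) i.2 i.1.2 x) -
     f0 i.1.1 i.1.2 i.2 (r + phase (c i.2) i.2 i.1.2 x)) ^+ 2) <= e.
have [d d0 hd] : exists2 d : R, 0 < d & forall i, P i d; last first.
  by exists d => // b a j; exact: (hd (b, a, j)).
apply: uniform_delta => [i d d' dd h s r sM rM sr|[[b a] j]].
  by apply: h => //; exact: lt_le_trans sr dd.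
have [k [m [k0 E]]] := phase_transport j a.
have [d d0 hd] := transport_continuity m M j (l0 b a j) k0 e0.
exists d => // s r sM rM sr; apply: le_trans (hd s r sM rM sr).
by apply: eq_leW; apply: eq_Rintegral => x _; rewrite /= !E.
Qed.

Lemma transport_eps (n : R) : 0 < n -> exists2 e : R, 0 < e & (4 * N)%:R * e <= n ^+ 2.
Proof.
move=> n0; exists (n ^+ 2 / (4 * N).+1%:R); first by rewrite divr_gt0// exprn_gt0.
rewrite mulrCA ler_piMr ?sqr_ge0// ler_pdivrMr ?ltr0Sn// mul1r ler_nat.
exact: leqnSn.
Qed.

Let sqint_phase b a j t : sqint (cell j) (fun x => f0 b a j (t + phase (c j) j a x)).
Proof. by apply: lsq_cell; exact: lsq_phased. Qed.

Lemma contH_travel : contH rho travel.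
Proof.
apply/contHP => t t0; split; first exact: inH_travel.
move=> n n0; have n2 : 0 < n / 2 by rewrite divr_gt0.
have [e e0 en] := transport_eps n2.
(* Times within 1 of [t] stay below [t + 1], the bound up to which [d] is uniform. *)
have [d d0 hd] := travel_delta (t + 1) e0.
exists (Num.min d 1); first by rewrite lt_min d0 ltr01.
move=> s s0; rewrite lt_min => /andP[sd s1].
apply: (@le_lt_trans _ _ (n / 2)); last by rewrite ltr_pdivrMr// ltr_pMr// ltr1n.
have tM : `|t| <= t + 1 by rewrite ger0_norm// lerDl.
have sM : `|s| <= t + 1 by move: s1; rewrite (ger0_norm s0) ltr_norml => /andP[_]; lra.
have hZ := inHB (inH_travel s0) (inH_travel t0).
apply: (@hnorm_transport _ _ _ hrho c c0 hc _
  (fun b a j x => f0 b a j (s + phase (c j) j a x) - f0 b a j (t + phase (c j) j a x)) e _ hZ (ltW n2) en).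
- by move=> b a j; apply: (sqintB (@measurable_cell R j)); exact: sqint_phase.
- by move=> b a j; exact: hd.
- move=> b j; apply: aeW => x _; rewrite partB !part_cplx /wv /wave.
  by move: (f0 _ _ _ _) (f0 _ _ _ _) (f0 _ _ _ _) (f0 _ _ _ _) => *; ring.
- move=> b j; rewrite Hdiv_lin lin1.
  have [_ W _] := isH1P (isH1_lin (-1) (travel_isH1 j t) (travel_isH1 j s)).
  apply: filterS W => x h jx; rewrite (h jx) partD partZ !part_cplx /sl /slope.
  by move: (f0 _ _ _ _) (f0 _ _ _ _) (f0 _ _ _ _) (f0 _ _ _ _) => *; ring.
Qed.

Lemma inH_travel_int t : 0 <= t -> inH (travel_int t).
Proof. by move=> t0; apply: inDA_inH (inDA_travel_int t0). Qed.

(** The velocity and the space derivative of the displacement have the same invariants [E], namely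
    the length times [f0] minus an increment of [f1]. [transport_average] makes them small relative
    to the length of the interval. *)
Lemma travel_is_intH t : 0 <= t -> is_intH rho travel t (travel_int t).
Proof.
move=> t0; apply: (is_intH_pieces hrho t0 inH_travel inH_travel_int).
  by move=> j; split; apply: aeW => x _; apply: part_eqP => b; rewrite part_cplx subrr part0.
move=> n n0; have [e e0 en] := transport_eps n0.
have [d d0 hd] := travel_delta t e0.
exists d => // p r q p0 pr rq qt qpd.
have pq : p <= q := le_trans pr rq; have qp0 : 0 <= q - p by rewrite subr_ge0.
have r0 := le_trans p0 pr; have q0 := le_trans p0 pq.
have hZ : inH ((q - p)%:C *: travel r - (travel_int q - travel_int p)).
  by apply: inHB; [apply: inHZ; exact: inH_travel|apply: inHB; exact: inH_travel_int].
pose E b a (j : 'I_N) x := (q - p) * f0 b a j (r + phase (c j) j a x) -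
  (f1 b a j (q + phase (c j) j a x) - f1 b a j (p + phase (c j) j a x)).
apply: (@hnorm_transport _ _ _ hrho c c0 hc _ E ((q - p) ^+ 2 * e) _ hZ).
- by apply: mulr_ge0 => //; exact: ltW.
- by rewrite exprMn mulrCA ler_wpM2l// sqr_ge0.
- move=> b a j; have mc := @measurable_cell R j.
  apply: (sqintB mc); first by apply: (sqintZ _ mc); exact: sqint_phase.
  by apply: (sqintB mc); apply: lsq_cell; exact: lsq_phased.
- move=> b a j; have [k [m [k0 Ek]]] := phase_transport j a.
  have := @transport_average R (f0 b a j) (f1 b a j) k m p r q e j (l0 _ _ _) (i1 _ _ _) k0 (ltW e0) pq _.
  rewrite mulrA -expr2 => H; apply: le_trans (H _).
    apply: eq_leW; apply: eq_Rintegral => x _; rewrite /E !Ek -sqrrN; congr (_ ^+ 2).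
    by move: (f0 _ _ _ _) (f1 _ _ _ _) (f1 _ _ _ _) => *; ring.
  move=> s /andP[ps sq]; have h := hd b a j s r.
  apply: le_trans (h _ _ _).
  + by apply: eq_leW; apply: eq_Rintegral => x _; rewrite !Ek.
  + by rewrite ger0_norm ?(le_trans p0 ps)// (le_trans sq).
  + by rewrite ger0_norm// (le_trans rq).
  + by apply: le_lt_trans qpd; rewrite ler_norml; apply/andP; split; lra.
- move=> b j; apply: aeW => x _; rewrite partB partZ partB !part_cplx /E /wv /wave.
  by move: (f0 _ _ _ _) (f0 _ _ _ _) (f1 _ _ _ _) (f1 _ _ _ _) (f1 _ _ _ _) (f1 _ _ _ _)
    (f1 _ _ _ _) (f1 _ _ _ _) => *; ring.
- move=> b j.
  (* Only combinations of the form [a *: _ + _] remain, so that [isH1_lin] gives the space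
     derivative term by term. *)
  have -> : (q - p)%:C *: travel r - (travel_int q - travel_int p) =
     (-1)%:C *: ((-1)%:C *: travel_int p + travel_int q) + ((q - p)%:C *: travel r + 0).
    by rewrite addr0 -!Hdiv_lin.
  rewrite !lin1.
  have [_ W _] := isH1P (isH1_lin (-1) (isH1_lin (-1) (diff_isH1 j p l1 i2) (diff_isH1 j q l1 i2))
    (isH1_lin (q - p) (travel_isH1 j r) (@isH1_0 R j))).
  apply: filterS W => x h jx; rewrite (h jx) !(partD, partZ, part_cplx, part0) /E /sl /slope.
  by move: (f0 _ _ _ _) (f0 _ _ _ _) (f1 _ _ _ _) (f1 _ _ _ _) (f1 _ _ _ _) (f1 _ _ _ _)
    (f1 _ _ _ _) (f1 _ _ _ _) => *; ring.
Qed.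

Lemma travel_mild (X0 : state R N) : Heq (travel 0) X0 -> mild_solution rho X0 travel.
Proof.
move=> h0; split; [exact: contH_travel|exact: h0|].
move=> t t0; exists (travel_int t); split; [exact: travel_is_intH|exact: inDA_travel_int|].
apply: Heq_sym; apply: (Heq_trans (HeqD (Heq_sym h0) (opA_travel_int t0))).
by rewrite addrC subrK; exact: Heq_refl.
Qed.

End DAlembert.



(** * Signals of an initial datum and existence *)

Section Existence.
Import numFieldNormedType.Exports.
Local Open Scope classical_set_scope.
Local Open Scope complex_scope.
Context {R : realType} {N : nat} (rho : 'I_N -> R) (hrho : forall j, 0 < rho j).

(** The default 1 keeps speeds and delays positive at every natural index, as the signals
    require. *)
Definition speed (j : nat) : R := oapp (fun i => Num.sqrt (rho i)) 1 (insub j).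

Lemma speed_gt0 j : 0 < speed j.
Proof. by rewrite /speed; case: insubP => [i _ _|_] //=; rewrite sqrtr_gt0. Qed.

Lemma speed_sqr (j : 'I_N) : speed j ^+ 2 = rho j.
Proof. by rewrite /speed valK /= sqr_sqrtr// ltW. Qed.

(** A common lower bound for all delays; the summand 1 covers the default speed. *)
Definition min_delay : R := (1 + \sum_i Num.sqrt (rho i))^-1.

Lemma sum_sqrt_ge0 : 0 <= \sum_i Num.sqrt (rho i).
Proof. by apply: sumr_ge0 => i _; exact: sqrtr_ge0. Qed.

Lemma min_delay_gt0 : 0 < min_delay.
Proof. by rewrite invr_gt0 ltr_wpDr// sum_sqrt_ge0. Qed.

Lemma min_delay_le j : min_delay <= (speed j)^-1.
Proof.
have S := sum_sqrt_ge0; have sp := speed_gt0 j.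
rewrite lef_pV2 ?posrE ?ltr_wpDr//.
rewrite /speed; case: insubP => [i _ _|_] /=; last by rewrite lerDl.
by rewrite (bigD1 i)//= addrCA lerDl addr_ge0// sumr_ge0.
Qed.

Variable X0 : state R N.
Hypothesis hX : inH X0.

(* The Riemann invariants v - c u' (d = false) and v + c u' (d = true). *)
Definition invariant (b d : bool) (i : 'I_N) : R -> R :=
  (fun x => part b (X0.2 i x) + (if d then speed i else - speed i) * part b (wd i (X0.1 i) x)) \_
  (`[i%:R, i.+1%:R]%classic).

(** The datum read as signals emitted in the past: what left the node at time [s <= 0] has, at time
    0, covered the distance [- s] times the speed. The affine map is the inverse of [phase]. *)
Definition past (b d : bool) (j : nat) (s : R) : R :=
  oapp (fun i => invariant b d i ((if d then speed j else - speed j) * s + (if d then j.+1%:R else j%:R)))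
    0 (insub j).

Lemma past_sqint b d j : sqint setT (past b d j).
Proof.
rewrite /past; case: insubP => [i _ _|_] /=; last first.
  split; first exact: measurable_cst.
  by under eq_fun do rewrite expr0n; exact: integrable0.
have mI : measurable (`[i%:R, i.+1%:R]%classic : set (measurableTypeR R)) by exact: measurable_itv.
apply: sqint_affine; first by case: d; rewrite ?oppr_eq0 gt_eqF// speed_gt0.
apply: sqint_restrict => //; apply/sqint_cellP; have mc := @measurable_cell R i.
have [[Hu _ _] Lv] := hX; apply: (sqintD mc); first exact: (L2_part _ _).1.
by apply: (sqintZ _ mc); apply: (L2_part _ _).1; exact: H1_L2wd.
Qed.

Definition sig0 b : bool -> nat -> R -> R := signal N speed min_delay (past b).

Lemma sig0_lsq b d j : lsq (sig0 b d j).
Proof.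
by apply: signal_lsq; [exact: min_delay_gt0|exact: min_delay_le|exact: past_sqint].
Qed.

Definition left_value b j : R := oapp (fun i : 'I_N => part b (trace i (X0.1 i) i%:R)) 0 (insub j).

(** At time 0 the left node sees the two primitives at the arguments 0 and [- 1 / c]. Giving both
    the value of the trace there makes their half sum that trace. *)
Lemma exists_sig1 : exists f1 : bool -> bool -> nat -> R -> R,
  forall b d j, isprim (f1 b d j) (sig0 b d j) /\
    f1 b d j (if d then 0 - (speed j)^-1 else 0) = left_value b j.
Proof.
have H (k : bool * bool * nat) : exists F, isprim F (sig0 k.1.1 k.1.2 k.2) /\
    F (if k.1.2 then 0 - (speed k.2)^-1 else 0) = left_value k.1.1 k.2.
  have [F PF _] := exists_prim 0 (sig0_lsq k.1.1 k.1.2 k.2).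
  set s := (if _ then _ else _); exists (fun x => F x - F s + left_value k.1.1 k.2).
  split; last by rewrite subrr add0r.
  by move=> a b ab; rewrite opprD addrACA subrr addr0 opprB addrA subrK; exact: PF.
have [f hf] := choice H; exists (fun b d j => f (b, d, j)) => b d j.
exact: (hf (b, d, j)).
Qed.

Lemma exists_sig2 (f1 : bool -> bool -> nat -> R -> R) : (forall b d j, lsq (f1 b d j)) ->
  exists f2 : bool -> bool -> nat -> R -> R, forall b d j, isprim (f2 b d j) (f1 b d j).
Proof.
move=> l1; have H (k : bool * bool * nat) : exists F, isprim F (f1 k.1.1 k.1.2 k.2).
  by have [F PF _] := exists_prim 0 (l1 k.1.1 k.1.2 k.2); exists F.
have [f hf] := choice H; exists (fun b d j => f (b, d, j)) => b d j.
exact: (hf (b, d, j)).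
Qed.

(** Both phases are nonpositive on the closed cell, so at time 0 only the past signals are seen. *)
Lemma sig0_phase b d (i : 'I_N) x : i%:R <= x <= i.+1%:R ->
  sig0 b d i (0 + phase (speed i) i d x) =
  part b (X0.2 i x) + (if d then speed i else - speed i) * part b (wd i (X0.1 i) x).
Proof.
move=> xi; have [x1 x2] := andP xi; have sp := speed_gt0 i; have sn : speed i != 0 by rewrite gt_eqF.
have ph0 : phase (speed i) i d x <= 0.
  case: d; rewrite /phase.
    by rewrite -mulrBr mulr_ge0_le0// ?invr_ge0 ?(ltW sp)// subr_le0.
  by rewrite mulNr addrC -mulrBr mulr_ge0_le0// ?invr_ge0 ?(ltW sp)// subr_le0.
rewrite add0r /sig0 signal_le0 ?min_delay_gt0 ?min_delay_le//; last exact: min_delay_le.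
rewrite /past valK /= /invariant.
have -> : (if d then speed i else - speed i) * phase (speed i) i d x + (if d then i.+1%:R else i%:R) = x.
  by case: d {ph0}; rewrite /phase; field.
by rewrite patchE mem_set//= in_itv.
Qed.

Lemma mild_exists : exists U, mild_solution rho X0 U.
Proof.
have [f1 hf1] := exists_sig1.
have i1 b d j : isprim (f1 b d j) (sig0 b d j) by case: (hf1 b d j).
have l1 b d j : lsq (f1 b d j) := isprim_lsq (sig0_lsq b d j) (i1 b d j).
have [f2 i2] := exists_sig2 l1.
have [[Hu bN ci] Lv] := hX.
have jj (j : nat) : j%:R <= j.+1%:R :> R by exact/ltW/natS_gt.
have wv0 b (i : 'I_N) x : i%:R <= x <= i.+1%:R -> wv speed sig0 b i 0 x = part b (X0.2 i x).
  move=> xi; rewrite /wv /wave !sig0_phase//.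
  by move: (part _ _) (part _ _) => *; lra.
have sl0 b (i : 'I_N) x : i%:R <= x <= i.+1%:R -> sl speed sig0 b i 0 x = part b (wd i (X0.1 i) x).
  move=> xi; rewrite /sl /slope !sig0_phase//; have sn : speed i != 0 by rewrite gt_eqF// speed_gt0.
  by move: (part _ _) (part _ _) => y z; field.
(* Both sides are primitives of the derivative of the datum with the same value at the left node.
   Equality on the closed cell yields the node conditions at time 0. *)
have wv1 b (i : 'I_N) x : i%:R <= x <= i.+1%:R ->
    wv speed f1 b i 0 x = part b (trace i (X0.1 i) x).
  move=> xi; have [x1 x2] := andP xi.
  have /isH1_part[_ _ _ P] := H1_isH1 (Hu i).
  have P1 := @wv_primitive R speed speed_gt0 sig0 f1 b i 0 sig0_lsq i1.
  rewrite (P1 x xi) (P b x xi); congr (_ + _).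
    have [_ e1] := hf1 b false i; have [_ e2] := hf1 b true i.
    rewrite /wv wave_left e1 e2 /left_value valK /=.
    by move: (part _ _) => y; lra.
  apply: eq_Rintegral => y; rewrite inE /= in_itv /= => /andP[y1 y2].
  by apply: sl0; rewrite y1 (le_trans y2).
exists (travel speed sig0 f1).
apply: (@travel_mild _ _ rho hrho speed speed_gt0 speed_sqr sig0 f1 f2 sig0_lsq i1 i2).
- move=> b s s0 j jN; rewrite /wv wave_right.
  rewrite (@signal_end R N speed min_delay speed_gt0 min_delay_gt0 min_delay_le) ?mulr0//.
- move=> b s s0 j jN; rewrite /wv wave_right wave_left; congr (_ * _).
  apply: (@signal_continuity R N speed min_delay speed_gt0 min_delay_gt0 min_delay_le) => //.
  by rewrite neq_ltn jN.
- move=> b s s0.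
  exact: (@signal_damped R N speed min_delay speed_gt0 min_delay_gt0 min_delay_le).
- move=> b s j s0 jN.
  apply: (@signal_flux R N speed min_delay speed_gt0 min_delay_gt0 min_delay_le) => //.
  by rewrite neq_ltn jN.
- move=> b j jN; have jlt : (j < N)%N by rewrite -jN.
  have jE : j.+1%:R = N%:R :> R by rewrite jN.
  have := wv1 b (Ordinal jlt) j.+1%:R; rewrite /= lexx jj => -> //.
  by have := bN (Ordinal jlt) jN; rewrite /= jE => ->; rewrite part0.
- move=> b j jN; have jlt : (j < N)%N by exact: ltn_trans jN.
  have := wv1 b (Ordinal jlt) j.+1%:R; rewrite /= lexx jj => -> //.
  have := wv1 b (Ordinal jN) j.+1%:R; rewrite /= lexx jj => -> //.
  by have := ci (Ordinal jlt) (Ordinal jN) erefl; rewrite /= => ->.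
- move=> i; split.
    have [_ _ wu _ _] := H1_isH1 (Hu i).
    apply: filterS wu => x h ix; rewrite -(h ix); apply: part_eqP => b.
    rewrite part_cplx wv1//; move: ix; rewrite /cell /= in_itv /= => /andP[x1 x2].
    by rewrite !ltW.
  apply: aeW => x; rewrite /cell /= in_itv /= => /andP[x1 x2]; apply: part_eqP => b.
  by rewrite part_cplx wv0// !ltW.
Qed.

End Existence.

(** * Derivative and decay of the energy *)

Section EnergyDecay.
Context {R : realType} {N : nat} (hN : (0 < N)%N) (rho : 'I_N -> R) (hrho : forall j, 0 < rho j).

Lemma classical_inH (U : R -> state R N) t : classical rho U -> 0 <= t -> inH (U t).
Proof. by move=> cU t0; have [dU _] := cU t t0; exact: (inDA_inH dU). Qed.

Lemma energy_diffR (U : R -> state R N) (t : R) : classical rho U -> 0 <= t ->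
  diffR (energy rho U) t (- Normc.normc (trace 0 ((U t).2 (Ordinal hN)) 0) ^+ 2).
Proof.
move=> cU t0 e e0; have [d d0 hd] := classical_diffR hN hrho cU t0 e0.
exists d => // s s0 st; have /= := hd s s0 st.
rewrite (energyE hrho (classical_inH cU s0)) (energyE hrho (classical_inH cU t0)).
set z := _ ^+ 2; set x := hip _ _ _; set y := hip _ _ _ => h.
have -> : 2^-1 * x - 2^-1 * y - (s - t) * - z = 2^-1 * (x - y - (s - t) * (-2 * z)) by field.
rewrite normrM ger0_norm ?invr_ge0// (le_trans _ h)//.
by rewrite ler_piMl// invf_le1// ler1n.
Qed.

Lemma energy_nonincreasing (U : R -> state R N) (s t : R) : classical rho U ->
  0 <= s -> s <= t -> energy rho U t <= energy rho U s.
Proof.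
move=> cU s0 st; have t0 := le_trans s0 st.
rewrite (energyE hrho (classical_inH cU s0)) (energyE hrho (classical_inH cU t0)).
by rewrite ler_wpM2l ?invr_ge0//; exact: (classical_nonincreasing hN hrho cU s0 st).
Qed.

End EnergyDecay.

Theorem proposition2p1 (R : realType) (N : nat) (hN : (0 < N)%N)
    (rho : 'I_N -> R) (hrho : forall j, 0 < rho j) :
  (forall U0 : state R N, inH U0 ->
     (exists U : R -> state R N, mild_solution rho U0 U) /\
     (forall U W : R -> state R N,
        mild_solution rho U0 U -> mild_solution rho U0 W ->
        forall t : R, 0 <= t -> Heq (U t) (W t)) /\
     (inDA rho U0 ->
        forall U : R -> state R N, mild_solution rho U0 U ->
          [/\ contDA rho U, C1H rho U &
              forall t : R, 0 <= t -> derivH rho U t (opA rho (U t))]))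
  /\
  (forall (U0 : state R N) (U : R -> state R N),
     inDA rho U0 -> mild_solution rho U0 U ->
     (forall t : R, 0 <= t ->
        let E' := - Normc.normc (trace 0 ((U t).2 (Ordinal hN)) 0) ^+ 2 in
        derivR (energy rho U) t E' /\ E' <= 0) /\
     (forall s t : R, 0 <= s -> s <= t -> energy rho U t <= energy rho U s)).
Proof.
split=> [U0 hU0|U0 U dU0 mU].
  split; first exact: (mild_exists hrho hU0).
  split; first by move=> U W mU mW t; exact: (mild_unique hN hrho mU mW).
  move=> dU0 U mU; have [V mV] := mild_exists hrho (opA_inH dU0).
  exact: (mild_regular hN hrho dU0 mU mV).
have [V mV] := mild_exists hrho (opA_inH dU0).
have [cU _] := mild_classical hN hrho dU0 mU mV.
split=> [t t0 /=|s t]; last exact: (energy_nonincreasing hN hrho cU).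
split; first exact: diffR_derivR (energy_diffR hN hrho cU t0).
by rewrite oppr_le0 sqr_ge0.
Qed.
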